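(* Let $X$ be a globally hyperbolic regular Lorentzian length space. If $X$ is locally concave and future one-connected, then every pair of timelike related points $x\ll y$ in $X$ is connected by a unique timelike geodesic, and these geodesics vary continuously with their endpoints.
   Context: A Lorentzian pre-length space is a tuple $(X,d,\ll,\leq,\tau)$ where $(X,d)$ is a metric space (all topological notions refer to $d$), $\leq$ is a reflexive transitive relation (causal relation), $\ll$ is a transitive relation contained in $\leq$ (timelike relation), and $\tau\colon X\times X\to[0,\infty]$ (time separation) is lower semicontinuous with $\tau(x,z)\geq\tau(x,y)+\tau(y,z)$ for $x\leq y\leq z$, and $\tau(x,y)>0$ iff $x\ll y$. Put $I^+(x)=\{y: x\ll y\}$, $I^-(x)=\{y: y\ll x\}$, $J^\pm(x)$ likewise with $\leq$, $I(x,y)=I^+(x)\cap I^-(y)$, $J(x,y)=J^+(x)\cap J^-(y)$; $x<y$ means $x\le y$, $x\neq y$. Curves. A non-constant, locally Lipschitz curve $\gamma$ on an interval is future-directed causal (timelike) if $\gamma(t_1)\leq\gamma(t_2)$ (resp. $\gamma(t_1)\ll\gamma(t_2)$) whenever $t_1<t_2$; past-directed curves are defined by reversing the relations. The length $L(\gamma)$ of a future-directed causal curve is $\inf\sum_{i}\tau(\gamma(t_{i-1}),\gamma(t_i))$ over all partitions of its domain. A maximizer is a future-directed causal curve $\gamma$ from $x$ to $y$ with $L(\gamma)=\tau(x,y)$ (similarly, with time reversed, for past-directed curves). A geodesic is a causal curve that is locally a maximizer: every parameter has a neighborhood in the domain on which the restriction is a maximizer. Timelike maximizers and timelike geodesics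 are taken with constant-speed parametrization ($\tau$-length from the initial point proportional to the parameter), and uniqueness of such curves is understood up to reparametrization. $X$ is regular if every maximizer between timelike related points is timelike. $X$ is globally hyperbolic if all causal diamonds $J(x,y)$ are compact and for every compact $K\subseteq X$ there is a constant $C(K)$ bounding the $d$-arclength of all causal curves contained in $K$. $X$ is locally causally closed if every point has a neighborhood $U$ such that $p_n\leq q_n$, $p_n,q_n\in U$, $p_n\to p\in\overline U$, $q_n\to q\in\overline U$ imply $p\leq q$. $X$ is causally path-connected if any $x\ll y$ are joined by a future-directed timelike curve and any $x<y$ by a future-directed causal curve. $X$ is localizable if every $x\in X$ has an open neighborhood $\Omega$ such that: there is $C>0$ bounding the $d$-arclength of all causal curves in $\Omega$; there is a continuous $\omega\colon\Omega\times\Omega\to[0,\infty)$ making $\Omega$ (with restricted $d,\ll,\leq$ and with $\omega$ as time separation) a Lorentzian pre-length space with $I^\pm(y)\cap\Omega\neq\varnothing$ for all $y\in\Omega$; and for all $p<q$ in $\Omega$ there is a future-directed causal curve from $p$ to $q$ in $\Omega$ which is of maximal length among such curves in $\Omega$ and whose length equals $\omega(p,q)\leq\tau(p,q)$. A Lorentzian length space is a locally causally closed, causally path-connected, localizable Lorentzian pre-length space with $\tau(x,y)=\sup\{L(\gamma): \gamma$ future-directed causal from $x$ to $y\}$ (sup of the empty set being $0$). $X$ is locally concave if every point has a neighborhood $U$ (a comparison neighborhood) such that: (1) $\tau|_{U\times U}$ is continuous; (2) for all $x,y\in U$ with $x\ll y$ there is a future-directed causal curve from $x$ to $y$ within $U$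 of length $\tau(x,y)$; (3) for any two timelike maximizers $\alpha,\beta\colon[0,1]\to U$ with the same time orientation such that [$\alpha(0)\ll\beta(0)$ or $\alpha(0)=\beta(0)$] and [$\alpha(1)\ll\beta(1)$ or $\alpha(1)=\beta(1)$], one has $\tau(\alpha(t),\beta(t))\geq t\,\tau(\alpha(1),\beta(1))+(1-t)\,\tau(\alpha(0),\beta(0))$ for all $t\in[0,1]$. A timelike homotopy between future-directed timelike curves $\gamma_0,\gamma_1\colon[0,1]\to X$ is a continuous map $H\colon[0,1]^2\to X$ with $H(0,\cdot)=\gamma_0$, $H(1,\cdot)=\gamma_1$ and every $H(s,\cdot)$ future-directed timelike. $X$ is future one-connected if any $x\ll y$ are joined by a future-directed timelike curve and any two future-directed timelike curves with common endpoints are timelike homotopic with fixed endpoints. When each $x\ll y$ is joined by a unique timelike geodesic $\gamma_{xy}\colon[0,1]\to X$, ''geodesics vary continuously with their endpoints'' means that $(x,y,t)\mapsto\gamma_{xy}(t)$ is continuous on $\{(x,y): x\ll y\}\times[0,1]$. *)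

(* Defs.v *)
From HB Require Import structures.
From mathcomp Require Import all_boot all_order all_algebra.
From mathcomp Require Import all_classical all_reals all_analysis.

Set Implicit Arguments.
Unset Strict Implicit.
Unset Printing Implicit Defensive.

Import Order.TTheory GRing.Theory Num.Theory.
Import numFieldNormedType.Exports.

Local Open Scope classical_set_scope.
Local Open Scope ring_scope.

(* The metric [d] is carried by the [metricType]; the three fields are the
   causal relation, the timelike relation and the time separation. *)
Record causal_data (R : realType) (X : Type) := CausalData {
  cle : X -> X -> Prop;
  cll : X -> X -> Prop;
  tau : X -> X -> \bar R }.

(* Past-directed notions are the future-directed ones for the reversed data. *)
Definition reverse (R : realType) (X : Type) (S : causal_data R X) :=
  CausalData (fun x y => cle S y x) (fun x y => cll S y x)
             (fun x y => tau S y x).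

Section PreLength.
Context (R : realType) (X : metricType R).
Implicit Types (S : causal_data R X) (x y z : X) (A : set X).

(* The set [A], with the restrictions of [d] and of the data [S], is a
   Lorentzian pre-length space. In the topology of [subspace B] the points
   outside [B] are isolated, so semicontinuity is only required on [A `*` A]. *)
Definition pre_length_on A S : Prop :=
  [/\ (forall x, A x -> cle S x x) /\
      (forall x y z, A x -> A y -> A z ->
         cle S x y -> cle S y z -> cle S x z),
      (forall x y z, A x -> A y -> A z ->
         cll S x y -> cll S y z -> cll S x z) /\
      (forall x y, A x -> A y -> cll S x y -> cle S x y),
      (forall x y, A x -> A y -> (0 <= tau S x y)%E) /\
      lower_semicontinuous
        (fun p : subspace (A `*` A) => tau S p.1 p.2),
      (forall x y z, A x -> A y -> A z -> cle S x y -> cle S y z ->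
         (tau S x y + tau S y z <= tau S x z)%E)
    & (forall x y, A x -> A y -> ((0 < tau S x y)%E <-> cll S x y))].

Definition lorentzian_pre_length S : Prop := pre_length_on setT S.

Definition chron_future S x : set X := [set y | cll S x y].
Definition chron_past S x : set X := [set y | cll S y x].
Definition diamond S x y : set X := [set z | cle S x z /\ cle S z y].

Implicit Types (D : set R) (g h c : R -> X) (a b : R).

(* Curves are total functions on [R]; only their values on the domain [D]
   (or [`[a, b]]) matter. *)

Definition locally_lipschitz D g : Prop :=
  forall t, D t -> exists k : R, exists2 V : set R, nbhs t V &
    forall r s, V r -> D r -> V s -> D s ->
      mdist (g r) (g s) <= k * `|r - s|.

Definition nonconstant D g : Prop :=
  exists r s, [/\ D r, D s & g r <> g s].

Definition curve D g : Prop :=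
  [/\ is_interval D, nonconstant D g & locally_lipschitz D g].

Definition future_causal S D g : Prop :=
  curve D g /\ forall s t, D s -> D t -> s < t -> cle S (g s) (g t).

Definition future_timelike S D g : Prop :=
  curve D g /\ forall s t, D s -> D t -> s < t -> cll S (g s) (g t).

Definition causal_curve S D g : Prop :=
  future_causal S D g \/ future_causal (reverse S) D g.

Definition causal_from_to S x y a b g : Prop :=
  [/\ future_causal S `[a, b] g, g a = x & g b = y].

Definition timelike_from_to S x y a b g : Prop :=
  [/\ future_timelike S `[a, b] g, g a = x & g b = y].

Definition contained D g A : Prop := g @` D `<=` A.

Definition partition_sum (f : X -> X -> \bar R) a b g (s : seq R) : \bar R :=
  (\sum_(0 <= n < size s)
     f (g (nth b (a :: s) n)) (g (nth b (a :: s) n.+1)))%E.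

Definition curve_length S a b g : \bar R :=
  ereal_inf [set partition_sum (tau S) a b g s | s in itv_partition a b].

(* The [d]-arclength, for a domain that need not be compact. *)
Definition arclength D g : \bar R :=
  ereal_sup [set l | exists a b s, [/\ D a, D b, itv_partition a b s &
    l = partition_sum (fun x y => (mdist x y)%:E) a b g s]].

Definition maximizer S a b g : Prop :=
  future_causal S `[a, b] g /\ curve_length S a b g = tau S (g a) (g b).

Definition geodesic S a b g : Prop :=
  future_causal S `[a, b] g /\
  forall t, t \in `[a, b] -> exists a' b',
    [/\ [set` `[a', b']] `<=` `[a, b],
        within `[a, b] (nbhs t) [set` `[a', b']] & maximizer S a' b' g].

Definition timelike_geodesic S x y a b g : Prop :=
  timelike_from_to S x y a b g /\ geodesic S a b g.

(* [g], on [`[a, b]], is a reparametrization of [h], on [`[a', b']]. *)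
Definition reparametrization a b g a' b' h : Prop :=
  exists phi : R -> R,
    [/\ {within `[a, b], continuous phi},
        {in `[a, b] &, {homo phi : s t / s <= t}},
        phi a = a', phi b = b' &
        forall t, t \in `[a, b] -> g t = h (phi t)].

Definition constant_speed S c : Prop :=
  exists v : R, forall t, t \in `[0, 1] -> curve_length S 0 t c = (v * t)%:E.

(* The constant-speed parametrization of a locally Lipschitz timelike curve is
   continuous but in general not locally Lipschitz for [d], so the Lipschitz
   condition is put on some parametrization [g] of the same curve. *)
Definition cs_timelike_maximizer S c : Prop :=
  constant_speed S c /\
  exists a b g, [/\ future_timelike S `[a, b] g, maximizer S a b g &
                    reparametrization 0 1 c a b g].

Definition cs_timelike_geodesic S x y c : Prop :=
  constant_speed S c /\
  exists a b g, timelike_geodesic S x y a b g /\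
                reparametrization 0 1 c a b g.

(* A maximizer may pause, i.e. be constant on a subinterval, and is then never
   literally timelike; being timelike is therefore understood, as for
   uniqueness, up to reparametrization. *)
Definition regular S : Prop :=
  forall x y a b g, cll S x y -> causal_from_to S x y a b g ->
    maximizer S a b g ->
    exists a' b' h, future_timelike S `[a', b'] h /\
                    reparametrization a b g a' b' h.

Definition globally_hyperbolic S : Prop :=
  (forall x y, compact (diamond S x y)) /\
  (forall K : set X, compact K -> exists C : R, forall D g,
     causal_curve S D g -> contained D g K -> (arclength D g <= C%:E)%E).

Definition locally_causally_closed S : Prop :=
  forall x, exists2 U, nbhs x U &
    forall (p q : nat -> X) (p0 q0 : X),
      (forall n, [/\ U (p n), U (q n) & cle S (p n) (q n)]) ->
      closure U p0 -> closure U q0 ->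
      p @ \oo --> p0 -> q @ \oo --> q0 -> cle S p0 q0.

Definition causally_path_connected S : Prop :=
  (forall x y, cll S x y -> exists a b g, timelike_from_to S x y a b g) /\
  (forall x y, cle S x y -> x <> y ->
     exists a b g, causal_from_to S x y a b g).

Definition localizable S : Prop :=
  forall x, exists Om : set X, [/\ open Om, Om x,
    (exists2 C : R, 0 < C & forall D g,
       causal_curve S D g -> contained D g Om -> (arclength D g <= C%:E)%E) &
    exists om : X -> X -> R,
      [/\ {within Om `*` Om, continuous (fun p : X * X => om p.1 p.2)},
          pre_length_on Om
            (CausalData (cle S) (cll S) (fun p q => (om p q)%:E)),
          (forall y, Om y -> chron_future S y `&` Om !=set0 /\
                             chron_past S y `&` Om !=set0) &
          forall p q, Om p -> Om q -> cle S p q -> p <> q ->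
            (exists a b g,
              [/\ causal_from_to S p q a b g, contained `[a, b] g Om,
                  (forall a' b' h, causal_from_to S p q a' b' h ->
                     contained `[a', b'] h Om ->
                     (curve_length S a' b' h <= curve_length S a b g)%E) &
                  curve_length S a b g = (om p q)%:E]) /\
            ((om p q)%:E <= tau S p q)%E]].

(* Adding [0] makes the supremum over the empty set equal to [0]; it is harmless
   otherwise as lengths are nonnegative. *)
Definition lorentzian_length_space S : Prop :=
  [/\ lorentzian_pre_length S,
      locally_causally_closed S,
      causally_path_connected S,
      localizable S &
      forall x y, tau S x y =
        ereal_sup (0%E |` [set l | exists a b g,
          causal_from_to S x y a b g /\ l = curve_length S a b g])].

Definition cll_or_eq S x y : Prop := cll S x y \/ x = y.

Definition comparison_neighborhood S (U : set X) : Prop :=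
  [/\ {within U `*` U, continuous (fun p : X * X => tau S p.1 p.2)},
      (forall x y, U x -> U y -> cll S x y -> exists a b g,
         [/\ causal_from_to S x y a b g, contained `[a, b] g U &
             curve_length S a b g = tau S x y]) &
      forall al be : R -> X,
        (cs_timelike_maximizer S al /\ cs_timelike_maximizer S be) \/
        (cs_timelike_maximizer (reverse S) al /\
         cs_timelike_maximizer (reverse S) be) ->
        contained `[0, 1] al U -> contained `[0, 1] be U ->
        cll_or_eq S (al 0) (be 0) -> cll_or_eq S (al 1) (be 1) ->
        forall t : R, t \in `[0, 1] ->
          (t%:E * tau S (al 1%R) (be 1%R)
             + (1 - t)%:E * tau S (al 0%R) (be 0%R)
             <= tau S (al t) (be t))%E].

Definition locally_concave S : Prop :=
  forall x, exists2 U, nbhs x U & comparison_neighborhood S U.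

Definition timelike_homotopy S g0 g1 (H : R * R -> X) : Prop :=
  [/\ {within [set` `[0, 1]] `*` [set` `[0, 1]], continuous H},
      (forall t, t \in `[0, 1] -> H (0, t) = g0 t),
      (forall t, t \in `[0, 1] -> H (1, t) = g1 t) &
      forall s, s \in `[0, 1] -> future_timelike S `[0, 1] (fun t => H (s, t))].

Definition future_one_connected S : Prop :=
  (forall x y, cll S x y -> exists a b g, timelike_from_to S x y a b g) /\
  (forall x y g0 g1,
     timelike_from_to S x y 0 1 g0 -> timelike_from_to S x y 0 1 g1 ->
     exists2 H, timelike_homotopy S g0 g1 H &
       forall s, s \in `[0, 1] -> H (s, 0) = x /\ H (s, 1) = y).

(* Every timelike geodesic from [x] to [y], in whatever parametrization, is a
   reparametrization of [c]. *)
Definition unique_timelike_geodesic S x y c : Prop :=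
  cs_timelike_geodesic S x y c /\
  forall a b g, timelike_geodesic S x y a b g ->
    reparametrization a b g 0 1 c.

End PreLength.

(* Main.v *)
Require Import Defs.
From mathcomp Require Import all_boot all_order all_algebra.
From mathcomp Require Import all_classical all_reals all_analysis.
From mathcomp Require Import ring lra.

Import Order.TTheory GRing.Theory Num.Theory.
Import numFieldNormedType.Exports.

Local Open Scope classical_set_scope.
Local Open Scope ring_scope.

Set Implicit Arguments.
Unset Strict Implicit.
Unset Printing Implicit Defensive.

(** The proof continues geodesics along the given timelike curves, in the manner
    of the Cartan-Hadamard theorem.  Concavity, propagated along chains of small
    comparison neighborhoods, shows that near a timelike geodesic two geodesics
    stay causally ordered as soon as their endpoints are; hence geodesics near a
    given one are determined by their endpoints, and they exist for all nearby
    endpoints, as fixed points of a midpoint iteration squeezed between a lower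
    and an upper barrier.  Given curves [H s] issuing from [x], the set of
    parameters [t] up to which there are geodesics from [x] to the points
    [H s t'], [t' <= t], depending continuously on [(s, t')], is thus open.  It is
    closed because all these geodesics lie in a compact causal diamond: an
    ultrafilter limit of geodesics is again a geodesic, the speeds being bounded
    since a limit causal curve cannot jump.  A constant family gives existence.
    For two geodesics between the same endpoints a timelike homotopy gives a
    continuous family of geodesics with fixed endpoints connecting them, and such
    a family is constant by local uniqueness. *)

(** * Real induction, clamping and limits in metric spaces *)

(** The definitions speak of [d]-Lipschitz curves, but constant-speed parametrizations and limits of
    geodesics need not be Lipschitz. The core therefore works with continuous maps along which [tau]
    is affine, on all of [[0, 1]] ([lin]) or on short windows ([tg]). This condition passes to
    limits. The translation to and from Lipschitz curves, where regularity enters, is confined to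
    the final sections. Two obstacles shape the argument. Concavity bounds separations from below
    and accepts only ends that are timelike related or equal, so distances between geodesics cannot
    be estimated as in nonpositive curvature. Order takes the place of distance: geodesics lying
    mutually below each other agree by antisymmetry, and merely causal ends are made timelike by
    cutting one geodesic at its end and the other at its start. Second, a limit of timelike
    geodesics might become null or infinitely fast. A lower speed bound is carried along the lift,
    and an upper one comes from compactness. Antisymmetry and closedness of the order, used
    throughout, are derived from global hyperbolicity. *)

Section RealLine.
Context {R : realType}.

(** Connectedness of the segment, packaged as an induction: the supremum of the parameters up to
    which [P] holds throughout is reached by the last hypothesis and overstepped by the previous
    one, unless it is [b]. *)
Lemma real_ind (P : R -> Prop) (a b : R) : a <= b -> P a ->
  (forall t, a <= t -> t < b -> P t ->
     exists2 e, 0 < e & forall u, t < u -> u < t + e -> u <= b -> P u) ->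
  (forall t, a < t -> t <= b -> (forall u, a <= u -> u < t -> P u) -> P t) ->
  forall t, a <= t -> t <= b -> P t.
Proof.
move=> ab Pa Pr Pl.
pose A := [set t | [/\ a <= t, t <= b & forall u, a <= u -> u <= t -> P u]].
have Aa : A a by split=> // u au ua; have -> : u = a by apply/le_anti/andP.
have hA : has_sup A by split; [exists a|exists b => t []].
have as_ : a <= sup A by apply: ub_le_sup => //; case: hA.
have sb : sup A <= b by apply: ge_sup => [|t []//]; exists a.
have Ps u : a <= u -> u < sup A -> P u.
  move=> au /(sup_gt _)[|t [at_ tb Pt] ut]; first by exists a.
  by apply: Pt => //; apply: ltW.
have Psup : P (sup A).
  have [<-//|ans] := eqVneq a (sup A).
  by apply: Pl => //; rewrite lt_neqAle ans.
have [sb'|bs] := ltP (sup A) b; last first.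
  move=> t at_ tb; have [ts|st] := ltP t (sup A); first exact: Ps.
  by have -> : t = sup A by apply/le_anti; rewrite st (le_trans tb).
have [e e0 Pe] := Pr _ as_ sb' Psup.
pose m := Num.min b (sup A + e / 2).
have sm : sup A < m by rewrite lt_min sb'/= ltrDl divr_gt0.
suff Am : A m.
  have := ub_le_sup (proj2 hA) Am; by rewrite leNgt sm.
split; first exact: le_trans as_ (ltW sm).
  by rewrite /m ge_min lexx.
move=> u au um; have [us|] := ltP u (sup A); first exact: Ps.
rewrite le_eqVlt => /predU1P[<-//|su]; apply: Pe => //.
  by apply: le_lt_trans um _; rewrite /m gt_min ltrD2l gtr_pMr// invf_lt1// ltr1n orbT.
by apply: le_trans um _; rewrite /m ge_min lexx.
Qed.

(** Compactness of the segment in near-covering form. With [F] the right neighborhoods of [0] it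
    produces Lebesgue numbers and uniform radii, and with an ultrafilter it turns local estimates
    into uniform convergence. *)
Lemma seg_near {I : Type} (F : set_system I) {FF : Filter F}
    (P : I -> R -> Prop) (a b : R) :
  (forall t, a <= t -> t <= b -> \forall t' \near t & i \near F, P i t') ->
  \forall i \near F, forall t, a <= t -> t <= b -> P i t.
Proof.
move=> H; have /compact_near_coveringP := @segment_compact R a b.
move=> /(_ I F P FF) HF.
have := HF _; rewrite /prop_near1 /nbhs /= => HF'.
apply: filterS (HF' _) => [i h t at_ tb|x]; last first.
  by rewrite /= in_itv /= => /andP[]; exact: H.
by apply: h; rewrite /= in_itv /= at_ tb.
Qed.

Lemma near_dist (x : R) (e : R) : 0 < e -> \forall y \near x, `|y - x| < e.
Proof.
move=> e0; near=> y; rewrite distrC; near: y; exact: nbhsx_ballx.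
Unshelve. all: by end_near. Qed.

Lemma near_distP (x : R) (P : R -> Prop) : (\forall y \near x, P y) <->
  exists2 e, 0 < e & forall y, `|y - x| < e -> P y.
Proof.
split=> [/nbhs_ballP[e e0 he]|[e e0 he]].
  by exists e => // y yx; apply: he; rewrite /ball /= distrC.
near=> y; apply: he; near: y; exact: near_dist.
Unshelve. all: by end_near. Qed.

Lemma cvg_near_le {I : Type} (F : set_system I) {FF : ProperFilter F}
    (f g : I -> R) (a b : R) : f @ F --> a -> g @ F --> b ->
  (\forall i \near F, f i <= g i) -> a <= b.
Proof.
move=> fa gb fg; rewrite -subr_ge0; apply: (cvgr_to_ge (cvgB gb fa)).
by apply: filterS fg => i; rewrite /= subr_ge0.
Qed.

Lemma cvg_near_eq {I : Type} (F : set_system I) {FF : ProperFilter F}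
    (f g : I -> R) (a b : R) : f @ F --> a -> g @ F --> b ->
  (\forall i \near F, f i = g i) -> a = b.
Proof.
move=> fa gb fg; apply/le_anti/andP; split.
  by apply: (cvg_near_le fa gb); apply: filterS fg => i ->.
by apply: (cvg_near_le gb fa); apply: filterS fg => i ->.
Qed.

(** Precomposition with [clamp a b] turns a curve that matters only on [[a, b]] into a globally
    continuous map, constant outside, so that continuity within a subspace need not be carried
    along. *)
Definition clamp (a b t : R) := Num.max a (Num.min t b).

Lemma clamp_in a b t : a <= b -> a <= clamp a b t /\ clamp a b t <= b.
Proof.
by move=> ab; rewrite /clamp le_max lexx ge_max ab ge_min lexx orbT.
Qed.

Lemma clamp_id a b t : a <= t -> t <= b -> clamp a b t = t.
Proof. by move=> at_ tb; rewrite /clamp (min_idPl _)// (max_idPr _). Qed.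

Lemma clamp_dist a b s t : `|clamp a b s - clamp a b t| <= `|s - t|.
Proof.
rewrite /clamp /Num.min /Num.max.
by do ![case: ifP => /=] => *; apply/ler_normlP; split; have := ler_norm (s - t);
  have := ler_norm (- (s - t)); rewrite normrN; move: (normr_ge0 (s - t)); lra.
Qed.

Lemma continuous_clamp a b : continuous (clamp a b).
Proof.
move=> t; apply/cvgrPdist_lt => e e0; near=> u.
apply: le_lt_trans (clamp_dist _ _ _ _) _; rewrite distrC; near: u; exact: near_dist.
Unshelve. all: by end_near. Qed.

Lemma clamp_homo a b s t : s <= t -> clamp a b s <= clamp a b t.
Proof. by move=> st; rewrite /clamp le_max2// le_min2. Qed.

End RealLine.

Section MetricLimits.
Context {R : realType} {X : metricType R}.
Implicit Types (x y z : X).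

Lemma nbhs_mdist x (W : set X) :
  nbhs x W <-> exists2 e : R, 0 < e & forall y, mdist x y < e -> W y.
Proof.
split=> [/metricType_numDomainType.nbhs_mdistP[/= e e0 he]|[e e0 he]]; first by exists e.
by apply/metricType_numDomainType.nbhs_mdistP; exists e.
Qed.

Lemma near_mdist x (e : R) : 0 < e -> \forall y \near x, mdist x y < e.
Proof. by move=> e0; apply/nbhs_mdist; exists e. Qed.

Lemma cvg_near_mdist {I : Type} (F : set_system I) {FF : Filter F} (f : I -> X) x (e : R) :
  f @ F --> x -> 0 < e -> \forall i \near F, mdist x (f i) < e.
Proof. by move=> fx e0; exact: (metricType_numDomainType.cvgr_dist_lt fx e0). Qed.

Lemma continuousPdist (f : R -> X) t : {for t, continuous f} <->
  forall e : R, 0 < e ->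
    exists2 d, 0 < d & forall u, `|u - t| < d -> mdist (f t) (f u) < e.
Proof.
split=> [/metricType_numDomainType.cvgrPdist_lt h e e0|h]; first by apply/near_distP; exact: h.
by apply/metricType_numDomainType.cvgrPdist_lt => e e0; apply/near_distP; exact: h.
Qed.

Lemma mdist_cvg {I : Type} (F : set_system I) {FF : Filter F} (f g : I -> X) x y :
  f @ F --> x -> g @ F --> y -> (fun i => mdist (f i) (g i)) @ F --> mdist x y.
Proof.
move=> fx gy; apply/cvgrPdist_lt => e e0.
have e2 : 0 < e / 2 by rewrite divr_gt0.
near=> i.
have h1 : mdist x (f i) < e / 2 by near: i; exact: metricType_numDomainType.cvgr_dist_lt fx _ e2.
have h2 : mdist y (g i) < e / 2 by near: i; exact: metricType_numDomainType.cvgr_dist_lt gy _ e2.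
have := metric_triangle x (f i) y; have := metric_triangle (f i) (g i) y.
have := metric_triangle (f i) x (g i); have := metric_triangle x y (g i).
rewrite (metric_sym (g i) y) (metric_sym (f i) x) => ? ? ? ?.
apply/ltr_normlP; split; lra.
Unshelve. all: by end_near. Qed.

Lemma cvg_mdist_unique {I : Type} (F : set_system I) {FF : ProperFilter F}
    (f : I -> X) x y : f @ F --> x -> f @ F --> y -> x = y.
Proof. move=> fx fy; exact: (cvg_unique (@metric_hausdorff R X) fx fy). Qed.

(** For an ultrafilter a cluster point is a limit. This replaces diagonal subsequences: one
    ultrafilter makes a family of curves converge at all parameters at once. *)
Lemma compact_ultra_cvg {T : topologicalType} {I : Type} (F : set_system I)
    {FF : UltraFilter F} (f : I -> T) (K : set T) : compact K -> (\forall i \near F, K (f i)) ->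
  exists2 x, K x & f @ F --> x.
Proof.
move=> cK FK; have [x [Kx clx]] := cK (f @ F) _ FK.
exists x => // W nW; rewrite /nbhs /= /fmap.
have [//|FnW] := @in_ultra_setVsetC _ F (f @^-1` W) FF.
have [|z []//] := clx (~` W) W _ nW.
exact: FnW.
Qed.

End MetricLimits.

(** * Causal structure and comparison neighborhoods *)

(** An infinite separation is sent to [0] by [fine], so the value is faithful only where [tau] is
    finite, as on comparison neighborhoods. Positivity of [tr] still forces the timelike relation
    everywhere. *)
Definition tr {R : realType} {X : Type} (S : causal_data R X) (p q : X) : R :=
  fine (tau S p q).

Definition lin {R : realType} {X : Type} (S : causal_data R X) (c : R -> X) (l : R) :=
  forall r s : R, 0 <= r -> r <= s -> s <= 1 -> tau S (c r) (c s) = (l * (s - r))%:E.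

(* The part of [comparison_neighborhood] used below, freed from Lipschitz
   parametrizations: maximizers of constant speed [l] enter as maps with [lin S c l]. *)
Record cmp {R : realType} {X : metricType R} (S : causal_data R X) (U : set X)
    : Prop := Cmp {
  cmp_fin : forall p q, U p -> U q -> tau S p q \is a fin_num;
  cmp_cont : forall p q, U p -> U q ->
    (fun z : X * X => tr S z.1 z.2) @ (p, q) --> tr S p q;
  cmp_thr : forall p m q, cll S p q -> diamond S p q `<=` U ->
    cle S p m -> cle S m q -> tr S p m + tr S m q = tr S p q ->
    exists c : R -> X, [/\ continuous c, lin S c (tr S p q), c 0 = p, c 1 = q &
      exists r, [/\ 0 <= r, r <= 1 & c r = m]];
  cmp_uniq : forall (c c' : R -> X) l l', lin S c l -> lin S c' l' -> 0 < l ->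
    c 0 = c' 0 -> c 1 = c' 1 -> diamond S (c 0) (c 1) `<=` U ->
    forall t, 0 <= t -> t <= 1 -> c t = c' t;
  cmp_conc : forall (c c' : R -> X) l l', lin S c l -> lin S c' l' ->
    0 < l -> 0 < l' ->
    diamond S (c 0) (c 1) `<=` U -> diamond S (c' 0) (c' 1) `<=` U ->
    cll_or_eq S (c 0) (c' 0) -> cll_or_eq S (c 1) (c' 1) ->
    forall t, 0 <= t -> t <= 1 ->
      t * tr S (c 1) (c' 1) + (1 - t) * tr S (c 0) (c' 0) <= tr S (c t) (c' t) }.

(* Invariant under time reversal, so that facts about the future of a point apply
   to its past. *)
Record tame {R : realType} {X : metricType R} (S : causal_data R X) : Prop := Tame {
  t_refl : forall x, cle S x x;
  t_trans : forall x y z, cle S x y -> cle S y z -> cle S x z;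
  t_anti : forall x y, cle S x y -> cle S y x -> x = y;
  t_ll_le : forall x y, cll S x y -> cle S x y;
  t_tau0 : forall x y, (0 <= tau S x y)%E;
  t_tri : forall x y z, cle S x y -> cle S y z ->
    (tau S x y + tau S y z <= tau S x z)%E;
  t_pos : forall x y, (0 < tau S x y)%E <-> cll S x y;
  t_open : forall p q, cll S p q -> \forall z \near (p, q), cll S z.1 z.2;
  t_closed : closed [set z : X * X | cle S z.1 z.2];
  t_compact : forall x y, compact (diamond S x y);
  t_fut : forall (x : X) (W : set X), nbhs x W -> exists2 y, W y & cll S x y;
  t_past : forall (x : X) (W : set X), nbhs x W -> exists2 y, W y & cll S y x;
  t_local : forall x : X, exists2 U : set X, nbhs x U & cmp S U }.

Section Order.
Context {R : realType} {X : metricType R} (S : causal_data R X) (hS : tame S).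
Implicit Types (x y z p q m : X) (U V W : set X).

Local Notation "x ≼ y" := (cle S x y) (at level 70).
Local Notation "x ≪ y" := (cll S x y) (at level 70).

Lemma ll_le_trans x y z : x ≪ y -> y ≼ z -> x ≪ z.
Proof.
move=> xy yz; apply/(t_pos hS); apply: lt_le_trans (t_tri hS (t_ll_le hS xy) yz).
by rewrite -[ltLHS](adde0) lte_leD// ?(t_tau0 hS)//; apply/(t_pos hS).
Qed.

Lemma le_ll_trans x y z : x ≼ y -> y ≪ z -> x ≪ z.
Proof.
move=> xy yz; apply/(t_pos hS); apply: lt_le_trans (t_tri hS xy (t_ll_le hS yz)).
rewrite addeC -[ltLHS](adde0) lte_leD// ?(t_tau0 hS)//; exact/(t_pos hS).
Qed.

Lemma ll_trans x y z : x ≪ y -> y ≪ z -> x ≪ z.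
Proof. by move=> xy yz; apply: ll_le_trans xy (t_ll_le hS yz). Qed.

(** The reverse triangle inequality at [x <= x <= x] reads [2 tau <= tau], so a finite nonnegative
    value is [0]. Finiteness comes from a comparison neighborhood. *)
Lemma tau_refl x : tau S x x = 0%E.
Proof.
have [U /nbhs_singleton Ux cU] := t_local hS x.
have := t_tri hS (t_refl hS x) (t_refl hS x); have := t_tau0 hS x x.
have := cmp_fin cU Ux Ux; case: (tau S x x) => [v||] //= _.
by rewrite -EFinD !lee_fin => v0 v2; congr (_%:E); lra.
Qed.

Lemma ll_irr x : ~ x ≪ x.
Proof. by move/(t_pos hS); rewrite tau_refl ltxx. Qed.

Lemma diamond_sub p q p' q' : p ≼ p' -> q' ≼ q ->
  diamond S p' q' `<=` diamond S p q.
Proof.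
by move=> pp qq z [pz zq]; split; [apply: t_trans pz|apply: t_trans zq qq].
Qed.

Lemma diamondl p q : p ≼ q -> diamond S p q p.
Proof. by split=> //; exact: t_refl. Qed.

Lemma diamondr p q : p ≼ q -> diamond S p q q.
Proof. by split=> //; exact: t_refl. Qed.

Lemma le_lim {I : Type} (F : set_system I) {FF : ProperFilter F} (f g : I -> X) p q :
  f @ F --> p -> g @ F --> q -> (\forall i \near F, f i ≼ g i) -> p ≼ q.
Proof.
move=> fp gq fg.
have := @closed_cvg _ _ F FF (fun i => (f i, g i)) [set z | z.1 ≼ z.2].
by move=> /(_ (t_closed hS) fg (p, q)); apply; exact: cvg_pair.
Qed.

Lemma le_closure p q : (forall A B : set X, nbhs p A -> nbhs q B ->
  exists p' q', [/\ A p', B q' & p' ≼ q']) -> p ≼ q.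
Proof.
move=> h; suff : [set z : X * X | z.1 ≼ z.2] (p, q) by [].
apply: (t_closed hS) => C [[A B] /= [nA nB] AB].
have [p' [q' [Ap' Bq' pq']]] := h _ _ nA nB.
by exists (p', q'); split=> //; exact: AB.
Qed.

Lemma ll_near {I : Type} (F : set_system I) {FF : Filter F} (f g : I -> X) p q :
  f @ F --> p -> g @ F --> q -> p ≪ q -> \forall i \near F, f i ≪ g i.
Proof.
by move=> fp gq pq; exact: (cvg_pair fp gq (t_open hS pq)).
Qed.

Lemma tr_lim {I : Type} (F : set_system I) {FF : Filter F} (f g : I -> X) U p q :
  cmp S U -> U p -> U q -> f @ F --> p -> g @ F --> q ->
  (fun i => tr S (f i) (g i)) @ F --> tr S p q.
Proof.
move=> cU Up Uq fp gq; exact: (cvg_comp _ _ (cvg_pair fp gq) (cmp_cont cU Up Uq)).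
Qed.

Lemma fut_nbhs p q : p ≪ q -> nbhs q (chron_future S p).
Proof.
move=> pq; apply: (@ll_near _ (nbhs q) _ (fun=> p) id p q) => //.
exact: cvg_cst.
Qed.

Lemma past_nbhs p q : p ≪ q -> nbhs p (chron_past S q).
Proof.
move=> pq; apply: (@ll_near _ (nbhs p) _ id (fun=> q) p q) => //.
exact: cvg_cst.
Qed.

Lemma tauE U p q : cmp S U -> U p -> U q -> tau S p q = (tr S p q)%:E.
Proof. by move=> cU Up Uq; rewrite /tr fineK//; exact: cmp_fin Up Uq. Qed.

Lemma tr_ge0 p q : 0 <= tr S p q.
Proof. by apply: fine_ge0; exact: t_tau0. Qed.

Lemma tr_ll p q : 0 < tr S p q -> p ≪ q.
Proof.
rewrite /tr => h; apply/(t_pos hS); move: h.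
by case: (tau S p q) => [r||] //=; rewrite ltxx.
Qed.

Lemma tr_gt0 U p q : cmp S U -> U p -> U q -> p ≪ q -> 0 < tr S p q.
Proof. by move=> cU Up Uq /(t_pos hS); rewrite (tauE cU)// lte_fin. Qed.

Lemma tr_tri U p q m : cmp S U -> U p -> U q -> U m -> p ≼ m -> m ≼ q ->
  tr S p m + tr S m q <= tr S p q.
Proof.
by move=> cU Up Uq Um pm mq; have := t_tri hS pm mq; rewrite !(tauE cU)//.
Qed.

Lemma lin_tr c l : lin S c l -> forall r s, 0 <= r -> r <= s -> s <= 1 ->
  tr S (c r) (c s) = l * (s - r).
Proof. by move=> h r s r0 rs s1; rewrite /tr h. Qed.

Lemma lin_ll c l : lin S c l -> 0 < l -> forall r s, 0 <= r -> r < s -> s <= 1 ->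
  c r ≪ c s.
Proof.
move=> h l0 r s r0 rs s1; apply/(t_pos hS); rewrite h// ?ltW//.
by rewrite lte_fin mulr_gt0// subr_gt0.
Qed.

Lemma lin_le c l : lin S c l -> 0 < l -> forall r s, 0 <= r -> r <= s -> s <= 1 ->
  c r ≼ c s.
Proof.
move=> h l0 r s r0; rewrite le_eqVlt => /predU1P[-> _|rs s1]; first exact: t_refl.
by apply: (t_ll_le hS); apply: (lin_ll h).
Qed.

Lemma cmp_ex U p q : cmp S U -> p ≪ q -> diamond S p q `<=` U ->
  exists c, [/\ continuous c, lin S c (tr S p q), c 0 = p & c 1 = q].
Proof.
move=> cU pq dU.
have [|c [cc cl c0 c1 _]] := cmp_thr cU pq dU (t_refl hS p) (t_ll_le hS pq).
  by rewrite {1}/tr tau_refl/= add0r.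
by exists c.
Qed.

Lemma cmp_subset U U' : cmp S U -> U' `<=` U -> cmp S U'.
Proof.
move=> [h1 h2 h3 h4 h5] s; split.
- by move=> p q /s Up /s; exact: h1.
- by move=> p q /s Up /s; exact: h2.
- by move=> p m q pq d; apply: h3 => //; exact: subset_trans s.
- by move=> c c' l l' cl cl' l0 e0 e1 d; apply: (h4 _ _ l l') => //; exact: subset_trans s.
- by move=> c c' l l' cl cl' l0 l0' d d'; apply: (h5 _ _ l l') => //; exact: subset_trans s.
Qed.

(* A failure would leave points [z] outside [W] squeezed between points tending
   to [x]; a cluster point [z] satisfies [x <= z <= x]. *)
Lemma strongly_causal x W : nbhs x W ->
  exists2 V, nbhs x V & forall p q, V p -> V q -> diamond S p q `<=` W.
Proof.
move=> nW; apply: contrapT => noV.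
pose G := filter_from (nbhs x)
  (fun V => [set z | ~ W z /\ exists p q, [/\ V p, V q & diamond S p q z]]).
have PG : ProperFilter G.
  apply: filter_from_proper; first apply: filter_from_filter.
  - by exists setT; exact: filterT.
  - move=> A B nA nB; exists (A `&` B); first exact: filterI.
    move=> z [nWz [p [q [[Ap Bp] [Aq Bq] d]]]].
    by split; split=> //; exists p, q.
  - move=> V nV; apply: contrapT => emp; apply: noV; exists V => // p q Vp Vq z d.
    by apply: contrapT => nWz; apply: emp; exists z; split=> //; exists p, q.
have [xm _ xmx] := t_past hS (@filterT _ _ (nbhs_filter x)).
have [xp _ xxp] := t_fut hS (@filterT _ _ (nbhs_filter x)).
have GK : G (diamond S xm xp).
  exists (chron_future S xm `&` chron_past S xp).
    by apply: filterI; [exact: fut_nbhs|exact: past_nbhs].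
  move=> z [_ [p [q [[xmp _] [_ qxp] [pz zq]]]]]; split.
    by apply: (t_trans hS) pz; apply: t_ll_le.
  by apply: (t_trans hS) zq _; apply: t_ll_le.
have [z [_ clz]] := @t_compact _ _ _ hS xm xp _ PG GK.
have xz : forall V, nbhs x V -> forall W', nbhs z W' ->
    exists z' p q, [/\ W' z', V p, V q, p ≼ z' & z' ≼ q] /\ ~ W z'.
  move=> V nV W' nW'.
  have GV : G [set z | ~ W z /\ exists p q, [/\ V p, V q & diamond S p q z]].
    by exists V.
  have [z' [[nWz' [p [q [Vp Vq [pz zq]]]]] W'z']] := clz _ _ GV nW'.
  by exists z', p, q.
have cl1 : x ≼ z /\ z ≼ x.
  split.
    apply: le_closure => V W' nV nW'.
    by have [z' [p [q [[W'z' Vp Vq pz zq] _]]]] := xz _ nV _ nW'; exists p, z'.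
  apply: le_closure => W' V nW' nV.
  by have [z' [p [q [[W'z' Vp Vq pz zq] _]]]] := xz _ nV _ nW'; exists z', q.
have zx : z = x by apply: (t_anti hS); case: cl1.
have nzW : nbhs z W by rewrite zx.
by have [z' [p [q [[Wz' _ _ _ _] ?]]]] := xz setT filterT W nzW.
Qed.

(** Since the order is closed, a cluster point bounds the values eventually from above and lies
    below every eventual upper bound. Antisymmetry then leaves a single cluster point, and
    compactness makes it the limit. *)
Lemma monotone_cvg {I : Type} (F : set_system I) {FF : ProperFilter F}
    (f : I -> X) (K : set X) : compact K -> (\forall i \near F, K (f i)) ->
  (\forall i \near F, \forall j \near F, f i ≼ f j) ->
  exists2 L, f @ F --> L & \forall i \near F, f i ≼ L.
Proof.
move=> cK FK mono.
have cll_le L : cluster (f @ F) L -> \forall i \near F, f i ≼ L.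
  move=> clL; apply: filterS mono => i fij.
  apply: le_closure => A W nA nW.
  have [z [ifz Wz]] := clL [set z | f i ≼ z] W fij nW.
  by exists (f i), z; split=> //; exact: nbhs_singleton nA.
have cl_le L y : cluster (f @ F) L -> (\forall i \near F, f i ≼ y) -> L ≼ y.
  move=> clL fy; apply: le_closure => W A nW nA.
  have [z [zy Wz]] := clL [set z | z ≼ y] W fy nW.
  by exists z, y; split=> //; exact: nbhs_singleton nA.
have [L [KL clL]] := cK (f @ F) _ FK.
exists L; last exact: cll_le.
move=> W nW; apply: contrapT => nFW.
(* If [f] did not converge to [L], it would avoid [W] on indices forming a proper filter finer than
   [F]. A cluster point along it is also one along [F], hence is [L], although it is never
   approached from inside [W]. *)
pose G := within [set i | ~ W (f i)] F.
have PG : ProperFilter G.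
  split; last exact: within_filter.
  move=> G0; have {}G0 : F [set i | ~ W (f i) -> False] := G0.
  by apply: nFW; apply: (@filterS _ F _ _ _ _ G0) => i /= h; apply: contrapT.
have FG : F `<=` G by move=> A FA; apply: filterS FA => i Ai _.
have [L' [_ clL']] := cK (f @ G) _ (FG _ FK).
have clL'F : cluster (f @ F) L' by move=> A B FA nB; apply: clL' => //; exact: FG.
have LL' : L' = L by apply: (t_anti hS); apply: cl_le => //; exact: cll_le.
have nL'W : nbhs L' W by rewrite LL'.
have GW : (f @ G) (~` W) by apply: (@filterS _ F _ _ _ _ (@filterT _ F _)) => i _.
by have [z []] := clL' _ _ GW nL'W.
Qed.

End Order.

(** * Constant-speed timelike geodesics *)

Lemma archi_mul {R : realType} (x e : R) : 0 < e -> exists k : nat, x <= k%:R * e.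
Proof.
move=> e0; exists (Num.bound `|x / e|); rewrite -ler_pdivrMr//.
by apply: le_trans (ler_norm _) (ltW (archi_boundP (normr_ge0 _))).
Qed.

(** A timelike geodesic of constant speed [l]. The window [e] is uniform over [[0, 1]], and no
    Lipschitz condition is imposed, so that limits of such maps can again be of this kind. *)
Definition tg {R : realType} {X : metricType R} (S : causal_data R X)
    (c : R -> X) (l : R) : Prop :=
  [/\ 0 < l, continuous c & exists2 e : R, 0 < e & forall r s : R, 0 <= r -> r <= s ->
     s <= 1 -> s - r <= e -> tau S (c r) (c s) = (l * (s - r))%:E].

Section Geodesics.
Context {R : realType} {X : metricType R} (S : causal_data R X) (hS : tame S).
Implicit Types (x y z p q m : X) (U V W : set X) (c : R -> X) (l : R).

Local Notation "x ≼ y" := (cle S x y) (at level 70).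
Local Notation "x ≪ y" := (cll S x y) (at level 70).

Lemma lin_tg c l : continuous c -> lin S c l -> 0 < l -> tg S c l.
Proof. by move=> cc cl l0; split=> //; exists 1 => // r s r0 rs s1 _; exact: cl. Qed.

(** The exact separations on windows of length [e] add up by the reverse triangle inequality. Only a
    lower bound survives, because a geodesic need not maximize globally. *)
Lemma tg_tau_ge c l : tg S c l -> forall r s, 0 <= r -> r <= s -> s <= 1 ->
  c r ≼ c s /\ ((l * (s - r))%:E <= tau S (c r) (c s))%E.
Proof.
move=> [l0 cc [e e0 he]].
have small r s : 0 <= r -> r <= s -> s <= 1 -> s - r <= e ->
    c r ≼ c s /\ ((l * (s - r))%:E <= tau S (c r) (c s))%E.
  move=> r0 rs s1 sre; rewrite he//; split=> //.
  have [<-|nrs] := eqVneq r s; first exact: t_refl.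
  apply: (t_ll_le hS); apply/(t_pos hS); rewrite he// lte_fin mulr_gt0//.
  by rewrite subr_gt0 lt_neqAle nrs.
have main k r s : 0 <= r -> r <= s -> s <= 1 -> s - r <= k%:R * e ->
    c r ≼ c s /\ ((l * (s - r))%:E <= tau S (c r) (c s))%E.
  elim: k s => [|k ih] s r0 rs s1.
    by rewrite mul0r => h; apply: small => //; apply: le_trans h (ltW e0).
  rewrite -natr1 mulrDl mul1r => sr.
  have [sre|esr] := leP (s - r) e; first exact: small.
  have [|||mr1 mr2] := ih (s - e) r0; [lra..|].
  have [||||ms1 ms2] := small (s - e) s; [lra..|].
  split; first exact: t_trans mr1 ms1.
  apply: le_trans (t_tri hS mr1 ms1); apply: le_trans (leeD mr2 ms2).
  by rewrite -EFinD lee_fin; lra.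
move=> r s r0 rs s1; have [k hk] := archi_mul (s - r) e0.
exact: main hk.
Qed.

Lemma tg_le c l : tg S c l -> forall r s, 0 <= r -> r <= s -> s <= 1 -> c r ≼ c s.
Proof. by move=> h r s r0 rs s1; have [] := tg_tau_ge h r0 rs s1. Qed.

Lemma tg_ll c l : tg S c l -> forall r s, 0 <= r -> r < s -> s <= 1 -> c r ≪ c s.
Proof.
move=> h r s r0 rs s1; have [_] := tg_tau_ge h r0 (ltW rs) s1; have [l0 _ _] := h.
move=> le; apply/(t_pos hS); apply: lt_le_trans le.
by rewrite lte_fin mulr_gt0// subr_gt0.
Qed.

Lemma tg_sub c l u v : tg S c l -> 0 <= u -> u < v -> v <= 1 ->
  tg S (fun t => c (u + t * (v - u))) (l * (v - u)).
Proof.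
move=> [l0 cc [e e0 he]] u0 uv v1; have uv0 : 0 < v - u by rewrite subr_gt0.
split; first by rewrite mulr_gt0.
  move=> t; apply: continuous_comp; last exact: cc.
  by apply: cvgD; [exact: cvg_cst|apply: cvgM; [exact: cvg_id|exact: cvg_cst]].
exists e => // r s r0 rs s1 sre; rewrite he; first by congr EFin; ring.
- by rewrite addr_ge0// mulr_ge0// ltW.
- by rewrite lerD2l ler_wpM2r// ltW.
- have : s * (v - u) <= 1 * (v - u) by rewrite ler_wpM2r// ltW.
  lra.
- have : (s - r) * (v - u) <= (s - r) * 1 by rewrite ler_wpM2l; lra.
  lra.
Qed.

(** Concavity on [[0, 1]] after the affine change of parameter from [[u, v]], multiplied by [v - u]
    to clear denominators. *)
Lemma concave_piece U (al be : R -> X) l l' u v t : cmp S U -> u < v ->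
  u <= t -> t <= v -> 0 < l -> 0 < l' ->
  (forall r s, u <= r -> r <= s -> s <= v -> tau S (al r) (al s) = (l * (s - r))%:E) ->
  (forall r s, u <= r -> r <= s -> s <= v -> tau S (be r) (be s) = (l' * (s - r))%:E) ->
  diamond S (al u) (al v) `<=` U -> diamond S (be u) (be v) `<=` U ->
  cll_or_eq S (al u) (be u) -> cll_or_eq S (al v) (be v) ->
  (t - u) * tr S (al v) (be v) + (v - t) * tr S (al u) (be u)
    <= (v - u) * tr S (al t) (be t).
Proof.
move=> cU uv ut tv l0 l0' hal hbe dal dbe e0 e1.
have vu0 : 0 < v - u by rewrite subr_gt0.
have aff r : 0 <= r -> r <= 1 -> u <= u + r * (v - u) /\ u + r * (v - u) <= v.
  move=> r0 r1; have := mulr_ge0 r0 (ltW vu0).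
  have : r * (v - u) <= 1 * (v - u) by rewrite ler_wpM2r// ltW.
  lra.
have linp (f : R -> X) k : (forall r s, u <= r -> r <= s -> s <= v ->
    tau S (f r) (f s) = (k * (s - r))%:E) ->
    lin S (fun w : R => f (u + w * (v - u))) (k * (v - u)).
  move=> hf r s r0 rs s1; rewrite hf; first by congr EFin; ring.
  - by case: (aff r r0 (le_trans rs s1)).
  - by rewrite lerD2l ler_wpM2r// ltW.
  - by case: (aff s (le_trans r0 rs) s1).
have h0 : u + 0 * (v - u) = u by ring.
have h1 : u + 1 * (v - u) = v by ring.
have := cmp_conc cU (linp _ _ hal) (linp _ _ hbe); rewrite /= h0 h1.
move=> /(_ (mulr_gt0 l0 vu0) (mulr_gt0 l0' vu0) dal dbe e0 e1 ((t - u) / (v - u))).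
have -> : u + (t - u) / (v - u) * (v - u) = t by rewrite divfK ?gt_eqF//; ring.
move=> /(_ _ _) h; rewrite -ler_pdivrMl//.
have -> : (v - u)^-1 * ((t - u) * tr S (al v) (be v) + (v - t) * tr S (al u) (be u))
   = (t - u) / (v - u) * tr S (al v) (be v) + (1 - (t - u) / (v - u)) * tr S (al u) (be u).
  by field; rewrite gt_eqF.
apply: h; first by rewrite divr_ge0// ?subr_ge0// ltW.
by rewrite ler_pdivrMr// mul1r lerD2r.
Qed.

End Geodesics.

Section Comparison.
Context {R : realType} {X : metricType R} (S : causal_data R X) (hS : tame S).
Implicit Types (x y z p q m : X) (U V W : set X) (c : R -> X) (l : R).

Local Notation "x ≼ y" := (cle S x y) (at level 70).
Local Notation "x ≪ y" := (cll S x y) (at level 70).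

Lemma cont_cvg {I : Type} (F : set_system I) {FF : Filter F} c (f : I -> R) t :
  continuous c -> f @ F --> t -> (fun i => c (f i)) @ F --> c t.
Proof. by move=> cc hf; exact: (cvg_comp _ _ hf (cc t)). Qed.

(** Since [k <= 1] an affine reparametrization only shortens windows, so a single [e] serves the
    whole deformation in [tg_comparison]. *)
Lemma tg_scaled c l : tg S c l -> exists2 e, 0 < e &
  forall a k r s, 0 <= a -> 0 <= k -> a + k <= 1 -> 0 <= r -> r <= s -> s <= 1 ->
  s - r <= e -> tau S (c (a + k * r)) (c (a + k * s)) = (l * k * (s - r))%:E.
Proof.
move=> [l0 cc [e e0 he]]; exists e => // a k r s a0 k0 ak r0 rs s1 sre.
rewrite he; first by congr EFin; ring.
- by rewrite addr_ge0// mulr_ge0.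
- by rewrite lerD2l ler_wpM2l.
- have : k * s <= k * 1 by rewrite ler_wpM2l.
  lra.
- have : k * (s - r) <= 1 * (s - r) by rewrite ler_wpM2r; lra.
  lra.
Qed.

(* Along the deformation the two geodesics stay strictly related: at a first
   failure [d], concavity on short windows propagates positivity of the
   separation from the parameter [0] to all parameters. *)
Lemma tg_comparison (c c' : R -> X) l l' d0 k : tg S c l -> tg S c' l' ->
  0 < d0 -> d0 <= 1 -> 0 < k ->
  (forall t, 0 <= t -> t <= 1 -> exists2 U, cmp S U &
     forall d u v, 0 <= d -> d <= d0 -> 0 <= u -> u <= v -> v <= 1 ->
       `|u - t| <= k -> `|v - t| <= k ->
       diamond S (c (0 + (1 - d) * u)) (c (0 + (1 - d) * v)) `<=` U /\
       diamond S (c' (d + (1 - d) * u)) (c' (d + (1 - d) * v)) `<=` U) ->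
  (forall t, 0 <= t -> t <= 1 -> c (0 + (1 - d0) * t) ≪ c' (d0 + (1 - d0) * t)) ->
  c 0 ≼ c' 0 -> c 1 ≼ c' 1 -> forall t, 0 <= t -> t <= 1 -> c t ≼ c' t.
Proof.
move=> tc tc' d00 d01 k0 hU hd0 h0 h1.
have [l0 cc _] := tc; have [l0' cc' _] := tc'.
(* [A d] omits the end of [c] and [B d] the beginning of [c']. For [d > 0] this makes both pairs of
   ends timelike: [c 0 <= c' 0 << c' d] and [c (1 - d) << c 1 <= c' 1]. *)
pose A d t := c (0 + (1 - d) * t); pose B d t := c' (d + (1 - d) * t).
have [e e0 he] := tg_scaled tc; have [e' e0' he'] := tg_scaled tc'.
have cvA (I : Type) (F : set_system I) (FF : Filter F) (f g : I -> R) d t :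
    f @ F --> d -> g @ F --> t -> (fun i => A (f i) (g i)) @ F --> A d t.
  move=> fd gt; apply: cont_cvg cc _; apply: cvgD; first exact: cvg_cst.
  by apply: cvgM => //; apply: cvgB => //; exact: cvg_cst.
have cvB (I : Type) (F : set_system I) (FF : Filter F) (f g : I -> R) d t :
    f @ F --> d -> g @ F --> t -> (fun i => B (f i) (g i)) @ F --> B d t.
  move=> fd gt; apply: cont_cvg cc' _; apply: cvgD => //.
  by apply: cvgM => //; apply: cvgB => //; exact: cvg_cst.
(* An interval reaching [k'] to either side of [t] has length at most [2 k'], hence fits in the
   windows of both geodesics. *)
have [k' [k'0 k'k k'e k'e']] : exists k', [/\ 0 < k', k' <= k, k' <= e / 2 & k' <= e' / 2].
  exists (Num.min k (Num.min (e / 2) (e' / 2))).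
  by rewrite !lt_min k0 !divr_gt0// !ge_min !lexx !orbT.
have main d : 0 < d -> d <= d0 -> forall t, 0 <= t -> t <= 1 -> A d t ≪ B d t.
  move=> dpos dd0.
  (* [real_ind] runs upwards while the deformation parameter decreases from [d0]; hence the variable
     [w = d0 - d]. *)
  suff : forall w, 0 <= w -> w <= d0 - d ->
      forall t, 0 <= t -> t <= 1 -> A (d0 - w) t ≪ B (d0 - w) t.
    by move=> /(_ (d0 - d)); rewrite subr_ge0 dd0 lexx subKr; apply.
  apply: real_ind; rewrite ?subr_ge0 ?subr0//.
    move=> w w0 wd Pw.
    have /near_distP[e1 e10 h] : \forall w' \near w, forall t, 0 <= t -> t <= 1 ->
        A (d0 - w') t ≪ B (d0 - w') t.
      apply: (@seg_near _ _ (nbhs w) _ (fun w1 t => A (d0 - w1) t ≪ B (d0 - w1) t)) => t t0 t1.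
      have c1 : (fun z : R * R => d0 - z.2) @ filter_prod (nbhs t) (nbhs w) --> d0 - w.
        by apply: cvgB; [exact: cvg_cst|exact: cvg_snd].
      have c2 : (fun z : R * R => z.1) @ filter_prod (nbhs t) (nbhs w) --> t.
        exact: cvg_fst.
      exact: (ll_near hS (cvA _ _ _ _ _ _ _ c1 c2) (cvB _ _ _ _ _ _ _ c1 c2) (Pw t t0 t1)).
    exists e1 => // u wu uw ud; apply: h.
    by rewrite gtr0_norm ?subr_gt0// ltrBlDl.
  move=> w w0 wd Pw; set dw := d0 - w.
  have [dw0 dw1] : 0 < dw /\ dw < 1 by split; rewrite /dw; clear -wd w0 dpos d01; lra.
  have inU t U u v : 0 <= u -> u <= v -> v <= 1 -> `|u - t| <= k' -> `|v - t| <= k' ->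
      (forall d u v, 0 <= d -> d <= d0 -> 0 <= u -> u <= v -> v <= 1 ->
       `|u - t| <= k -> `|v - t| <= k ->
       diamond S (A d u) (A d v) `<=` U /\ diamond S (B d u) (B d v) `<=` U) ->
      forall d', 0 <= d' -> d' <= d0 ->
      diamond S (A d' u) (A d' v) `<=` U /\ diamond S (B d' u) (B d' v) `<=` U.
    by move=> u0 uv v1 ut vt h d' d'0 d'd; apply: h => //; apply: le_trans k'k.
  (* Concavity holds for all earlier [w'], where the pairs are strictly related. Its nonnegative
     term at [v] is dropped, and the limit [w' -> w] gives [(v - t) tr(A u, B u) <= (v - u) tr(A t,
     B t)]. The room [v > t] keeps the weight positive. *)
  have step u t v : 0 <= u -> u <= t -> t < v -> v <= 1 -> t - u <= k' -> v - t <= k' ->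
      A dw u ≪ B dw u -> A dw t ≪ B dw t.
    move=> u0 ut tv v1 tuk vtk ABu.
    have [U cU /inU hUt] := hU t (le_trans u0 ut) (le_trans (ltW tv) v1).
    have uk' : `|u - t| <= k' by rewrite distrC ger0_norm// subr_ge0.
    have vk' : `|v - t| <= k' by rewrite ger0_norm// subr_ge0 ltW.
    have tk' : `|t - t| <= k' by rewrite subrr normr0 ltW.
    have dw_le : dw <= d0 by rewrite /dw; clear -w0; lra.
    have UA s d' : 0 <= s -> s <= 1 -> `|s - t| <= k' -> 0 <= d' -> d' <= d0 ->
        U (A d' s) /\ U (B d' s).
      move=> s0 s1 sk d'0 d'd; have [h1' h2'] := hUt s s s0 (lexx _) s1 sk sk d' d'0 d'd.
      by split; [apply: h1'|apply: h2']; apply: (diamondl hS); exact: t_refl.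
    have t0 : 0 <= t by exact: le_trans ut.
    have t1 : t <= 1 by apply: le_trans (ltW tv) v1.
    have [UAu UBu] := UA u dw u0 (le_trans ut t1) uk' (ltW dw0) dw_le.
    have [UAt UBt] := UA t dw t0 t1 tk' (ltW dw0) dw_le.
    have uv : u < v by apply: le_lt_trans tv.
    apply: (tr_ll hS); rewrite -(pmulr_rgt0 _ (_ : 0 < v - u)) ?subr_gt0//.
    apply: (@lt_le_trans _ _ ((v - t) * tr S (A dw u) (B dw u))).
      by rewrite mulr_gt0 ?subr_gt0//; apply: (tr_gt0 hS cU).
    have cd : (fun w' => d0 - w') @ w^'- --> dw.
      by apply: cvgB; [exact: cvg_cst|exact: cvg_within].
    have lim s : U (A dw s) -> U (B dw s) ->
        (fun w' => tr S (A (d0 - w') s) (B (d0 - w') s)) @ w^'- --> tr S (A dw s) (B dw s).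
      move=> UAs UBs; apply: (tr_lim cU UAs UBs).
        exact: (cvA _ _ _ _ _ _ _ cd (cvg_cst _)).
      exact: (cvB _ _ _ _ _ _ _ cd (cvg_cst _)).
    have L1 : (fun w' => (v - t) * tr S (A (d0 - w') u) (B (d0 - w') u)) @ w^'- -->
        (v - t) * tr S (A dw u) (B dw u).
      by apply: cvgM; [exact: cvg_cst|exact: lim].
    have L2 : (fun w' => (v - u) * tr S (A (d0 - w') t) (B (d0 - w') t)) @ w^'- -->
        (v - u) * tr S (A dw t) (B dw t).
      by apply: cvgM; [exact: cvg_cst|exact: lim].
    apply: (ler_cvg_to L1 L2).
    near=> w'.
    have w'w : w' < w by near: w'; exact: nbhs_left_lt.
    have w'0 : 0 < w' by near: w'; exact: nbhs_left_gt.
    have d'0 : 0 <= d0 - w' by clear -w'w wd dpos; lra.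
    have d'1 : 0 < 1 - (d0 - w') by clear -w'0 d01; lra.
    have d'd : d0 - w' <= d0 by clear -w'0; lra.
    have := @concave_piece _ _ S U (A (d0 - w')) (B (d0 - w'))
      (l * (1 - (d0 - w'))) (l' * (1 - (d0 - w'))) u v t cU uv ut (ltW tv).
    rewrite !mulr_gt0//; move=> /(_ isT isT) h.
    have := tr_ge0 hS (A (d0 - w') v) (B (d0 - w') v) => g0.
    rewrite -[X in X <= _]add0r.
    apply: (le_trans _ (h _ _ _ _ _ _)).
    - by rewrite lerD2r mulr_ge0// subr_ge0.
    - by move=> r s ur rs sv; apply: he => //; clear -u0 v1 ur sv tuk vtk k'e d'1 d'0; lra.
    - by move=> r s ur rs sv; apply: he' => //; clear -u0 v1 ur sv tuk vtk k'e' d'1 d'0; lra.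
    - by have [] := hUt u v u0 (ltW uv) v1 uk' vk' _ d'0 d'd.
    - by have [] := hUt u v u0 (ltW uv) v1 uk' vk' _ d'0 d'd.
    - by left; apply: Pw => //; [exact: ltW|exact: le_trans ut t1].
    - by left; apply: Pw => //; [exact: ltW|exact: le_trans (ltW uv)].
  have AB0 : A dw 0 ≪ B dw 0.
    have -> : A dw 0 = c 0 by rewrite /A mulr0 addr0.
    have -> : B dw 0 = c' dw by rewrite /B mulr0 addr0.
    apply: (le_ll_trans hS h0).
    by apply: (tg_ll hS tc') => //; exact: ltW.
  have AB1 : A dw 1 ≪ B dw 1.
    have -> : A dw 1 = c (1 - dw) by rewrite /A mulr1 add0r.
    have -> : B dw 1 = c' 1 by rewrite /B mulr1 subrKC.
    apply: (ll_le_trans hS _ h1).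
    by apply: (tg_ll hS tc); clear -dw0 dw1; lra.
  (* Positivity travels from [0] in steps of length [k']. The parameter [1] has no room to its right
     and is covered by [AB1]. *)
  have all n t : 0 <= t -> t < 1 -> t <= n%:R * k' -> A dw t ≪ B dw t.
    elim: n t => [|n ih] t t0 t1.
      by rewrite mul0r => tle; have -> : t = 0 by apply/le_anti/andP.
    rewrite -natr1 mulrDl mul1r => tn.
    have [tk|kt] := leP t k'.
      apply: (@step 0 t (Num.min 1 (t + k'))) => //; rewrite ?subr0//.
      - by rewrite lt_min t1 ltrDl.
      - by rewrite ge_min lexx.
      - by rewrite lerBlDl ge_min lexx orbT.
    apply: (@step (t - k') t (Num.min 1 (t + k'))) => //; try lra.
    - by rewrite lt_min t1 ltrDl.
    - by rewrite ge_min lexx.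
    - by rewrite lerBlDl ge_min lexx orbT.
    - by apply: ih; lra.
  move=> t t0; rewrite le_eqVlt => /predU1P[->//|t1].
  by have [n hn] := archi_mul t k'0; exact: all hn.
move=> t t0 t1; have z1 : (fun d : R => d) @ 0^'+ --> (0 : R) by exact: cvg_within.
have -> : c t = A 0 t by rewrite /A subr0 mul1r add0r.
have -> : c' t = B 0 t by rewrite /B subr0 mul1r add0r.
apply: (le_lim hS (cvA _ _ _ _ _ _ _ z1 (cvg_cst t)) (cvB _ _ _ _ _ _ _ z1 (cvg_cst t))).
near=> d.
have dp : 0 < d by near: d; exact: nbhs_right_gt.
have dl : d <= d0 by near: d; exact: nbhs_right_le.
exact: (t_ll_le hS (main d dp dl t t0 t1)).
Unshelve. all: by end_near. Qed.

End Comparison.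

(** * Local uniqueness of geodesics *)

Definition near_geo {R : realType} {X : metricType R} (e : R) (c c' : R -> X) :=
  forall t, 0 <= t -> t <= 1 -> mdist (c t) (c' t) < e.

(* Within distance [e] of [c], geodesics are ordered as soon as their endpoints
   are; in particular they are determined by their endpoints. *)
Definition ordered_ball {R : realType} {X : metricType R} (S : causal_data R X)
    (e : R) (c : R -> X) := forall c1 c2 l1 l2, tg S c1 l1 -> tg S c2 l2 ->
  near_geo e c c1 -> near_geo e c c2 -> cle S (c1 0) (c2 0) ->
  cle S (c1 1) (c2 1) -> forall t, 0 <= t -> t <= 1 -> cle S (c1 t) (c2 t).

Section LocalUniqueness.
Context {R : realType} {X : metricType R} (S : causal_data R X) (hS : tame S).
Implicit Types (x y z p q m : X) (U V W : set X) (c : R -> X) (l e : R).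

Local Notation "x ≼ y" := (cle S x y) (at level 70).
Local Notation "x ≪ y" := (cll S x y) (at level 70).

(** Inside a comparison neighborhood a locally maximizing curve is globally maximizing:
    [tg_comparison] in both directions identifies it with the maximizer between its ends. *)
Lemma tg_small_lin c l U : tg S c l -> cmp S U ->
  diamond S (c 0) (c 1) `<=` U -> lin S c l.
Proof.
move=> tc cU dU.
have c01 : c 0 ≪ c 1 by apply: (tg_ll hS tc).
have Ud z : diamond S (c 0) (c 1) z -> U z by move=> /dU.
have [U0 U1] : U (c 0) /\ U (c 1).
  by split; apply: Ud; [apply: diamondl|apply: diamondr] => //; exact: t_ll_le.
have [c' [cc' lc' c'0 c'1]] := cmp_ex hS cU c01 dU.
have tr0 : 0 < tr S (c 0) (c 1) by apply: (tr_gt0 hS cU).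
have tc' := lin_tg cc' lc' tr0.
have ord b b' k k' : tg S b k -> tg S b' k' -> b 0 = c 0 -> b 1 = c 1 ->
    b' 0 = c 0 -> b' 1 = c 1 -> forall t, 0 <= t -> t <= 1 -> b t ≼ b' t.
  move=> tb tb' b0 b1 b'0 b'1.
  have in01 (d s : R) : 0 <= d -> d <= 1 -> 0 <= s -> s <= 1 ->
      [/\ 0 <= 0 + (1 - d) * s, 0 + (1 - d) * s <= 1, 0 <= d + (1 - d) * s
        & d + (1 - d) * s <= 1].
    move=> d0 d1 s0 s1; have : 0 <= (1 - d) * s by rewrite mulr_ge0// subr_ge0.
    have : (1 - d) * s <= (1 - d) * 1 by rewrite ler_wpM2l// subr_ge0.
    by clear -d0; split; lra.
  (* At deformation parameter [1] both curves have shrunk to the points [c 0] and [c 1], so the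
     initial condition is just [c 0 << c 1]. The neighborhood [U] contains the whole diamond and
     serves all parameters. *)
  apply: (@tg_comparison _ _ _ hS _ _ _ _ 1 1 tb tb') => //.
  - move=> t t0 t1; exists U => // d u v d0 d1 u0 uv v1 _ _.
    have v0 := le_trans u0 uv; have u1 := le_trans uv v1.
    have [? ? ? ?] := in01 d u d0 d1 u0 u1; have [? ? ? ?] := in01 d v d0 d1 v0 v1.
    split; (apply: subset_trans dU; apply: (diamond_sub hS)).
    + by rewrite -b0; apply: (tg_le hS tb).
    + by rewrite -b1; apply: (tg_le hS tb).
    + by rewrite -b'0; apply: (tg_le hS tb').
    + by rewrite -b'1; apply: (tg_le hS tb').
  - by move=> t t0 t1; rewrite subrr !mul0r !addr0 b0 b'1.
  - by rewrite b0 b'0; exact: t_refl.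
  - by rewrite b1 b'1; exact: t_refl.
have e t : 0 <= t -> t <= 1 -> c t = c' t.
  move=> t0 t1; apply: (t_anti hS).
    exact: (ord _ _ _ _ tc tc').
  exact: (ord _ _ _ _ tc' tc).
have lc : lin S c (tr S (c 0) (c 1)).
  move=> r s r0 rs s1.
  by rewrite (e r r0 (le_trans rs s1)) (e s (le_trans r0 rs) s1) lc'.
suff -> : l = tr S (c 0) (c 1) by [].
have [l0 _ [d d0 hd]] := tc; pose m := Num.min d 1.
have [m0 md m1] : [/\ 0 < m, m <= d & m <= 1] by split; rewrite /m ?lt_min ?d0 ?ltr01// ge_min lexx ?orbT.
have := lc 0 m (lexx _) (ltW m0) m1; rewrite hd ?subr0//; last exact: ltW.
by move=> [] /(mulIf (lt0r_neq0 m0)).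
Qed.

Lemma tg_small_unique c c' l l' U : tg S c l -> tg S c' l' -> cmp S U ->
  c 0 = c' 0 -> c 1 = c' 1 -> diamond S (c 0) (c 1) `<=` U ->
  forall t, 0 <= t -> t <= 1 -> c t = c' t.
Proof.
move=> tc tc' cU e0 e1 dU; have lc := tg_small_lin tc cU dU.
have lc' : lin S c' l' by apply: (tg_small_lin tc' cU); rewrite -e0 -e1.
by have [l0 _ _] := tc; apply: (cmp_uniq cU lc lc').
Qed.

(** A Lebesgue number for a cover along a curve, with the same [e] measuring parameters on the curve
    and distances from it. *)
Lemma lebesgue c (VV : set (set X)) : continuous c ->
  (forall x, exists2 V, nbhs x V & VV V) ->
  exists2 e, 0 < e & forall t, 0 <= t -> t <= 1 -> exists2 V, VV V &
    forall u, `|u - t| < e -> forall z, mdist (c u) z < e -> V z.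
Proof.
move=> cc hV.
pose P e t := exists2 V, VV V &
    forall u, `|u - t| < e -> forall z, mdist (c u) z < e -> V z.
suff : \forall e \near (0:R)^'+, forall t, 0 <= t -> t <= 1 -> P e t.
  move=> h; near (0 : R)^'+ => e; exists e; first by near: e; exact: nbhs_right_gt.
  by near: e; exact: h.
apply: seg_near => t t0 t1.
have [V /nbhs_mdist[r r0 hr] VVV] := hV (c t).
have r2 : 0 < r / 2 by rewrite divr_gt0.
have /continuousPdist/(_ _ r2)[d d0 hd] := cc t.
exists ([set t' | `|t' - t| < d / 2], [set e | e < Num.min (d / 2) (r / 2)]).
  split; first by apply: near_dist; rewrite divr_gt0.
  by apply: nbhs_right_lt; rewrite lt_min !divr_gt0.
move=> [t' e] /= [t't]; rewrite lt_min => /andP[ed er].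
exists V => // u ut' z uz; apply: hr.
have := hd u; have : `|u - t| < d.
  have -> : u - t = (u - t') + (t' - t) by ring.
  by apply: le_lt_trans (ler_normD _ _) _; lra.
move=> /[swap] /[apply] ctu; apply: le_lt_trans (metric_triangle _ (c u) _) _.
by clear -er uz ctu; lra.
Unshelve. all: by end_near. Qed.

Definition convex_in U V := forall p q, V p -> V q -> diamond S p q `<=` U.

Lemma local_convex x W : nbhs x W -> exists2 V, nbhs x V &
  exists2 U, cmp S U & U `<=` W /\ convex_in U V.
Proof.
move=> nW; have [U nU cU] := t_local hS x.
have [V nV hV] := strongly_causal hS (filterI nU nW).
exists V => //; exists (U `&` W); first by apply: (cmp_subset cU); exact: subIsetl.
by split; [exact: subIsetr|exact: hV].
Qed.

Lemma near_geo_sym e c c' : near_geo e c c' -> near_geo e c' c.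
Proof. by move=> h t t0 t1; rewrite metric_sym; exact: h. Qed.

Lemma near_geo_trans e e' c c' c'' : near_geo e c c' -> near_geo e' c' c'' ->
  near_geo (e + e') c c''.
Proof.
move=> h h' t t0 t1; apply: le_lt_trans (metric_triangle _ (c' t) _) _.
by rewrite ltrD// ?h// h'.
Qed.

Lemma near_geo_le e e' c c' : e <= e' -> near_geo e c c' -> near_geo e' c c'.
Proof. by move=> ee' h t t0 t1; apply: lt_le_trans ee'; exact: h. Qed.

Lemma ordered_ball_le e e' c : e' <= e -> ordered_ball S e c -> ordered_ball S e' c.
Proof.
by move=> ee' h c1 c2 l1 l2 t1 t2 n1 n2; apply: (h _ _ l1 l2) => //;
  exact: near_geo_le ee' _.
Qed.

Lemma ordered_ball_near e c c' : near_geo (e / 2) c c' -> ordered_ball S e c ->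
  ordered_ball S (e / 2) c'.
Proof.
move=> n h c1 c2 l1 l2 t1 t2 n1 n2; apply: (h _ _ l1 l2) => //.
  by have := near_geo_trans n n1; rewrite -splitr.
by have := near_geo_trans n n2; rewrite -splitr.
Qed.

Lemma ordered_ball_unique e c c1 c2 l1 l2 : ordered_ball S e c ->
  tg S c1 l1 -> tg S c2 l2 -> near_geo e c c1 -> near_geo e c c2 ->
  c1 0 = c2 0 -> c1 1 = c2 1 -> forall t, 0 <= t -> t <= 1 -> c1 t = c2 t.
Proof.
move=> h t1 t2 n1 n2 e0 e1 t tg0 tl1; apply: (t_anti hS).
  by apply: (h _ _ _ _ t1 t2) => //; rewrite ?e0 ?e1; exact: t_refl.
by apply: (h _ _ _ _ t2 t1) => //; rewrite ?e0 ?e1; exact: t_refl.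
Qed.

(** At parameter shift [d] the points [pt t << ptw t] are uniformly apart: the timelike relation is
    open and [[0, 1]] compact, so it persists for all points within some [e1]. This supplies the
    initial condition of [tg_comparison] for any two curves close to [c]. *)
Lemma local_order c l : tg S c l -> exists2 e, 0 < e & ordered_ball S e c.
Proof.
move=> tc; have [l0 cc _] := tc.
have [e e0 he] := @lebesgue c [set V | exists2 U, cmp S U & convex_in U V] cc
   (fun x => let: ex_intro2 V nV (ex_intro2 U cU (conj _ h)) :=
     local_convex (@filterT _ (nbhs x) _) in ex_intro2 _ _ V nV (ex_intro2 _ _ U cU h)).
(* The deformation moves a parameter by at most [d < e / 2], so one within [e / 2] of [t] stays in
   the window of radius [e] where a single convex neighborhood is available. *)
have [d [d0 d1 de]] : exists d, [/\ 0 < d, d <= 1/2 & d < e / 2].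
  exists (Num.min (1 / 2) (e / 4)); rewrite lt_min ge_min lexx gt_min.
  by split=> //; [apply/andP; split; lra|apply/orP; right; lra].
pose ptw t := c (d + (1 - d) * t); pose pt t := c ((1 - d) * t).
have : \forall e1 \near (0:R)^'+, forall t, 0 <= t -> t <= 1 -> forall z z',
    mdist (pt t) z < e1 -> mdist (ptw t) z' < e1 -> z ≪ z'.
  apply: seg_near => t t0 t1.
  have ll : pt t ≪ ptw t.
    by rewrite /pt /ptw; have := tg_ll hS tc; apply; nra.
  have [[A B] /= [/nbhs_mdist[a a0 ha] /nbhs_mdist[b b0 hb]] AB] := t_open hS ll.
  have a2 : 0 < a / 2 by rewrite divr_gt0.
  have b2 : 0 < b / 2 by rewrite divr_gt0.
  have cpt : {for t, continuous pt}.
    apply: (cont_cvg cc); apply: cvgM; first exact: cvg_cst.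
    exact: cvg_id.
  have cptw : {for t, continuous ptw}.
    apply: (cont_cvg cc); apply: cvgD; first exact: cvg_cst.
    by apply: cvgM; [exact: cvg_cst|exact: cvg_id].
  have n1 : \forall t' \near t, mdist (pt t) (pt t') < a / 2 by exact: (cvg_near_mdist cpt a2).
  have n2 : \forall t' \near t, mdist (ptw t) (ptw t') < b / 2 by exact: (cvg_near_mdist cptw b2).
  exists ([set t' | mdist (pt t) (pt t') < a / 2 /\ mdist (ptw t) (ptw t') < b / 2],
          [set e | e < Num.min (a / 2) (b / 2)]).
    split; first exact: (filterI n1 n2).
    by apply: nbhs_right_lt; rewrite lt_min a2 b2.
  move=> [t' e1] /= [[m1 m2]]; rewrite lt_min => /andP[ea eb] z z' zz zz'.
  apply: (AB (z, z')); split => /=.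
    apply: ha; apply: le_lt_trans (metric_triangle _ (pt t') _) _.
    by clear -m1 zz ea; lra.
  apply: hb; apply: le_lt_trans (metric_triangle _ (ptw t') _) _.
  by clear -m2 zz' eb; lra.
move=> hsep; near (0:R)^'+ => e1.
have e10 : 0 < e1 by near: e1; exact: nbhs_right_gt.
have e1e : e1 <= e by near: e1; exact: nbhs_right_le.
have sep : forall t, 0 <= t -> t <= 1 -> forall z z',
    mdist (pt t) z < e1 -> mdist (ptw t) z' < e1 -> z ≪ z' by near: e1.
exists e1 => // c1 c2 l1 l2 t1 t2 n1 n2 i0 i1.
have d1' : d <= 1 by clear -d1; lra.
have e20 : 0 < e / 2 by rewrite divr_gt0.
have in01 (d' s : R) : 0 <= d' -> d' <= d -> 0 <= s -> s <= 1 ->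
      [/\ 0 <= (1 - d') * s, (1 - d') * s <= 1, 0 <= d' + (1 - d') * s
        & d' + (1 - d') * s <= 1].
    move=> d'0 d'd s0 s1.
    have : 0 <= (1 - d') * s by rewrite mulr_ge0// subr_ge0 (le_trans d'd).
    have : (1 - d') * s <= (1 - d') * 1 by rewrite ler_wpM2l// subr_ge0 (le_trans d'd).
    by clear -d'0; split; lra.
apply: (@tg_comparison _ _ _ hS _ _ _ _ d (e / 2) t1 t2) => //.
- move=> t t0 t1'; have [V [U cU cvx] hV] := he t t0 t1'; exists U => //.
  move=> d' u v d'0 d'd u0 uv v1 ut vt.
  have near1 s : 0 <= s -> s <= 1 -> `|s - t| <= e / 2 ->
     V (c1 (0 + (1 - d') * s)) /\ V (c2 (d' + (1 - d') * s)).
    move=> s0 s1 st; rewrite add0r; have [w1 w2 w3 w4] := in01 d' s d'0 d'd s0 s1.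
    have d's0 : 0 <= d' * s by rewrite mulr_ge0.
    have d's1 : d' * s <= d' * 1 by rewrite ler_wpM2l.
    move: st => /ler_normlP[st1 st2].
    split.
      apply: (hV ((1 - d') * s)); last by apply: lt_le_trans e1e; exact: n1.
      by clear -de d'd d's0 d's1 st1 st2; apply/ltr_normlP; split; lra.
    apply: (hV (d' + (1 - d') * s)); last by apply: lt_le_trans e1e; exact: n2.
    by clear -de d'd d'0 d's0 d's1 st1 st2; apply/ltr_normlP; split; lra.
  have [Vu1 Vu2] := near1 u u0 (le_trans uv v1) ut.
  have [Vv1 Vv2] := near1 v (le_trans u0 uv) v1 vt.
  by split; exact: cvx.
- move=> t t0 t1'; have [w1 w2 w3 w4] := in01 d t (ltW d0) (lexx _) t0 t1'.
  by rewrite add0r; apply: (sep t t0 t1'); [exact: n1|exact: n2].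
Unshelve. all: by end_near. Qed.

End LocalUniqueness.

(** * Local existence by chains of midpoints *)

Definition midpoint {R : realType} {X : Type} (S : causal_data R X) (p m q : X) :=
  [/\ cle S p m, cle S m q, tr S p m = tr S p q / 2 & tr S m q = tr S p q / 2].

Section Midpoints.
Context {R : realType} {X : metricType R} (S : causal_data R X) (hS : tame S).
Implicit Types (x y z p q m : X) (U V W : set X) (c : R -> X) (l e : R).

Local Notation "x ≼ y" := (cle S x y) (at level 70).
Local Notation "x ≪ y" := (cll S x y) (at level 70).
Local Notation lleq := (cll_or_eq S).

Lemma lleq_le x y : lleq x y -> x ≼ y.
Proof. by move=> [/(t_ll_le hS)//|->]; exact: t_refl. Qed.

Lemma lleq_trans x y z : lleq x y -> lleq y z -> lleq x z.
Proof.
move=> [xy|->//] [yz|<-]; last by left.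
by left; apply: (ll_trans hS) xy yz.
Qed.

Lemma lleq_refl x : lleq x x. Proof. by right. Qed.

Lemma lleq_ll_trans x y z : lleq x y -> y ≪ z -> x ≪ z.
Proof. by move=> /lleq_le; exact: le_ll_trans. Qed.

Lemma ll_lleq_trans x y z : x ≪ y -> lleq y z -> x ≪ z.
Proof. by move=> xy /lleq_le; exact: ll_le_trans. Qed.

Lemma diamond_ends p q U : p ≪ q -> diamond S p q `<=` U -> U p /\ U q.
Proof.
by move=> /(t_ll_le hS) pq dU; split; apply: dU; [exact: diamondl|exact: diamondr].
Qed.

(** Equality in the triangle inequality puts [m] on a maximizer, and half the separation from [p]
    forces its parameter to be [1 / 2]. *)
Lemma midpoint_lin U p m q : cmp S U -> p ≪ q -> diamond S p q `<=` U ->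
  midpoint S p m q -> exists c,
  [/\ continuous c, lin S c (tr S p q), c 0 = p, c 1 = q & c (1 / 2) = m].
Proof.
move=> cU pq dU [pm mq e1 e2].
have [|c [cc lc c0 c1 [r [r0 r1 cr]]]] := cmp_thr cU pq dU pm mq.
  by rewrite e1 e2; lra.
exists c; split=> //.
have [Up Uq] := diamond_ends pq dU.
have := lin_tr lc (lexx 0) r0 r1; rewrite c0 cr e1 subr0.
have tr0 := tr_gt0 hS cU Up Uq pq.
by move=> /(mulfI (lt0r_neq0 tr0)) re; rewrite -cr -re mul1r.
Qed.

Lemma lin_midpoint c l u v : lin S c l -> 0 < l -> 0 <= u -> u <= v -> v <= 1 ->
  midpoint S (c u) (c ((u + v) / 2)) (c v).
Proof.
move=> lc l0 u0 uv v1; split; try (apply: (lin_le hS lc l0); lra).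
  by rewrite !(lin_tr lc); lra.
by rewrite !(lin_tr lc); lra.
Qed.

Lemma midpoint_ex U p q : cmp S U -> p ≪ q -> diamond S p q `<=` U ->
  exists m, midpoint S p m q.
Proof.
move=> cU pq dU; have [c [cc lc c0 c1]] := cmp_ex hS cU pq dU.
have [Up Uq] := diamond_ends pq dU.
have tr0 := tr_gt0 hS cU Up Uq pq.
exists (c ((0 + 1) / 2)); rewrite -{1}c0 -{1}c1.
by apply: (lin_midpoint lc); rewrite ?ler01.
Qed.

Lemma midpoint_unique U p q m m' : cmp S U -> p ≪ q -> diamond S p q `<=` U ->
  midpoint S p m q -> midpoint S p m' q -> m = m'.
Proof.
move=> cU pq dU /(midpoint_lin cU pq dU)[c [cc lc c0 c1 <-]].
move=> /(midpoint_lin cU pq dU)[c' [cc' lc' c'0 c'1 <-]].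
have [Up Uq] := diamond_ends pq dU.
apply: (cmp_uniq cU lc lc'); rewrite ?c0 ?c1 ?(tr_gt0 hS cU)//; lra.
Qed.

Lemma midpoint_mono U p q p' q' m m' : cmp S U -> p ≪ q -> p' ≪ q' ->
  diamond S p q `<=` U -> diamond S p' q' `<=` U -> lleq p p' -> lleq q q' ->
  midpoint S p m q -> midpoint S p' m' q' -> lleq m m'.
Proof.
move=> cU pq pq' dU dU' pp qq mm mm'.
have [Up Uq] := diamond_ends pq dU; have [Up' Uq'] := diamond_ends pq' dU'.
have [c [cc lc c0 c1 cm]] := midpoint_lin cU pq dU mm.
have [c' [cc' lc' c'0 c'1 cm']] := midpoint_lin cU pq' dU' mm'.
have := cmp_conc cU lc lc' (tr_gt0 hS cU Up Uq pq) (tr_gt0 hS cU Up' Uq' pq').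
rewrite c0 c1 c'0 c'1 => /(_ dU dU' pp qq (1 / 2)); rewrite cm cm'.
move=> /(_ _ _) conc.
have {}conc : 1 / 2 * tr S q q' + (1 - 1 / 2) * tr S p p' <= tr S m m'.
  by apply: conc; lra.
have := tr_ge0 hS p p'; have := tr_ge0 hS q q'.
case: (pp) => [/(tr_gt0 hS cU Up Up') g0 g1 g2|epp].
  by left; apply: (tr_ll hS); lra.
case: (qq) => [/(tr_gt0 hS cU Uq Uq') g0 g1 g2|eqq].
  by left; apply: (tr_ll hS); lra.
by right; rewrite -epp -eqq in mm'; exact: (midpoint_unique cU pq dU).
Qed.

Lemma midpoint_lim {I : Type} (F : set_system I) {FF : ProperFilter F}
    (f g h : I -> X) U p m q : cmp S U -> U p -> U m -> U q ->
  f @ F --> p -> g @ F --> m -> h @ F --> q ->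
  (\forall i \near F, midpoint S (f i) (g i) (h i)) -> midpoint S p m q.
Proof.
move=> cU Up Um Uq fp gm hq Fm.
have l1 : (fun i => tr S (f i) (g i)) @ F --> tr S p m by exact: tr_lim cU Up Um fp gm.
have l2 : (fun i => tr S (g i) (h i)) @ F --> tr S m q by exact: tr_lim cU Um Uq gm hq.
have l3 : (fun i => tr S (f i) (h i) / 2) @ F --> tr S p q / 2.
  by apply: cvgM; [exact: tr_lim cU Up Uq fp hq|exact: cvg_cst].
split.
- by apply: (le_lim hS fp gm); apply: filterS Fm => i [].
- by apply: (le_lim hS gm hq); apply: filterS Fm => i [].
- apply: (cvg_near_eq l1 l3).
  by apply: filterS Fm => i [].
- apply: (cvg_near_eq l2 l3).
  by apply: filterS Fm => i [].
Qed.

(** Midpoints of nearby pairs lie in a fixed compact diamond. Were some of them outside [W] for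
    arbitrarily close pairs, an ultrafilter limit would be a midpoint of [p] and [q], hence [m],
    which is interior to [W]. *)
Lemma midpoint_cont U W p m q : cmp S U -> p ≪ q -> diamond S p q `<=` U ->
  midpoint S p m q -> nbhs m W ->
  \forall z \near (p, q), forall m', midpoint S z.1 m' z.2 -> W m'.
Proof.
move=> cU pq dU mm nW; apply: contrapT => nnear.
pose B A : set ((X * X) * X) :=
  [set w | A w.1 /\ midpoint S w.1.1 w.2 w.1.2 /\ ~ W w.2].
have PG : ProperFilter (filter_from (nbhs (p, q)) B).
  apply: filter_from_proper; first apply: filter_from_filter.
  - by exists setT; exact: filterT.
  - move=> A A' nA nA'; exists (A `&` A'); first exact: filterI.
    by move=> w [[Aw A'w] mw].
  - move=> A nA; apply: contrapT => emp; apply: nnear; apply: filterS nA => z Az m' mz.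
    by apply: contrapT => nWm'; apply: emp; exists (z, m').
have [G [UG sG]] := ultraFilterLemma PG.
have GA A : nbhs (p, q) A -> G (B A) by move=> nA; apply: sG; exists A.
have [pm _ pmp] := t_past hS (@filterT _ _ (nbhs_filter p)).
have [qp _ qqp] := t_fut hS (@filterT _ _ (nbhs_filter q)).
have c1 : (fun w : (X * X) * X => w.1) @ G --> (p, q).
  by move=> A /GA h; apply: (@filterS _ G _ _ _ _ h) => w [].
have cp : (fun w : (X * X) * X => w.1.1) @ G --> p.
  exact: (cvg_comp _ _ c1 cvg_fst).
have cq : (fun w : (X * X) * X => w.1.2) @ G --> q.
  exact: (cvg_comp _ _ c1 cvg_snd).
have Gmid : \forall w \near G, midpoint S w.1.1 w.2 w.1.2 /\ ~ W w.2.
  by apply: filterS (GA setT filterT) => w [].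
have GK : \forall w \near G, diamond S pm qp w.2.
  have h1 : \forall w \near G, pm ≪ w.1.1 by exact: (ll_near hS (cvg_cst pm) cp pmp).
  have h2 : \forall w \near G, w.1.2 ≪ qp by exact: (ll_near hS cq (cvg_cst qp) qqp).
  near=> w; have [[a b _ _] _] : midpoint S w.1.1 w.2 w.1.2 /\ ~ W w.2 by near: w.
  split.
    by apply: (t_trans hS) a; apply: (t_ll_le hS); near: w.
  by apply: (t_trans hS b); apply: (t_ll_le hS); near: w.
have [m' _ cm'] := compact_ultra_cvg (t_compact hS (x:=pm) (y:=qp)) GK.
have [Up Uq] := diamond_ends pq dU.
have Um' : U m'.
  apply: dU; split.
    by apply: (le_lim hS cp cm'); apply: filterS Gmid => w [[]].
  by apply: (le_lim hS cm' cq); apply: filterS Gmid => w [[]].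
have mm' : midpoint S p m' q.
  by apply: (midpoint_lim cU Up Um' Uq cp cm' cq); apply: filterS Gmid => w [].
have e : m' = m by apply: (midpoint_unique cU pq dU).
have nW' : nbhs m' W by rewrite e.
have GW : \forall w \near G, W w.2 by exact: cm'.
by have [w [Ww [_ nWw]]] := @filter_ex _ G _ _ (filterI GW Gmid).
Unshelve. all: by end_near. Qed.

(** Monotone iteration between a sub- and a supersolution. The operator [T] replaces every interior
    entry by the midpoint of its neighbors; it is monotone and preserves the order interval between
    [lo] and [hi]. Iterates of [lo] increase in compact diamonds, and their limit is a fixed
    point. *)
Lemma chain_exists (lo hi : nat -> X) (N : nat) :
  (forall i, (0 < i < N)%N -> exists2 U, cmp S U & diamond S (lo i.-1) (hi i.+1) `<=` U) ->
  (forall i, (0 < i < N)%N -> hi i.-1 ≪ lo i.+1) ->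
  (forall i, (0 < i < N)%N -> forall m, midpoint S (lo i.-1) m (lo i.+1) -> lleq (lo i) m) ->
  (forall i, (0 < i < N)%N -> forall m, midpoint S (hi i.-1) m (hi i.+1) -> lleq m (hi i)) ->
  (forall i, (i <= N)%N -> lleq (lo i) (hi i)) ->
  exists p : nat -> X, (forall i, (i <= N)%N -> lo i ≼ p i /\ p i ≼ hi i) /\
    forall i, (0 < i < N)%N -> midpoint S (p i.-1) (p i) (p i.+1).
Proof.
move=> hU hlohi hlo hhi lohi.
(* A total midpoint function, with the junk value [z.1] for pairs without a midpoint; inside the box
   one always exists. *)
have /choice[mf hmf] : forall z : X * X, exists m,
    (exists m', midpoint S z.1 m' z.2) -> midpoint S z.1 m z.2.
  move=> z; have [[m hm]|no] := pselect (exists m, midpoint S z.1 m z.2); first by exists m.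
  by exists z.1 => /no.
pose T (q : nat -> X) i := if (0 < i < N)%N then mf (q i.-1, q i.+1) else q i.
pose Box (q : nat -> X) := forall i, (i <= N)%N -> lleq (lo i) (q i) /\ lleq (q i) (hi i).
have idx i : (0 < i < N)%N -> [/\ (i.-1 <= N)%N, (i <= N)%N & (i.+1 <= N)%N].
  move=> /andP[i0 iN]; split=> //; last exact: ltnW.
  by apply: leq_trans (leq_pred _) (ltnW iN).
have boxll (q : nat -> X) i : Box q -> (0 < i < N)%N -> q i.-1 ≪ q i.+1.
  move=> bq hi'; have [i1 i2 i3] := idx i hi'.
  apply: lleq_ll_trans (proj2 (bq _ i1)) _.
  by apply: ll_lleq_trans (hlohi i hi') (proj1 (bq _ i3)).
have boxd (q : nat -> X) i : Box q -> (0 < i < N)%N ->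
    diamond S (q i.-1) (q i.+1) `<=` diamond S (lo i.-1) (hi i.+1).
  move=> bq hi'; have [i1 i2 i3] := idx i hi'; apply: (diamond_sub hS).
    exact: lleq_le (proj1 (bq _ i1)).
  exact: lleq_le (proj2 (bq _ i3)).
have boxmid (q : nat -> X) i : Box q -> (0 < i < N)%N -> midpoint S (q i.-1) (T q i) (q i.+1).
  move=> bq hi'; rewrite /T hi'; apply: (hmf (q i.-1, q i.+1)).
  have [U cU dU] := hU i hi'; apply: (midpoint_ex cU); first exact: boxll.
  exact: subset_trans (boxd q i bq hi') dU.
have Tmono (q q' : nat -> X) : Box q -> Box q' -> (forall i, (i <= N)%N -> lleq (q i) (q' i)) ->
    forall i, (i <= N)%N -> lleq (T q i) (T q' i).
  move=> bq bq' qq i iN; have [hi'|nhi] := boolP (0 < i < N)%N; last first.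
    by rewrite /T (negbTE nhi); exact: qq.
  have [i1 i2 i3] := idx i hi'.
  have [U cU dU] := hU i hi'.
  apply: (midpoint_mono cU (boxll _ _ bq hi') (boxll _ _ bq' hi')).
  - exact: subset_trans (boxd q i bq hi') dU.
  - exact: subset_trans (boxd q' i bq' hi') dU.
  - exact: qq.
  - exact: qq.
  - exact: boxmid.
  - exact: boxmid.
have blo : Box lo by move=> i iN; split; [exact: lleq_refl|exact: lohi].
have bhi : Box hi by move=> i iN; split; [exact: lohi|exact: lleq_refl].
have bT (q : nat -> X) : Box q -> Box (T q).
  move=> bq i iN; have [hi'|nhi] := boolP (0 < i < N)%N; last first.
    by rewrite /T (negbTE nhi); exact: bq.
  split.
    apply: lleq_trans (hlo i hi' _ (boxmid lo i blo hi')) _.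
    by apply: Tmono => // j jN; case: (bq j jN).
  apply: lleq_trans (hhi i hi' _ (boxmid hi i bhi hi')).
  by apply: Tmono => // j jN; case: (bq j jN).
pose P k := iter k T lo.
have bP k : Box (P k) by elim: k => // k ih; exact: bT.
have PS k : forall i, (i <= N)%N -> lleq (P k i) (P k.+1 i).
  by elim: k => [i iN|k ih]; [case: (bT _ blo i iN)|exact: Tmono (bP k) (bP k.+1) ih].
have Pmono k j i : (i <= N)%N -> (k <= j)%N -> P k i ≼ P j i.
  move=> iN; elim: j => [|j ih]; first by rewrite leqn0 => /eqP->; exact: t_refl.
  rewrite leq_eqVlt => /predU1P[->|/ih h]; first exact: t_refl.
  exact: t_trans h (lleq_le (PS j i iN)).
have /choice[L hL] : forall i, exists l : X, (i <= N)%N -> (fun k => P k i) @ \oo --> l.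
  move=> i.
  have [iN|Ni] := leqP i N; last by exists (lo 0%N).
  have [||L cL _] := @monotone_cvg _ _ _ hS _ \oo _ (fun k => P k i) (diamond S (lo i) (hi i)) (@t_compact _ _ _ hS _ _).
  - by near=> k; have [/lleq_le ? /lleq_le ?] := bP k i iN; split.
  - by near=> k; near=> j; apply: Pmono => //; near: j; exact: nbhs_infty_ge.
  by exists L.
have Lbox i : (i <= N)%N -> lo i ≼ L i /\ L i ≼ hi i.
  move=> iN; split.
    apply: (le_lim hS (cvg_cst (lo i)) (hL i iN)).
    by near=> k; have [/lleq_le] := bP k i iN.
  apply: (le_lim hS (hL i iN) (cvg_cst (hi i))).
  by near=> k; have [_ /lleq_le] := bP k i iN.
exists L; split=> // i hi'; have [i1 i2 i3] := idx i hi'.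
have [U cU dU] := hU i hi'.
have [a1 b1] := Lbox _ i1; have [a2 b2] := Lbox _ i2; have [a3 b3] := Lbox _ i3.
(* The new entry is a midpoint of old neighbors, so the limit is taken with the index shifted by one
   in the middle. *)
have cvS : (fun k => P k.+1 i) @ \oo --> L i.
  move=> A /(hL i i2)[n _ hA]; exists n => // k /= nk; exact: (hA k.+1 (leqW nk)).
have midk : \forall k \near \oo, midpoint S (P k i.-1) (P k.+1 i) (P k i.+1).
  by near=> k; exact: (boxmid (P k) i (bP k) hi').
have hll := t_ll_le hS (hlohi i hi').
have Lm : L i.-1 ≼ L i.
  by apply: (le_lim hS (hL _ i1) cvS); apply: filterS midk => k [].
have Lm' : L i ≼ L i.+1.
  by apply: (le_lim hS cvS (hL _ i3)); apply: filterS midk => k [].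
apply: (midpoint_lim cU _ _ _ (hL _ i1) cvS (hL _ i3) midk); apply: dU; split=> //.
- by apply: (t_trans hS Lm) (t_trans hS Lm' b3).
- by apply: (t_trans hS a1 Lm).
- by apply: (t_trans hS Lm' b3).
- by apply: (t_trans hS a1 (t_trans hS Lm Lm')).
Unshelve. all: by end_near. Qed.

End Midpoints.

Lemma grid_cell {R : realType} (h t : R) (k : nat) : 0 <= t -> t <= k.+1%:R * h ->
  exists2 i, (i <= k)%N & i%:R * h <= t /\ t <= i.+1%:R * h.
Proof.
elim: k => [|k ih] t0 tk; first by exists 0%N; rewrite // mul0r.
have [tk'|kt] := leP t (k.+1%:R * h).
  by have [i ik it] := ih t0 tk'; exists i => //; exact: leqW.
by exists k.+1 => //; split=> //; exact: ltW.
Qed.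

(** * From a chain of midpoints to a geodesic *)

Section ChainToGeodesic.
Context {R : realType} {X : metricType R} (S : causal_data R X) (hS : tame S).
Implicit Types (x y z p q m : X) (U V W : set X) (c : R -> X) (l e : R).

Local Notation "x ≼ y" := (cle S x y) (at level 70).
Local Notation "x ≪ y" := (cll S x y) (at level 70).
Local Notation lleq := (cll_or_eq S).

(** Agreement on the whole overlap, not only at [b], means that near every point the glued map is
    one of the two. *)
Lemma continuous_glue (f g : R -> X) (a b : R) : a < b ->
  continuous f -> continuous g -> (forall t, a < t -> t <= b -> f t = g t) ->
  continuous (fun t => if t <= b then f t else g t).
Proof.
move=> ab cf cg fg t; pose F u := if u <= b then f u else g u.
suff : F @ t --> F t by [].
have [tb|bt] := ltP t b.
  have -> : F t = f t by rewrite /F ltW.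
  apply: (@cvg_trans _ (f @ t)); last exact: cf.
  by apply: near_eq_cvg; near=> u; rewrite /F ifT//; apply: ltW; near: u; exact: lt_nbhsl.
have at_ := lt_le_trans ab bt.
have -> : F t = g t by rewrite /F; case: ifPn => // tb; exact: fg.
apply: (@cvg_trans _ (g @ t)); last exact: cg.
apply: near_eq_cvg; near=> u; rewrite /F; case: ifPn => // ub; rewrite fg//.
near: u; exact: lt_nbhsr.
Unshelve. all: by end_near. Qed.

(** The maximizers from [p i.-1] through [p i] to [p i.+1] overlap pairwise and coincide on the
    overlaps by uniqueness. All steps have the same separation [L], since each midpoint halves its
    interval. So the glued map has speed [L] on unit windows, and rescaling by [N] ends the
    construction. *)
Lemma chain_geodesic (p : nat -> X) (N : nat) : (1 < N)%N ->
  (forall i, (0 < i < N)%N -> exists2 U, cmp S U &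
     diamond S (p i.-1) (p i.+1) `<=` U) ->
  (forall i, (0 < i < N)%N -> p i.-1 ≪ p i.+1) ->
  (forall i, (0 < i < N)%N -> midpoint S (p i.-1) (p i) (p i.+1)) ->
  exists c l, [/\ tg S c l, c 0 = p 0%N, c 1 = p N &
    forall i t, (i < N)%N -> i%:R * N%:R^-1 <= t -> t <= i.+1%:R * N%:R^-1 ->
      diamond S (p i) (p i.+1) (c t)].
Proof.
move=> N1 hU hll hmid; pose L := tr S (p 0%N) (p 2%N) / 2.
have L0 : 0 < L.
  have [U cU dU] := hU 1%N N1; have [U0 U2] := diamond_ends hS (hll 1%N N1) dU.
  by rewrite divr_gt0//; exact: (tr_gt0 hS cU U0 U2 (hll 1%N N1)).
pose unit_speed (s : R -> X) (k : nat) := forall r r' : R, 0 <= r -> r <= r' ->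
  r' <= k%:R -> r' - r <= 1 -> tau S (s r) (s r') = (L * (r' - r))%:E.
have main k : (k.+2 <= N)%N -> exists s : R -> X, [/\ continuous s,
    unit_speed s k.+2 & forall i, (i <= k.+2)%N -> s i%:R = p i].
  elim: k => [|k ih] kN.
    have [U cU dU] := hU 1%N kN.
    have [c [cc lc c0 c1 ch]] := midpoint_lin hS cU (hll 1%N kN) dU (hmid 1%N kN).
    exists (fun t => c (t / 2)); split.
    - move=> t; apply: (cont_cvg cc).
      by apply: cvgM; [exact: cvg_id|exact: cvg_cst].
    - move=> r r' r0 rr r2 _; rewrite lc; first by congr EFin; rewrite /L /=; lra.
      + by rewrite divr_ge0.
      + by rewrite ler_pM2r// invr_gt0.
      + by rewrite ler_pdivrMr// mul1r.
    - move=> [|[|[|//]]] _; first by rewrite mul0r c0.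
        by rewrite ch.
      by rewrite divff// c1.
  have [s [cs us sp]] := ih (ltnW kN); have kN' : (0 < k.+2 < N)%N by [].
  have [U cU dU] := hU _ kN'; have ll := hll _ kN'; have mid := hmid _ kN'.
  have [c [cc lc c0 c1 ch]] := midpoint_lin hS cU ll dU mid; move: mid ll dU c0 c1 => /=.
  move=> [pm mq e1 e2] ll dU c0 c1.
  have nk : k.+2%:R = k.+1%:R + 1 :> R by rewrite -[in LHS]natr1.
  have nk' : k.+3%:R = k.+1%:R + 2 :> R by rewrite -[in LHS]natr1 nk; ring.
  have k0 : 0 <= k.+1%:R :> R by [].
  have trL : tr S (p k.+1) (p k.+3) = L * 2.
    have := us k.+1%:R k.+2%:R k0; rewrite nk lerDl ler01 lexx addrAC subrr add0r lexx.
    move=> /(_ isT isT isT); rewrite -nk !sp// => h.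
    by move: e1; rewrite {1}/tr h /= mulr1 => ->; lra.
  rewrite trL in lc.
  pose s' t := if t <= k.+2%:R then s t else c ((t - k.+1%:R) / 2).
  (* The old curve and the first half of the new maximizer are both affine of speed [L] from
     [p k.+1] to [p k.+2]. *)
  have agree t : k.+1%:R <= t -> t <= k.+2%:R -> s t = c ((t - k.+1%:R) / 2).
    move=> kt tk.
    have l1 : lin S (fun w => s (k.+1%:R + w)) L.
      move=> r r' r0 rr r1; rewrite us; first by congr EFin; ring.
      - by rewrite addr_ge0.
      - by rewrite lerD2l.
      - by rewrite nk lerD2l.
      - by clear -r0 r1; lra.
    have l2 : lin S (fun w => c (w / 2)) L.
      move=> r r' r0 rr r1; rewrite lc; first by congr EFin; lra.
      - by rewrite divr_ge0.
      - by rewrite ler_pM2r// invr_gt0.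
      - by clear -r1; lra.
    have := cmp_uniq cU l1 l2 L0; rewrite /= addr0 mul0r c0 mul1r -nk !sp//.
    rewrite -[2^-1]mul1r ch => /(_ erefl erefl).
    have dU' : diamond S (p k.+1) (p k.+2) `<=` U.
      by apply: subset_trans dU; apply: (diamond_sub hS) => //; exact: t_refl.
    move=> /(_ dU' (t - k.+1%:R)); rewrite subr_ge0 kt lerBlDl -nk tk subrKC.
    exact.
  have s'l t : t <= k.+2%:R -> s' t = s t by rewrite /s' => ->.
  have s'r t : k.+1%:R <= t -> s' t = c ((t - k.+1%:R) / 2).
    by move=> kt; rewrite /s'; case: ifPn => // tk; exact: agree.
  exists s'; split.
  - apply: (@continuous_glue _ _ k.+1%:R); rewrite ?nk ?ltrDl//.
      move=> t; apply: (cont_cvg cc); apply: cvgM; last exact: cvg_cst.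
      by apply: cvgB; [exact: cvg_id|exact: cvg_cst].
    by move=> t kt tk; apply: agree; [exact: ltW|rewrite nk].
  - move=> r r' r0 rr rk rr1.
    have [r'k|kr'] := leP r' k.+2%:R.
      by rewrite !s'l ?(le_trans rr)// us.
    (* A window of length at most [1] that ends after [k.+2] begins after [k.+1], so it lies
       entirely in the last maximizer. *)
    have kr : k.+1%:R <= r by rewrite nk in kr'; clear -rr1 kr'; lra.
    rewrite (s'r _ kr) (s'r _ (le_trans kr rr)).
    rewrite lc; first by congr EFin; lra.
    + by clear -kr; lra.
    + by clear -rr; lra.
    + by rewrite nk' in rk; clear -rk; lra.
  - move=> i; rewrite leq_eqVlt => /predU1P[->|ik].
      rewrite s'r ?nk'; last by rewrite lerDl.
      by rewrite addrAC subrr add0r divff.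
    by rewrite s'l ?ler_nat// sp.
have [s [cs us sp]] : exists s : R -> X, [/\ continuous s,
    unit_speed s N & forall i, (i <= N)%N -> s i%:R = p i].
  by case: (N) N1 main => [|[|k]] // _ /(_ k (leqnn _)).
have N0 : 0 < N%:R :> R by rewrite ltr0n ltnW.
exists (fun t => s (N%:R * t)), (L * N%:R); split.
- split; first by rewrite mulr_gt0.
    by move=> t; apply: (cont_cvg cs); apply: cvgM; [exact: cvg_cst|exact: cvg_id].
  exists N%:R^-1; first by rewrite invr_gt0.
  move=> r r' r0 rr r1 rN; rewrite us; first by congr EFin; ring.
  + by rewrite mulr_ge0// ltW.
  + by rewrite ler_pM2l.
  + by rewrite -[leRHS]mulr1 ler_pM2l.
  + by rewrite -mulrBr -ler_pdivlMl// mulr1.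
- by rewrite mulr0 (sp 0%N).
- by rewrite mulr1 sp.
- move=> i t iN; rewrite ler_pdivrMr// ler_pdivlMr// mulrC => it ti.
  have mono (r r' : R) : 0 <= r -> r <= r' -> r' <= N%:R -> r' - r <= 1 -> s r ≼ s r'.
    move=> r0; rewrite le_eqVlt => /predU1P[->|rr] rN r1; first by move=> *; exact: t_refl.
    apply: (t_ll_le hS); apply/(t_pos hS); rewrite us// ?ltW// lte_fin mulr_gt0//.
    by rewrite subr_gt0.
  have i1 : i.+1%:R = i%:R + 1 :> R by rewrite -natr1.
  have iN' : i.+1%:R <= N%:R :> R by rewrite ler_nat.
  rewrite -(sp i) ?(ltnW iN)// -(sp i.+1)//; split; apply: mono => //.
  + exact: le_trans iN'.
  + by move: ti; rewrite i1; clear; lra.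
  + by apply: le_trans it.
  + by move: it; rewrite i1; clear; lra.
Qed.

End ChainToGeodesic.

(** * Geodesics between perturbed endpoints *)

Section LocalExistence.
Context {R : realType} {X : metricType R} (S : causal_data R X) (hS : tame S).
Implicit Types (x y z p q m : X) (U V W : set X) (c : R -> X) (l e : R).

Local Notation "x ≼ y" := (cle S x y) (at level 70).
Local Notation "x ≪ y" := (cll S x y) (at level 70).
Local Notation lleq := (cll_or_eq S).

Lemma tg_midpoint c l d u v : 0 < l ->
  (forall r s, 0 <= r -> r <= s -> s <= 1 -> s - r <= d ->
     tau S (c r) (c s) = (l * (s - r))%:E) ->
  0 <= u -> u < v -> v <= 1 -> v - u <= d ->
  midpoint S (c u) (c ((u + v) / 2)) (c v).
Proof.
move=> l0 hd u0 uv v1 uvd.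
have h1 : tau S (c u) (c ((u + v) / 2)) = (l * ((u + v) / 2 - u))%:E.
  by apply: hd; clear -u0 uv v1 uvd; lra.
have h2 : tau S (c ((u + v) / 2)) (c v) = (l * (v - (u + v) / 2))%:E.
  by apply: hd; clear -u0 uv v1 uvd; lra.
have h3 : tau S (c u) (c v) = (l * (v - u))%:E by apply: hd => //; exact: ltW.
split.
- by apply: (t_ll_le hS); apply/(t_pos hS); rewrite h1 lte_fin mulr_gt0//; clear -uv; lra.
- by apply: (t_ll_le hS); apply/(t_pos hS); rewrite h2 lte_fin mulr_gt0//; clear -uv; lra.
- by rewrite /tr h1 h3 /=; field.
- by rewrite /tr h2 h3 /=; field.
Qed.

(** The midpoint of [c u] and [c v] is [c ((u + v) / 2)], and [c w] is in its open timelike past or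
    future. By [midpoint_cont] this survives a perturbation of the ends; it gives the barrier
    inequalities next to the moved endpoints. *)
Lemma midpoint_barrier c l d u v w U : tg S c l ->
  (forall r s, 0 <= r -> r <= s -> s <= 1 -> s - r <= d ->
     tau S (c r) (c s) = (l * (s - r))%:E) ->
  0 <= u -> u < v -> v <= 1 -> v - u <= d -> 0 <= w -> w <= 1 ->
  cmp S U -> diamond S (c u) (c v) `<=` U ->
  (w < (u + v) / 2 -> \forall z \near (c u, c v),
     forall m, midpoint S z.1 m z.2 -> c w ≪ m) /\
  ((u + v) / 2 < w -> \forall z \near (c u, c v),
     forall m, midpoint S z.1 m z.2 -> m ≪ c w).
Proof.
move=> tc hd u0 uv v1 uvd w0 w1 cU dU; have [l0 _ _] := tc.
have mid := tg_midpoint l0 hd u0 uv v1 uvd.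
have ll : c u ≪ c v by exact: (tg_ll hS tc).
split=> wuv; apply: (midpoint_cont hS cU ll dU mid).
  apply: (fut_nbhs hS); apply: (tg_ll hS tc) => //; clear -u0 uv v1; lra.
by apply: (past_nbhs hS); apply: (tg_ll hS tc) => //; clear -u0 uv v1; lra.
Qed.

Lemma near_fst (p q : X) (P : X -> X -> Prop) :
  (\forall z \near (p, q), P z.1 z.2) -> \forall z \near p, P z q.
Proof.
move=> h; have cp : (fun z => (z, q)) @ p --> (p, q).
  by apply: cvg_pair; [exact: cvg_id|exact: cvg_cst].
exact: (cp _ h).
Qed.

Lemma near_snd (p q : X) (P : X -> X -> Prop) :
  (\forall z \near (p, q), P z.1 z.2) -> \forall z \near q, P p z.
Proof.
move=> h; have cp : (fun z => (p, z)) @ q --> (p, q).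
  by apply: cvg_pair; [exact: cvg_cst|exact: cvg_id].
exact: (cp _ h).
Qed.

Lemma near_pair (p q : X) (P Q : X -> Prop) : (\forall z \near p, P z) ->
  (\forall z \near q, Q z) -> \forall z \near (p, q), P z.1 /\ Q z.2.
Proof. by move=> hP hQ; exists (P, Q). Qed.

(** [chain_exists] is applied to a fine grid on [c], shifted back or forth by a quarter cell in the
    interior, with the prescribed points as ends of both barriers. In the interior a shifted grid
    solves the midpoint equation exactly. Next to an end the barrier inequality is strict, hence
    stable when the end moves. *)
Lemma tg_exists_near c l e : tg S c l -> 0 < e ->
  \forall z \near (c 0, c 1), exists s k,
    [/\ tg S s k, s 0 = z.1, s 1 = z.2 & near_geo e c s].
Proof.
move=> tc e0; have [l0 cc [d d0 hd]] := tc.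
have hV x : exists2 V, nbhs x V & exists2 U, cmp S U &
    (forall y y', U y -> U y' -> mdist y y' < e) /\ convex_in S U V.
  have e2 : 0 < e / 2 by rewrite divr_gt0.
  have [V nV [U cU [UW cvx]]] := local_convex hS (near_mdist x e2).
  exists V => //; exists U => //; split=> // y y' /UW/= hy /UW/= hy'.
  apply: le_lt_trans (metric_triangle _ x _) _; rewrite metric_sym.
  by clear -hy hy'; lra.
have [e1 e10 he1] := lebesgue cc hV.
(* Two cells with shifts of [h / 4] at both ends have length at most [5 h / 2], so [3 h] below [d]
   and [e1] suffices for every window in use. *)
have [N [N0 N3 Nd Ne]] : exists N : nat, [/\ (0 < N)%N, (3 <= N)%N,
    3 < N%:R * d & 3 < N%:R * e1].
  have m0 : 0 < Num.min d e1 by rewrite lt_min d0.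
  have [k hk] := archi_mul 4 m0; exists k.+3; split=> //.
    have : Num.min d e1 <= d by rewrite ge_min lexx.
    have : 0 <= (3 : R) * d by rewrite mulr_ge0// ltW.
    rewrite -addn3 natrD mulrDl => a b.
    have : k%:R * Num.min d e1 <= k%:R * d by rewrite ler_wpM2l.
    by clear -a hk; lra.
  have : Num.min d e1 <= e1 by rewrite ge_min lexx orbT.
  have : 0 <= (3 : R) * e1 by rewrite mulr_ge0// ltW.
  rewrite -addn3 natrD mulrDl => a b.
  have : k%:R * Num.min d e1 <= k%:R * e1 by rewrite ler_wpM2l.
  by clear -a hk; lra.
have NR0 : 0 < N%:R :> R by rewrite ltr0n.
pose h : R := N%:R^-1; have h0 : 0 < h by rewrite invr_gt0.
have Nh : N%:R * h = 1 by rewrite divff// gt_eqF.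
have hd3 : 3 * h < d by rewrite ltr_pdivrMr// mulrC.
have he3 : 3 * h < e1 by rewrite ltr_pdivrMr// mulrC.
have N13 : 3 * h <= 1.
  by have : 3%:R * h <= N%:R * h; [rewrite ler_wpM2r ?(ltW h0)// ler_nat|rewrite Nh].
(* [g i s] is the grid point [i h] of [c] shifted by [s h / 4], with [s = -1] for
   the lower and [s = 1] for the upper barrier. *)
pose g (s : R) (i : nat) := i%:R * h + s * (h / 4).
have gS s i : g s i.+1 = g s i + h by rewrite /g -natr1; ring.
have gN (i j : nat) s : (i + j)%N = N -> g s i = 1 - j%:R * h + s * (h / 4).
  move=> ij; have : (i%:R + j%:R) * h = 1 by rewrite -natrD ij.
  by rewrite /g; clear; lra.
have g01 s i : -1 <= s -> s <= 1 -> (0 < i < N)%N -> 0 < g s i /\ g s i < 1.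
  move=> s0 s1 /andP[i0 iN]; have i1 : 1 * h <= i%:R * h by rewrite ler_wpM2r ?(ltW h0)// ler1n.
  have iN1 : i.+1%:R * h <= N%:R * h by rewrite ler_wpM2r ?(ltW h0)// ler_nat.
  rewrite Nh -natr1 mulrDl in iN1; rewrite /g.
  have hh : - 1 * h <= s * h by rewrite ler_wpM2r ?(ltW h0).
  have hh' : s * h <= 1 * h by rewrite ler_wpM2r ?(ltW h0).
  by clear -i1 iN1 hh hh' h0; lra.
have N2 : (0 < 2 < N)%N by rewrite (leq_trans _ N3).
have N1 : (0 < 1 < N)%N by rewrite (leq_trans _ N3).
have NP : exists M, N = M.+3 by exists (N - 3)%N; rewrite -addn3 subnK.
have [M eN] := NP.
have NM1 : (0 < M.+1 < N)%N by rewrite eN /= leqnSn.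
have NM2 : (0 < M.+2 < N)%N by rewrite eN /= ltnSn.
have gM1 s : g s M.+1 = 1 - 2 * h + s * (h / 4) by apply: (gN _ 2%N); rewrite eN addn2.
have gM2 s : g s M.+2 = 1 - h + s * (h / 4) by rewrite (gN _ 1%N) ?mul1r// eN addn1.
have g1 s : g s 1%N = h + s * (h / 4) by rewrite /g mul1r.
have g2 s : g s 2%N = 2 * h + s * (h / 4) by rewrite /g.
have m1le : -1 <= -1 :> R by exact: lexx.
have m11 : -1 <= 1 :> R by lra.
have nearV t : 0 <= t -> t <= 1 -> exists2 U, cmp S U &
   (forall y y', U y -> U y' -> mdist y y' < e) /\ exists2 V,
     (forall u, `|u - t| < e1 -> forall z, mdist (c u) z < e1 -> V z) & convex_in S U V.
  move=> t0 t1; have [V [U cU [dU cvx]] hVt] := he1 t t0 t1.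
  by exists U => //; split=> //; exists V.
have left s : -1 <= s -> s <= 1 -> \forall z \near c 0, [/\ mdist (c 0) z < e1,
    z ≪ c (g (-1) 2%N),
    s < 0 -> forall m, midpoint S z m (c (g s 2%N)) -> c (g s 1%N) ≪ m &
    0 < s -> forall m, midpoint S z m (c (g s 2%N)) -> m ≪ c (g s 1%N)].
  move=> s0 s1; have [a1 b1] := g01 s 1%N s0 s1 N1; have [a2 b2] := g01 s 2%N s0 s1 N2.
  have sh : -1 * h <= s * h by rewrite ler_wpM2r// ltW.
  have sh' : s * h <= 1 * h by rewrite ler_wpM2r// ltW.
  have [U cU [_ [V hVV cvx]]] := nearV 0 (lexx _) ler01.
  have dU : diamond S (c 0) (c (g s 2%N)) `<=` U.
    apply: cvx; first by apply: (hVV 0); rewrite ?subrr ?normr0 ?mdistxx.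
    apply: (hVV (g s 2%N)); last by rewrite mdistxx.
    by rewrite subr0 gtr0_norm// g2; clear -sh' he3 h0; lra.
  have g2d : g s 2%N - 0 <= d by rewrite g2; clear -sh' hd3 h0; lra.
  have [B1 B2] := midpoint_barrier tc hd (lexx 0) a2 (ltW b2) g2d (ltW a1) (ltW b1) cU dU.
  have ll : c 0 ≪ c (g (-1) 2%N).
    by have [? ?] := g01 (-1) 2%N m1le m11 N2; apply: (tg_ll hS tc) => //; exact: ltW.
  have n3 : \forall z \near c 0, s < 0 -> forall m, midpoint S z m (c (g s 2%N)) -> c (g s 1%N) ≪ m.
    have [s00|s00] := ltP s 0; last by near=> z.
    (* The end [0] is not shifted, so the midpoint sits at [h + s h / 8], strictly between the
       unshifted point [h] and the barrier point [h + s h / 4]. *)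
    have B1' : g s 1%N < (0 + g s 2%N) / 2.
      have sh0 : s * h < 0 * h by rewrite ltr_pM2r.
      by rewrite g1 g2; clear -sh0; lra.
    by near=> z => _; near: z; exact: (near_fst (P := fun a b => forall m, midpoint S a m b -> _) (B1 B1')).
  have n4 : \forall z \near c 0, 0 < s -> forall m, midpoint S z m (c (g s 2%N)) -> m ≪ c (g s 1%N).
    have [s00|s00] := ltP 0 s; last by near=> z.
    have B2' : (0 + g s 2%N) / 2 < g s 1%N.
      have sh0 : 0 * h < s * h by rewrite ltr_pM2r.
      by rewrite g1 g2; clear -sh0; lra.
    by near=> z => _; near: z; exact: (near_fst (P := fun a b => forall m, midpoint S a m b -> _) (B2 B2')).
  near=> z; split.
  - by near: z; exact: near_mdist.
  - by near: z; exact: (past_nbhs hS ll).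
  - by near: z.
  - by near: z.
have right s : -1 <= s -> s <= 1 -> \forall z \near c 1, [/\ mdist (c 1) z < e1,
    c (g 1 M.+1) ≪ z,
    s < 0 -> forall m, midpoint S (c (g s M.+1)) m z -> c (g s M.+2) ≪ m &
    0 < s -> forall m, midpoint S (c (g s M.+1)) m z -> m ≪ c (g s M.+2)].
  move=> s0 s1; have [a1 b1] := g01 s M.+1 s0 s1 NM1; have [a2 b2] := g01 s M.+2 s0 s1 NM2.
  have sh : -1 * h <= s * h by rewrite ler_wpM2r// ltW.
  have sh' : s * h <= 1 * h by rewrite ler_wpM2r// ltW.
  have [U cU [_ [V hVV cvx]]] := nearV 1 ler01 (lexx _).
  have dU : diamond S (c (g s M.+1)) (c 1) `<=` U.
    apply: cvx; last by apply: (hVV 1); rewrite ?subrr ?normr0 ?mdistxx.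
    apply: (hVV (g s M.+1)); last by rewrite mdistxx.
    by rewrite distrC gtr0_norm ?subr_gt0// gM1; clear -sh he3 h0; lra.
  have g2d : 1 - g s M.+1 <= d by rewrite gM1; clear -sh hd3 h0; lra.
  have [B1 B2] := midpoint_barrier tc hd (ltW a1) b1 (lexx 1) g2d (ltW a2) (ltW b2) cU dU.
  have ll : c (g 1 M.+1) ≪ c 1.
    by have [? ?] := g01 1 M.+1 m11 (lexx _) NM1; apply: (tg_ll hS tc) => //; exact: ltW.
  have n3 : \forall z \near c 1, s < 0 -> forall m, midpoint S (c (g s M.+1)) m z -> c (g s M.+2) ≪ m.
    have [s00|s00] := ltP s 0; last by near=> z.
    have B1' : g s M.+2 < (g s M.+1 + 1) / 2.
      have sh0 : s * h < 0 * h by rewrite ltr_pM2r.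
      by rewrite gM1 gM2; clear -sh0; lra.
    by near=> z => _; near: z; exact: (near_snd (P := fun a b => forall m, midpoint S a m b -> _) (B1 B1')).
  have n4 : \forall z \near c 1, 0 < s -> forall m, midpoint S (c (g s M.+1)) m z -> m ≪ c (g s M.+2).
    have [s00|s00] := ltP 0 s; last by near=> z.
    have B2' : (g s M.+1 + 1) / 2 < g s M.+2.
      have sh0 : 0 * h < s * h by rewrite ltr_pM2r.
      by rewrite gM1 gM2; clear -sh0; lra.
    by near=> z => _; near: z; exact: (near_snd (P := fun a b => forall m, midpoint S a m b -> _) (B2 B2')).
  near=> z; split.
  - by near: z; exact: near_mdist.
  - by near: z; exact: (fut_nbhs hS ll).
  - by near: z.
  - by near: z.
refine (filterS _ (near_pair (filterI (left _ m1le m11) (left _ m11 (lexx _)))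
   (filterI (right _ m1le m11) (right _ m11 (lexx _))))).
move=> -[x' y'] /= [[[xe xl x1 _] [_ _ _ x4]] [[ye yl y1 _] [_ _ _ y4]]].
have lt10 : -1 < 0 :> R by lra.
have {}x1 := x1 lt10; have {}y1 := y1 lt10; have {}x4 := x4 ltr01; have {}y4 := y4 ltr01.
(* Both barriers take the values [x'] and [y'] at the ends, which pins the ends of every chain
   between them. *)
pose b s i := if i == 0%N then x' else if i == N then y' else c (g s i).
have bc s i : (0 < i < N)%N -> b s i = c (g s i).
  by move=> /andP[i0 iN]; rewrite /b gtn_eqF// ltn_eqF.
have b0 s : b s 0%N = x' by [].
have bN s : b s N = y' by rewrite /b eqxx gtn_eqF.
have inV i : (0 < i < N)%N -> exists2 U, cmp S U &
    (forall y y', U y -> U y' -> mdist y y' < e) /\ exists2 V,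
    convex_in S U V & (forall s j, -1 <= s -> s <= 1 -> (i.-1 <= j)%N -> (j <= i.+1)%N -> V (b s j)) /\
    (forall t, i.-1%:R * h <= t -> t <= i.+1%:R * h -> V (c t)).
  move=> /andP[i0 iN]; have i1 : 1 * h <= i%:R * h by rewrite ler_wpM2r ?(ltW h0)// ler1n.
  have iN1 : i%:R * h <= N%:R * h by rewrite ler_wpM2r ?(ltW h0)// ler_nat ltnW.
  have ih0 : 0 <= i%:R * h by rewrite mulr_ge0// ltW.
  rewrite Nh in iN1; have [U cU [dU [V hVV cvx]]] := nearV _ ih0 iN1.
  have ei : i = i.-1.+1 by rewrite prednK.
  have ip : i.+1%:R * h = i%:R * h + h by rewrite -natr1; ring.
  have im : i.-1%:R * h = i%:R * h - h by rewrite [in RHS]ei -natr1; ring.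
  exists U => //; split=> //; exists V => //; split; last first.
    move=> t; rewrite im ip => t1 t2; apply: (hVV t); last by rewrite mdistxx.
    by clear -t1 t2 he3 h0; apply/ltr_normlP; split; lra.
  move=> s j s0 s1 ij ji.
  have sh : -1 * h <= s * h by rewrite ler_wpM2r// ltW.
  have sh' : s * h <= 1 * h by rewrite ler_wpM2r// ltW.
  have jl : i%:R * h - h <= j%:R * h by rewrite -im ler_wpM2r ?(ltW h0)// ler_nat.
  have jr : j%:R * h <= i%:R * h + h by rewrite -ip ler_wpM2r ?(ltW h0)// ler_nat.
  rewrite /b; case: eqP => [j0|_].
    apply: (hVV 0) => //; rewrite j0 mul0r in jl jr.
    by clear -jl ih0 he3 h0; apply/ltr_normlP; split; lra.
  case: eqP => [jN|_].
    apply: (hVV 1) => //; rewrite jN Nh in jl jr.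
    by clear -jr iN1 he3 h0; apply/ltr_normlP; split; lra.
  apply: (hVV (g s j)); last by rewrite mdistxx.
  by rewrite /g; clear -sh sh' jl jr he3 h0; apply/ltr_normlP; split; lra.
have gll s s' i j : -1 <= s -> s <= 1 -> -1 <= s' -> s' <= 1 ->
    (0 < i < N)%N -> (0 < j < N)%N -> g s i < g s' j -> c (g s i) ≪ c (g s' j).
  move=> s0 s1 s'0 s'1 iN jN gg; have [? ?] := g01 s i s0 s1 iN.
  by have [? ?] := g01 s' j s'0 s'1 jN; apply: (tg_ll hS tc) => //; exact: ltW.
have pred_range i : (0 < i < N)%N ->
    [\/ i = 1%N, i = M.+2 | (0 < i.-1 < N)%N /\ (0 < i.+1 < N)%N].
  move=> /andP[i0 iN]; have [->|i1] := eqVneq i 1%N; first by constructor 1.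
  have [->|iM] := eqVneq i M.+2; first by constructor 2.
  constructor 3; split; last by rewrite eN /= ltnS ltn_neqAle iM -ltnS -eN.
  by case: i i0 iN i1 {iM} => [|[|i]] //= _ iN _; rewrite ltnW.
(* Away from the ends three consecutive barrier points are equally spaced on [c] within one window,
   so the barrier condition holds with equality. *)
have shifted_mid s i m : -1 <= s -> s <= 1 -> (0 < i < N)%N -> (0 < i.-1 < N)%N -> (0 < i.+1 < N)%N ->
    midpoint S (b s i.-1) m (b s i.+1) -> b s i = m.
  move=> s0 s1 iN i1N i2N mm; have [U cU [_ [V cvx [VB _]]]] := inV i iN.
  have i1i : (i.-1 <= i.+1)%N by rewrite (leq_trans (leq_pred _)).
  have dU : diamond S (b s i.-1) (b s i.+1) `<=` U by apply: cvx; apply: VB.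
  rewrite !bc// in mm dU *.
  have [gg1 gg2] : g s i.-1 = g s i - h /\ g s i.+1 = g s i + h.
    by split; [rewrite -[in RHS](prednK (proj1 (andP iN))) gS addrK|rewrite gS].
  have [? ?] := g01 s i.-1 s0 s1 i1N; have [? ?] := g01 s i.+1 s0 s1 i2N.
  have glt : g s i.-1 < g s i.+1 by rewrite gg1 gg2; clear -h0; lra.
  apply: (midpoint_unique hS cU _ dU _ mm); first exact: gll.
  have -> : g s i = (g s i.-1 + g s i.+1) / 2 by rewrite gg1 gg2; clear; lra.
  apply: (tg_midpoint l0 hd); rewrite ?ltW//.
  by rewrite gg1 gg2; clear -hd3 h0; lra.
have [p [pb pmid]] : exists p : nat -> X,
    (forall i, (i <= N)%N -> b (-1) i ≼ p i /\ p i ≼ b 1 i) /\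
    forall i, (0 < i < N)%N -> midpoint S (p i.-1) (p i) (p i.+1).
  apply: (chain_exists hS).
  - move=> i iN; have [U cU [_ [V cvx [VB _]]]] := inV i iN.
    by exists U => //; apply: cvx; apply: VB => //; rewrite (leq_trans (leq_pred _)).
  - move=> i iN; have [->|->|[i1 i2]] := pred_range i iN.
    + by rewrite b0 bc.
    + by rewrite -[M.+3]eN bN bc.
    + rewrite !bc//; apply: gll => //; rewrite gS.
      rewrite -{2}(prednK (proj1 (andP iN))) gS /g; clear -h0; lra.
  - move=> i iN m mm; have [ei|ei|[i1 i2]] := pred_range i iN.
    + by left; rewrite ei bc//; apply: x1; rewrite ei b0 bc in mm.
    + by left; rewrite ei bc//; apply: y1; rewrite ei -[M.+3]eN bN bc in mm.
    + by right; apply: shifted_mid mm.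
  - move=> i iN m mm; have [ei|ei|[i1 i2]] := pred_range i iN.
    + by left; rewrite ei bc//; apply: x4; rewrite ei b0 bc in mm.
    + by left; rewrite ei bc//; apply: y4; rewrite ei -[M.+3]eN bN bc in mm.
    + by right; rewrite -(shifted_mid _ _ _ _ _ _ _ _ mm).
  - move=> i iN; have [->|i0] := eqVneq i 0%N; first by right.
    have [->|iN'] := eqVneq i N; first by rewrite !bN; right.
    have ii : (0 < i < N)%N by rewrite lt0n i0 ltn_neqAle iN'.
    by left; rewrite !bc//; apply: gll => //; rewrite /g; clear -h0; lra.
have diaU i : (0 < i < N)%N -> forall j k, (i.-1 <= j)%N -> (k <= i.+1)%N -> (j <= k)%N ->
   diamond S (p j) (p k) `<=` diamond S (b (-1) j) (b 1 k).
  move=> /andP[i0 iN] j k ij ki jk.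
  have kN := leq_trans ki iN; have jN := leq_trans jk kN.
  by apply: (diamond_sub hS); [case: (pb j jN)|case: (pb k kN)].
have le1 i : (i.-1 <= i.+1)%N by rewrite (leq_trans (leq_pred _)).
have [s [k [ts s0 s1 sd]]] : exists s k, [/\ tg S s k, s 0 = p 0%N, s 1 = p N &
    forall i t, (i < N)%N -> i%:R * N%:R^-1 <= t -> t <= i.+1%:R * N%:R^-1 ->
      diamond S (p i) (p i.+1) (s t)].
  apply: (chain_geodesic hS) => //.
  - move=> i iN; have [U cU [_ [V cvx [VB _]]]] := inV i iN; exists U => //.
    apply: subset_trans (diaU i iN _ _ (leqnn _) (leqnn _) (le1 i)) _.
    by apply: cvx; apply: VB => //; exact: le1.
  - move=> i iN; have [i1 i2] : (i.-1 <= N)%N /\ (i.+1 <= N)%N.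
      by case/andP: (iN) => i0 iN'; split=> //; rewrite (leq_trans (leq_pred _))// ltnW.
    have := proj1 (pb _ i2); have := proj2 (pb _ i1).
    suff ll : b 1 i.-1 ≪ b (-1) i.+1.
      by move=> /(le_ll_trans hS)/(_ ll)/(ll_le_trans hS); apply.
    have [->|->|[i1' i2']] := pred_range i iN.
    + by rewrite b0 bc.
    + by rewrite -[M.+3]eN bN bc.
    + rewrite !bc//; apply: gll => //; rewrite gS.
      rewrite -{2}(prednK (proj1 (andP iN))) gS /g; clear -h0; lra.
have bxx i : (i <= N)%N -> b (-1) i = b 1 i -> p i = b 1 i.
  by move=> iN bb; have [] := pb i iN; rewrite bb => ? ?; apply: (t_anti hS).
exists s, k; split=> //.
- by rewrite s0 bxx.
- by rewrite s1 bxx// !bN.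
move=> t t0 t1.
have tk : t <= N.-1.+1%:R * h by rewrite prednK// Nh.
have [i iN [it ti]] := grid_cell t0 tk.
have {}iN : (i < N)%N by rewrite -(prednK N0) ltnS.
have [j [jN ji ij]] : exists j, [/\ (0 < j < N)%N, (j.-1 <= i)%N & (i.+1 <= j.+1)%N].
  have [->|i0] := eqVneq i 0%N; first by exists 1%N.
  by exists i; rewrite lt0n i0 iN leq_pred.
have [U cU [dU [V cvx [VB Vc]]]] := inV j jN.
have Uct : U (c t).
  have Vct : V (c t).
    apply: Vc; first by apply: le_trans it; rewrite ler_wpM2r ?(ltW h0)// ler_nat.
    by apply: le_trans ti _; rewrite ler_wpM2r ?(ltW h0)// ler_nat.
  by apply: (cvx _ _ Vct Vct); apply: (diamondl hS); exact: t_refl.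
apply: dU => //.
have := diaU j jN i i.+1 ji ij (leqnSn _) _ (sd i t iN it ti).
by apply: cvx; apply: VB => //; [exact: leqW|exact: leq_trans (leqnSn _)].
Unshelve. all: by end_near. Qed.

End LocalExistence.

(** * Limits of geodesics *)

Section FirstExit.
Context {R : realType}.

Lemma first_exit (f : R -> R) (a b rho : R) : continuous f -> f a < rho ->
  (exists u, [/\ a <= u, u <= b & rho <= f u]) ->
  exists s, [/\ a < s, s <= b, f s = rho & forall u, a <= u -> u <= s -> f u <= rho].
Proof.
move=> cf fa [u0 [au0 u0b fu0]].
pose A := [set u | [/\ a <= u, u <= b & rho <= f u]].
have hA : has_inf A by split; [exists u0|exists a => u []].
have as_ : a <= inf A by apply: lb_le_inf => [|u []//]; exists u0.
have sb : inf A <= b by apply: le_trans (ge_inf (proj2 hA) (And3 au0 u0b fu0)) u0b.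
have fs : rho <= f (inf A).
  rewrite leNgt; apply/negP => fs.
  have /near_distP[e e0 he] : \forall u \near inf A, f u < rho.
    exact: (cvgr_lt _ (cf (inf A)) _ fs).
  have [u [au ub fu] us] := inf_adherent e0 hA.
  have su : inf A <= u by exact: (ge_inf (proj2 hA) (And3 au ub fu)).
  have := he u; rewrite ger0_norm ?subr_ge0// ltrBlDl => /(_ us).
  by rewrite ltNge fu.
have lts u : a <= u -> u < inf A -> f u < rho.
  move=> au us; rewrite ltNge; apply/negP => fu.
  have : inf A <= u.
    apply: (ge_inf (proj2 hA)).
    by split=> //; apply: ltW; apply: lt_le_trans sb.
  by rewrite leNgt us.
have as' : a < inf A.
  by rewrite lt_neqAle as_ andbT; apply: contraTneq fs => <-; rewrite -ltNge.
have fs' : f (inf A) <= rho.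
  have cl : f @ (inf A)^'- --> f (inf A) by apply: cvg_at_left_filter; exact: cf.
  apply: (cvgr_to_le cl); near=> u; apply: ltW; apply: lts.
    by near: u; exact: nbhs_left_ge.
  by near: u; exact: nbhs_left_lt.
exists (inf A); split=> //; first by apply/le_anti; rewrite fs fs'.
by move=> u au; rewrite le_eqVlt => /predU1P[->//|us]; apply: ltW; exact: lts.
Unshelve. all: by end_near. Qed.

Lemma at_leftP (x : R) (P : R -> Prop) : (\forall u \near x^'-, P u) ->
  exists2 e, 0 < e & forall u, x - e < u -> u < x -> P u.
Proof.
move=> /nbhs_ballP[e e0 he]; exists e => // u xu ux; apply: he => //.
by rewrite /ball /= gtr0_norm ?subr_gt0// ltrBlDr -ltrBlDl.
Qed.

End FirstExit.

(** * Time reversal *)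

Section Reverse.
Context {R : realType} {X : metricType R}.
Implicit Types (S : causal_data R X) (U : set X) (c : R -> X).

Lemma diamond_reverse S p q : diamond (reverse S) p q = diamond S q p.
Proof. by apply/seteqP; split=> z [? ?]; split. Qed.

Lemma lin_reverse S c l : lin (reverse S) c l <-> lin S (fun t : R => c (1 - t)) l.
Proof.
split=> h r s r0 rs s1.
  have := h (1 - s) (1 - r); rewrite /= => -> //; last 3 first.
  - by clear -s1; lra.
  - by clear -rs; lra.
  - by clear -r0; lra.
  by congr EFin; ring.
have := h (1 - s) (1 - r); rewrite !subKr /= => -> //; last 3 first.
- by clear -s1; lra.
- by clear -rs; lra.
- by clear -r0; lra.
by congr EFin; ring.
Qed.

Lemma continuous_reverse c : continuous c -> continuous (fun t : R => c (1 - t)).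
Proof.
move=> cc t; apply: (cont_cvg cc); apply: cvgB; [exact: cvg_cst|exact: cvg_id].
Qed.

Lemma cmp_reverse S U : cmp S U -> cmp (reverse S) U.
Proof.
move=> cU; have swap (p q : X) : (fun z : X * X => (z.2, z.1)) @ (p, q) --> (q, p).
  by apply: cvg_pair; [exact: cvg_snd|exact: cvg_fst].
split.
- by move=> p q Up Uq; exact: (cmp_fin cU Uq Up).
- by move=> p q Up Uq; exact: (cvg_comp _ _ (swap p q) (cmp_cont cU Uq Up)).
- move=> p m q pq dU pm mq e; rewrite diamond_reverse in dU.
  have [|c [cc lc c0 c1 [r [r0 r1 cr]]]] := cmp_thr cU pq dU mq pm.
    by rewrite addrC.
  exists (fun t : R => c (1 - t)); rewrite subr0 subrr; split=> //.
  + exact: continuous_reverse.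
  + apply/lin_reverse; rewrite (_ : (fun _ => _) = c)//.
    by apply/funext => t; rewrite subKr.
  + by exists (1 - r); rewrite subKr; split=> //; lra.
- move=> c c' l l' /lin_reverse lc /lin_reverse lc' l0 e0 e1.
  rewrite diamond_reverse => dU t t0 t1.
  have := cmp_uniq cU lc lc' l0; rewrite !subr0 !subrr => /(_ e1 e0 dU (1 - t)).
  by rewrite subKr; apply; lra.
- move=> c c' l l' /lin_reverse lc /lin_reverse lc' l0 l0'.
  rewrite !diamond_reverse => dU dU' e0 e1 t t0 t1.
  have := cmp_conc cU lc' lc l0' l0; rewrite !subr0 !subrr => /(_ dU' dU).
  have sym a b : cll_or_eq (reverse S) a b -> cll_or_eq S b a.
    by move=> [ab|->]; [left|right].
  move=> /(_ (sym _ _ e1) (sym _ _ e0) (1 - t)); rewrite !subKr /tr /= => h.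
  by rewrite addrC; apply: h; lra.
Qed.

Lemma tame_reverse S : tame S -> tame (reverse S).
Proof.
move=> hS.
have swap (p q : X) : (fun z : X * X => (z.2, z.1)) @ (p, q) --> (q, p).
  by apply: cvg_pair; [exact: cvg_snd|exact: cvg_fst].
split=> /=.
- exact: (t_refl hS).
- by move=> x y z xy yz; exact: (t_trans hS yz xy).
- by move=> x y xy yx; exact: (t_anti hS yx xy).
- by move=> x y; exact: (t_ll_le hS).
- by move=> x y; exact: (t_tau0 hS).
- by move=> x y z xy yz; rewrite addeC; exact: (t_tri hS).
- by move=> x y; exact: (t_pos hS).
- by move=> p q qp; exact: (swap p q _ (t_open hS qp)).
- have -> : [set z : X * X | cle S z.2 z.1] =
      (fun z : X * X => (z.2, z.1)) @^-1` [set z | cle S z.1 z.2] by [].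
  apply: closed_comp; last exact: (t_closed hS).
  by move=> [p q] _; exact: swap.
- by move=> x y; rewrite diamond_reverse; exact: (t_compact hS).
- exact: (t_past hS).
- exact: (t_fut hS).
- by move=> x; have [U nU cU] := t_local hS x; exists U => //; exact: cmp_reverse.
Qed.

Lemma tg_reverse S c l : tg S c l -> tg (reverse S) (fun t : R => c (1 - t)) l.
Proof.
move=> [l0 cc [e e0 he]]; split=> //; first exact: continuous_reverse.
exists e => // r s r0 rs s1 sr /=; rewrite he; first by congr EFin; ring.
- by clear -s1; lra.
- by clear -rs; lra.
- by clear -r0; lra.
- by clear -sr; lra.
Qed.

End Reverse.

Section LeftLimit.
Context {R : realType} {X : metricType R} (S : causal_data R X) (hS : tame S).
Implicit Types (x y z p q m : X) (U V W : set X) (c : R -> X) (l e : R).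

Local Notation "x ≼ y" := (cle S x y) (at level 70).
Local Notation "x ≪ y" := (cll S x y) (at level 70).

(* A jump of the limit at [r] would, by continuity of the separation, extend a
   maximizer into [L] by a causal piece of zero length, against [cmp_thr]. *)
Lemma left_limit {I : Type} (F : set_system I) {UF : UltraFilter F}
    (C : I -> R -> X) (ls : I -> R) (l : R) (cs : R -> X) (x y : X) :
  (\forall i \near F, tg S (C i) (ls i)) ->
  (\forall i \near F, forall t, 0 <= t -> t <= 1 -> diamond S x y (C i t)) ->
  ls @ F --> l -> 0 < l ->
  (forall t, 0 <= t -> t <= 1 -> (fun i => C i t) @ F --> cs t) ->
  forall r, 0 < r -> r <= 1 -> forall W, nbhs (cs r) W ->
  exists2 d, 0 < d & \forall i \near F, forall u, 0 <= u -> r - d <= u -> u <= r ->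
    W (C i u).
Proof.
move=> Ftg FK lsl l0 Ccs r r0 r1.
have Fmono u v : 0 <= u -> u <= v -> v <= 1 -> \forall i \near F, C i u ≼ C i v.
  by move=> u0 uv v1; apply: filterS Ftg => i ti; exact: (tg_le hS ti).
have mono u v : 0 <= u -> u <= v -> v <= 1 -> cs u ≼ cs v.
  move=> u0 uv v1; apply: (le_lim hS (Ccs u u0 (le_trans uv v1))
    (Ccs v (le_trans u0 uv) v1)); exact: Fmono.
have csK t : 0 <= t -> t <= 1 -> diamond S x y (cs t).
  move=> t0 t1; split.
    apply: (le_lim hS (cvg_cst x) (Ccs t t0 t1)).
    by apply: filterS FK => i /(_ t t0 t1)[].
  apply: (le_lim hS (Ccs t t0 t1) (cvg_cst y)).
  by apply: filterS FK => i /(_ t t0 t1)[].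
have [L csL csleL] : exists2 L, cs @ r^'- --> L & \forall u \near r^'-, cs u ≼ L.
  apply: (@monotone_cvg _ _ _ hS _ r^'- _ cs (diamond S x y)); first exact: (t_compact hS).
    near=> u; apply: csK; first by near: u; exact: nbhs_left_ge.
    by apply: le_trans r1; near: u; exact: nbhs_left_le.
  near=> u; near=> v; apply: mono.
  - by near: u; exact: nbhs_left_ge.
  - by near: v; apply: nbhs_left_ge; near: u; exact: nbhs_left_lt.
  - by apply: le_trans r1; near: v; exact: nbhs_left_le.
have [U nU cU] := t_local hS L.
have [V nV hV] := strongly_causal hS nU.
have VU z : V z -> U z.
  by move=> Vz; apply: (hV z z Vz Vz); apply: (diamondl hS); exact: t_refl.
(* The control of the curves is proved around the left limit [L]; together with [L = cs r] it
   becomes control around [cs r]. *)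
suff main W : nbhs L W -> L = cs r /\ exists2 d, 0 < d &
    \forall i \near F, forall u, 0 <= u -> r - d <= u -> u <= r -> W (C i u).
  move=> W nW; have [Lcs _] := main setT filterT.
  by apply: (proj2 (main W _)); rewrite Lcs.
move=> nW.
have /nbhs_mdist[rho' rho'0 hrho] : nbhs L (V `&` W) by exact: filterI.
pose rho := rho' / 2; have rho0 : 0 < rho by rewrite divr_gt0.
have rhoV z : mdist L z <= rho -> V z /\ W z.
  by move=> Lz; apply: hrho; apply: le_lt_trans Lz _; rewrite /rho; clear -rho'0; lra.
(* Points between [cs a] and [L] are thereby strictly closer to [L] than [rho], which later
   contradicts an exit point at distance exactly [rho]. *)
have [V2 nV2 hV2] := strongly_causal hS (near_mdist L rho0).
have /at_leftP[d' d'0 hd'] : \forall u \near r^'-, [/\ cs u ≼ L, V2 (cs u) & mdist L (cs u) < rho].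
  have h1 : \forall u \near r^'-, V2 (cs u) by exact: csL.
  have h2 : \forall u \near r^'-, mdist L (cs u) < rho by exact: (cvg_near_mdist csL).
  by near=> u; split; near: u.
have [d [d0 dr dd']] : exists d, [/\ 0 < d, d <= r & d < d'].
  exists (Num.min r (d' / 2)); rewrite lt_min r0 divr_gt0//.
  rewrite ge_min lexx gt_min; split=> //; apply/orP; right.
  by clear -d'0; lra.
pose a := r - d; have a0 : 0 <= a by rewrite subr_ge0.
have ar : a < r by rewrite /a; clear -d0; lra.
have csa u : a <= u -> u < r -> [/\ cs u ≼ L, V2 (cs u), V (cs u) & mdist L (cs u) < rho].
  move=> au ur; have [|//|h1 h2 h3] := hd' u.
    by move: au; rewrite /a; clear -dd'; lra.
  by split=> //; case: (rhoV (cs u) (ltW h3)).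
have [pL V2p Vp Lp] := csa a (lexx _) ar.
have a1 : a <= 1 by apply: le_trans (ltW ar) r1.
(* In the limit [cs a] has separation [l (r - a)] both from [z] and from [L], and [L <= z]. So [tau]
   vanishes from [L] to [z], and the maximizer from [cs a] through [L] to [z] has used up its whole
   length at [L]. *)
have squeeze (s : I -> R) z : (\forall i \near F, [/\ a < s i, s i <= r &
      forall u, a <= u -> u <= s i -> V (C i u)]) -> s @ F --> r ->
    (fun i => C i (s i)) @ F --> z -> V z -> z = L.
  move=> hs sr Csz Vz.
  have Flin : \forall i \near F, forall u v, a <= u -> u <= v -> v <= s i ->
      tr S (C i u) (C i v) = ls i * (v - u).
    near=> i; have ti : tg S (C i) (ls i) by near: i.
    have [asi sir Vsi] : [/\ a < s i, s i <= r &
        forall u, a <= u -> u <= s i -> V (C i u)] by near: i.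
    have tsub := tg_sub ti a0 asi (le_trans sir r1).
    have h0 : a + 0 * (s i - a) = a by ring.
    have h1 : a + 1 * (s i - a) = s i by ring.
    have sa0 : 0 < s i - a by rewrite subr_gt0.
    have := tg_small_lin hS tsub cU; rewrite h0 h1.
    move=> /(_ (hV _ _ (Vsi _ (lexx _) (ltW asi)) (Vsi _ (ltW asi) (lexx _)))) li u v au uv vs.
    have := lin_tr li (r := (u - a) / (s i - a)) (s := (v - a) / (s i - a)).
    have par w : a + (w - a) / (s i - a) * (s i - a) = w.
      by rewrite divfK ?gt_eqF// subrKC.
    rewrite !par => -> //.
    + by field; rewrite gt_eqF.
    + by rewrite divr_ge0 ?subr_ge0// ltW.
    + by rewrite ler_pM2r ?invr_gt0// lerD2r.
    + by rewrite ler_pdivrMr// mul1r lerD2r.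
  have Up := VU _ Vp; have Uz := VU _ Vz; have UL := nbhs_singleton nU.
  have tpz : tr S (cs a) z = l * (r - a).
    have c1 : (fun i => tr S (C i a) (C i (s i))) @ F --> tr S (cs a) z.
      exact: (tr_lim cU Up Uz (Ccs a a0 a1) Csz).
    have c2 : (fun i => ls i * (s i - a)) @ F --> l * (r - a).
      by apply: cvgM => //; apply: cvgB => //; exact: cvg_cst.
    apply: (cvg_near_eq c1 c2); near=> i.
    have [asi _ _] : [/\ a < s i, s i <= r &
        forall u, a <= u -> u <= s i -> V (C i u)] by near: i.
    have h : forall u v, a <= u -> u <= v -> v <= s i ->
      tr S (C i u) (C i v) = ls i * (v - u) by near: i.
    by apply: h => //; exact: ltW.
  have Fs u : u < r -> \forall i \near F, u < s i.
    by move=> ur; exact: (cvgr_gt _ sr _ ur).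
  have tpu u : a <= u -> u < r -> tr S (cs a) (cs u) = l * (u - a).
    move=> au ur; have [_ _ /VU Uu _] := csa u au ur.
    have u0 := le_trans a0 au; have u1 := le_trans (ltW ur) r1.
    have c1 : (fun i => tr S (C i a) (C i u)) @ F --> tr S (cs a) (cs u).
      exact: (tr_lim cU Up Uu (Ccs a a0 a1) (Ccs u u0 u1)).
    have c2 : (fun i => ls i * (u - a)) @ F --> l * (u - a).
      by apply: cvgM => //; exact: cvg_cst.
    apply: (cvg_near_eq c1 c2); near=> i.
    have h : forall u v, a <= u -> u <= v -> v <= s i ->
      tr S (C i u) (C i v) = ls i * (v - u) by near: i.
    by apply: h => //; apply: ltW; near: i; exact: Fs.
  have tpL : tr S (cs a) L = l * (r - a).
    have c1 : (fun u => tr S (cs a) (cs u)) @ r^'- --> tr S (cs a) L.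
      exact: (tr_lim cU Up UL (cvg_cst _) csL).
    have c2 : (fun u => l * (u - a)) @ r^'- --> l * (r - a).
      apply: cvgM; first exact: cvg_cst.
      by apply: cvgB; [apply: cvg_at_left_filter; exact: cvg_id|exact: cvg_cst].
    apply: (cvg_near_eq c1 c2); near=> u; apply: tpu.
      by near: u; exact: nbhs_left_ge.
    by near: u; exact: nbhs_left_lt.
  have Lz : L ≼ z.
    apply: (le_lim hS csL (cvg_cst z)); near=> u.
    have ur : u < r by near: u; exact: nbhs_left_lt.
    have u0 : 0 <= u by near: u; apply: nbhs_left_ge.
    apply: (le_lim hS (Ccs u u0 (le_trans (ltW ur) r1)) Csz).
    near=> i; have ti : tg S (C i) (ls i) by near: i.
    have [_ sir _] : [/\ a < s i, s i <= r &
        forall u, a <= u -> u <= s i -> V (C i u)] by near: i.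
    apply: (tg_le hS ti) => //; last exact: le_trans r1.
    by apply: ltW; near: i; exact: Fs.
  have tri := tr_tri hS cU Up Uz UL pL Lz.
  have tLz : tr S L z = 0.
    by apply/le_anti; rewrite (tr_ge0 hS) andbT; move: tri; rewrite tpL tpz; clear; lra.
  have tpz0 : 0 < tr S (cs a) z by rewrite tpz mulr_gt0// subr_gt0.
  have [|c [cc lc c0 c1 [w [w0 w1 cw]]]] := cmp_thr cU (tr_ll hS tpz0) (hV _ _ Vp Vz) pL Lz.
    by rewrite tpL tpz tLz addr0.
  have := lin_tr lc (lexx 0) w0 w1; rewrite c0 cw subr0 tpL -tpz => e.
  have w1' : w = 1 by apply: (mulfI (lt0r_neq0 tpz0)); rewrite mulr1.
  by rewrite -cw w1' c1.
(* Either the curves remain in the ball up to [r], and [squeeze] with [s = r] concludes, or almost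
   all of them exit. Their first exit points then converge to a point [z] at distance [rho] from
   [L], and [squeeze] gives the contradiction [z = L]. *)
have [FA|FnA] := in_ultra_setVsetC [set i | forall u, a <= u -> u <= r -> mdist L (C i u) < rho] UF.
  have zr : cs r = L.
    apply: (squeeze (fun=> r)).
    - apply: filterS FA => i h; split=> // u au ur.
      by case: (rhoV _ (ltW (h u au ur))).
    - exact: cvg_cst.
    - by apply: Ccs => //; exact: ltW.
    - suff : mdist L (cs r) <= rho by move=> /rhoV[].
      have c1 : (fun i => mdist L (C i r)) @ F --> mdist L (cs r).
        by apply: mdist_cvg; [exact: cvg_cst|apply: Ccs => //; exact: ltW].
      apply: (cvgr_to_le c1); apply: filterS FA => i h; apply: ltW.
      by apply: h => //; exact: ltW.
  split=> //; exists d => //; apply: filterS FA => i h u u0 au ur.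
  by case: (rhoV _ (ltW (h u au ur))).
exfalso.
have Fa : \forall i \near F, mdist L (C i a) < rho.
  have c1 : (fun i => mdist L (C i a)) @ F --> mdist L (cs a).
    by apply: mdist_cvg; [exact: cvg_cst|exact: Ccs].
  exact: (cvgr_lt _ c1 _ Lp).
have Fexit : \forall i \near F, exists s, [/\ a < s, s <= r, mdist L (C i s) = rho
    & forall u, a <= u -> u <= s -> mdist L (C i u) <= rho].
  near=> i; have [_ cC _] : tg S (C i) (ls i) by near: i.
  have nA : ~ forall u, a <= u -> u <= r -> mdist L (C i u) < rho by near: i; exact: FnA.
  apply: (@first_exit _ (fun u => mdist L (C i u))).
  - by move=> u; apply: mdist_cvg; [exact: cvg_cst|exact: cC].
  - by near: i.
  - apply: contrapT => no; apply: nA => u au ur; rewrite ltNge; apply/negP => hu.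
    by apply: no; exists u.
have /choice[s hs] : forall i, exists s, (exists s, [/\ a < s, s <= r, mdist L (C i s) = rho
    & forall u, a <= u -> u <= s -> mdist L (C i u) <= rho]) ->
    [/\ a < s, s <= r, mdist L (C i s) = rho
    & forall u, a <= u -> u <= s -> mdist L (C i u) <= rho].
  move=> i; have [[s' hs']|no] := pselect (exists s, [/\ a < s, s <= r, mdist L (C i s) = rho
    & forall u, a <= u -> u <= s -> mdist L (C i u) <= rho]); first by exists s'.
  by exists 0 => /no.
have {}Fexit : \forall i \near F, [/\ a < s i, s i <= r, mdist L (C i (s i)) = rho
    & forall u, a <= u -> u <= s i -> mdist L (C i u) <= rho].
  by apply: filterS Fexit => i; exact: hs.
have [z _ Csz] : exists2 z, diamond S x y z & (fun i => C i (s i)) @ F --> z.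
  apply: compact_ultra_cvg; first exact: (t_compact hS).
  near=> i; have [asi sir _ _] : [/\ a < s i, s i <= r, mdist L (C i (s i)) = rho
    & forall u, a <= u -> u <= s i -> mdist L (C i u) <= rho] by near: i.
  have hK : forall t, 0 <= t -> t <= 1 -> diamond S x y (C i t) by near: i.
  by apply: hK; [exact: le_trans (ltW asi)|exact: le_trans r1].
have Lz : mdist L z = rho.
  have c1 : (fun i => mdist L (C i (s i))) @ F --> mdist L z.
    by apply: mdist_cvg => //; exact: cvg_cst.
  have c2 : (fun _ : I => rho) @ F --> rho by exact: cvg_cst.
  by apply: (cvg_near_eq c1 c2); apply: filterS Fexit => i [].
have [Vz _] : V z /\ W z by apply: rhoV; rewrite Lz.
have zL : z <> L by move=> zL; move: Lz rho0; rewrite zL mdistxx => <-; rewrite ltxx.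
apply: zL; apply: (squeeze s) => //.
  apply: filterS Fexit => i [h1 h2 _ h4]; split=> // u au us.
  by case: (rhoV _ (h4 u au us)).
(* The exit parameters must tend to [r]: otherwise some [v] lies between their limit and [r], and
   [cs a <= z <= cs v <= L] puts [z] strictly within [rho] of [L]. *)
have [s0 + ss0] : exists2 s0, `[a, r]%classic s0 & s @ F --> s0.
  apply: compact_ultra_cvg; first exact: segment_compact.
  by apply: filterS Fexit => i [h1 h2 _ _]; rewrite /= in_itv /= (ltW h1).
rewrite /= in_itv /= => /andP[as0 s0r].
move: s0r; rewrite le_eqVlt => /predU1P[<-//|s0r]; exfalso.
pose v := (s0 + r) / 2.
have [s0v vr] : s0 < v /\ v < r by rewrite /v; clear -s0r; lra.
have v0 : 0 <= v by apply: le_trans a0 (le_trans as0 (ltW s0v)).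
have v1 : v <= 1 by apply: le_trans (ltW vr) r1.
have [vL _ _ _] := csa v (le_trans as0 (ltW s0v)) vr.
have zL : z ≼ L.
  apply: (t_trans hS _ vL); apply: (le_lim hS Csz (Ccs v v0 v1)); near=> i.
  have ti : tg S (C i) (ls i) by near: i.
  have [asi _ _ _] : [/\ a < s i, s i <= r, mdist L (C i (s i)) = rho
    & forall u, a <= u -> u <= s i -> mdist L (C i u) <= rho] by near: i.
  apply: (tg_le hS ti) => //; first exact: le_trans (ltW asi).
  by apply: ltW; near: i; exact: (cvgr_lt _ ss0 _ s0v).
have pz : cs a ≼ z.
  apply: (le_lim hS (Ccs a a0 a1) Csz); near=> i.
  have ti : tg S (C i) (ls i) by near: i.
  have [asi sir _ _] : [/\ a < s i, s i <= r, mdist L (C i (s i)) = rho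
    & forall u, a <= u -> u <= s i -> mdist L (C i u) <= rho] by near: i.
  by apply: (tg_le hS ti) => //; [exact: ltW|exact: le_trans r1].
have := hV2 _ _ V2p (nbhs_singleton nV2) z (conj pz zL).
by rewrite /= Lz ltxx.
Unshelve. all: by end_near. Qed.

End LeftLimit.

Section Limits.
Context {R : realType} {X : metricType R} (S : causal_data R X) (hS : tame S).
Implicit Types (x y z p q : X) (U V W : set X) (c : R -> X) (l e : R).

Local Notation "x ≼ y" := (cle S x y) (at level 70).
Local Notation "x ≪ y" := (cll S x y) (at level 70).

(* Unbounded speeds would make every interval of parameters infinitely long,
   whereas the limit has a left limit at [1], near which [tau] is bounded. *)
Lemma speed_bounded {I : Type} (F : set_system I) {UF : UltraFilter F}
    (C : I -> R -> X) (ls : I -> R) (cs : R -> X) (x y : X) :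
  (\forall i \near F, tg S (C i) (ls i)) ->
  (\forall i \near F, forall t, 0 <= t -> t <= 1 -> diamond S x y (C i t)) ->
  (forall t, 0 <= t -> t <= 1 -> (fun i => C i t) @ F --> cs t) ->
  exists M, \forall i \near F, ls i <= M.
Proof.
move=> Ftg FK Ccs.
have csK t : 0 <= t -> t <= 1 -> diamond S x y (cs t).
  move=> t0 t1; split.
    apply: (le_lim hS (cvg_cst x) (Ccs t t0 t1)).
    by apply: filterS FK => i /(_ t t0 t1)[].
  apply: (le_lim hS (Ccs t t0 t1) (cvg_cst y)).
  by apply: filterS FK => i /(_ t t0 t1)[].
have mono u v : 0 <= u -> u <= v -> v <= 1 -> cs u ≼ cs v.
  move=> u0 uv v1; apply: (le_lim hS (Ccs u u0 (le_trans uv v1)) (Ccs v (le_trans u0 uv) v1)).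
  by apply: filterS Ftg => i ti; exact: (tg_le hS ti).
have [w csw _] : exists2 w, cs @ 1^'- --> w & \forall u \near 1^'-, cs u ≼ w.
  apply: (@monotone_cvg _ _ _ hS _ (1 : R)^'- _ cs (diamond S x y)); first exact: (t_compact hS).
    near=> u; apply: csK; first by near: u; exact: nbhs_left_ge.
    by near: u; exact: nbhs_left_le.
  near=> u; near=> v; apply: mono.
  - by near: u; exact: nbhs_left_ge.
  - by near: v; apply: nbhs_left_ge; near: u; exact: nbhs_left_lt.
  - by near: v; exact: nbhs_left_le.
have [U nU cU] := t_local hS w; have Uw := nbhs_singleton nU.
have [[A B] /= [nA nB] AB] : \forall z \near (w, w), tr S z.1 z.2 < 1.
  have tw : tr S w w < 1 by rewrite /tr (tau_refl hS) /= ltr01.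
  exact: (cvgr_lt _ (cmp_cont cU Uw Uw) _ tw).
pose V := A `&` B `&` U.
have nV : nbhs w V by apply: filterI => //; exact: filterI.
have /at_leftP[e' e'0 he'] : \forall u \near (1 : R)^'-, nbhs (cs u) V.
  exact: (csw _ (nbhs_interior nV)).
have [u [v [u0 uv v1 nu nv]]] : exists u v : R,
    [/\ 0 <= u, u < v, v <= 1, nbhs (cs u) V & nbhs (cs v) V].
  pose e := Num.min e' 1.
  have [e0 ee' e1] : [/\ 0 < e, e <= e' & e <= 1].
    by split; rewrite /e ?lt_min ?e'0 ?ltr01// ge_min lexx ?orbT.
  exists (1 - e / 2), (1 - e / 3); split; try (by clear -e0 e1; lra).
    by apply: he'; clear -e0 ee' e1; lra.
  by apply: he'; clear -e0 ee' e1; lra.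
(* From [u] to [v] the separation is at least [ls i * (v - u)], and it is below [1] once both points
   are in [V]. *)
exists ((v - u)^-1); have u1 := le_trans (ltW uv) v1; have v0 := le_trans u0 (ltW uv).
have n1 : \forall i \near F, V (C i u) by exact: (Ccs u u0 u1).
have n2 : \forall i \near F, V (C i v) by exact: (Ccs v v0 v1).
near=> i; have ti : tg S (C i) (ls i) by near: i.
have [[Au Bu] Uu] : V (C i u) by near: i.
have [[Av Bv] Uv] : V (C i v) by near: i.
have [_] := tg_tau_ge hS ti u0 (ltW uv) v1; rewrite (tauE cU Uu Uv) lee_fin => le.
rewrite -[leRHS]mul1r ler_pdivlMr ?subr_gt0//; apply: le_trans le _; apply: ltW.
exact: (AB (C i u, C i v)).
Unshelve. all: by end_near. Qed.

(** The limit is pointwise along the ultrafilter. Applying [left_limit] to [S] and to its reversal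
    yields equicontinuity at each parameter, hence a continuous limit and uniform convergence. On
    short pieces the curves are maximizers in a comparison neighborhood, where [tau] is continuous.
    The bound [m] keeps the limit speed positive. *)
Lemma tg_limit {I : Type} (F : set_system I) {UF : UltraFilter F}
    (C : I -> R -> X) (ls : I -> R) (x y : X) (m : R) : 0 < m ->
  (\forall i \near F, tg S (C i) (ls i) /\ m <= ls i) ->
  (\forall i \near F, forall t, 0 <= t -> t <= 1 -> diamond S x y (C i t)) ->
  exists c l, [/\ tg S c l, m <= l,
    forall t, 0 <= t -> t <= 1 -> (fun i => C i t) @ F --> c t &
    forall e, 0 < e -> \forall i \near F, near_geo e c (C i)].
Proof.
move=> m0 Ftm FK.
have Ftg : \forall i \near F, tg S (C i) (ls i) by apply: filterS Ftm => i [].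
have /choice[cs hcs] : forall r : R, exists z, (fun i => C i (clamp 0 1 r)) @ F --> z.
  move=> r; have [r0 r1] := clamp_in r ler01.
  have [|z _ hz] := compact_ultra_cvg (t_compact hS (x:=x) (y:=y)) (f := fun i => C i (clamp 0 1 r)) (F := F).
    by apply: filterS FK => i; exact.
  by exists z.
have Ccs t : 0 <= t -> t <= 1 -> (fun i => C i t) @ F --> cs t.
  by move=> t0 t1; have := hcs t; rewrite clamp_id.
have cs_clamp t : cs t = cs (clamp 0 1 t).
  have [t0 t1] := clamp_in t ler01.
  by apply: (cvg_mdist_unique (hcs t)); exact: Ccs.
have [M FM] := speed_bounded Ftg FK Ccs.
have [l /=] : exists2 l, `[m, M]%classic l & ls @ F --> l.
  apply: compact_ultra_cvg; first exact: segment_compact.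
  by near=> i; rewrite /= in_itv /=; apply/andP; split; near: i => //; apply: filterS Ftm => i [].
rewrite in_itv /= => /andP[ml _] lsl.
have l0 : 0 < l by apply: lt_le_trans ml.
have local r W : 0 <= r -> r <= 1 -> nbhs (cs r) W ->
    exists2 d, 0 < d & \forall i \near F, forall u, 0 <= u -> u <= 1 -> `|u - r| < d -> W (C i u).
  move=> r0 r1 nW.
  have [dl dl0 hl] : exists2 d, 0 < d & \forall i \near F, forall u, 0 <= u -> u <= 1 ->
      u <= r -> r - d <= u -> W (C i u).
    move: r0; rewrite le_eqVlt => /predU1P[r0|r0].
      exists 1 => //; have : \forall i \near F, W (C i r) by apply: Ccs => //; rewrite -r0.
      apply: filterS => i Wi u u0 u1 ur _.
      by have -> : u = r by apply/le_anti; rewrite ur -r0 u0.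
    have [d d0 hd] := left_limit hS Ftg FK lsl l0 Ccs r0 r1 nW.
    by exists d => //; apply: filterS hd => i h u u0 u1 ur du; exact: h.
  have [dr dr0 hr] : exists2 d, 0 < d & \forall i \near F, forall u, 0 <= u -> u <= 1 ->
      r <= u -> u <= r + d -> W (C i u).
    move: r1; rewrite le_eqVlt => /predU1P[r1|r1].
      exists 1 => //; have : \forall i \near F, W (C i r) by apply: Ccs => //; rewrite r1.
      apply: filterS => i Wi u u0 u1 ur _.
      by have -> : u = r by apply/le_anti; rewrite ur r1 u1.
    have rF : \forall i \near F, tg (reverse S) (fun u : R => C i (1 - u)) (ls i).
      by apply: filterS Ftg => i; exact: tg_reverse.
    have rK : \forall i \near F, forall t : R, 0 <= t -> t <= 1 ->
        diamond (reverse S) y x (C i (1 - t)).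
      apply: filterS FK => i h t t0 t1; rewrite diamond_reverse; apply: h.
        by rewrite subr_ge0.
      by rewrite lerBlDr lerDl.
    have rC t : 0 <= t -> t <= 1 -> (fun i => C i (1 - t)) @ F --> cs (1 - t).
      by move=> t0 t1; apply: Ccs; [rewrite subr_ge0|rewrite lerBlDr lerDl].
    have r'0 : 0 < 1 - r by rewrite subr_gt0.
    have r'1 : 1 - r <= 1 by rewrite lerBlDr lerDl.
    have nW' : nbhs (cs (1 - (1 - r))) W by rewrite subKr.
    have [d d0 hd] := @left_limit _ _ _ (tame_reverse hS) _ F UF (fun i u => C i (1 - u)) ls l
      (fun u => cs (1 - u)) y x rF rK lsl l0 rC (1 - r) r'0 r'1 W nW'.
    exists d => //; apply: filterS hd => i h u u0 u1 ru ud.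
    have := h (1 - u); rewrite subKr; apply.
    - by rewrite subr_ge0.
    - by clear -ud; lra.
    - by clear -ru; lra.
  exists (Num.min dl dr); first by rewrite lt_min dl0.
  near=> i => u u0 u1; rewrite lt_min => /andP[/ltr_normlP[a1 a2] /ltr_normlP[b1 b2]].
  have [ur|ru] := leP u r.
    have h : forall u, 0 <= u -> u <= 1 -> u <= r -> r - dl <= u -> W (C i u) by near: i.
    by apply: h => //; clear -a1; lra.
  have h : forall u, 0 <= u -> u <= 1 -> r <= u -> u <= r + dr -> W (C i u) by near: i.
  by apply: h => //; [exact: ltW|clear -b2; lra].
have local_dist r e : 0 <= r -> r <= 1 -> 0 < e -> exists2 d, 0 < d &
    (\forall i \near F, forall u, 0 <= u -> u <= 1 -> `|u - r| < d -> mdist (cs r) (C i u) < e) /\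
    (forall u, 0 <= u -> u <= 1 -> `|u - r| < d -> mdist (cs r) (cs u) <= e).
  move=> r0 r1 e0; have [d d0 hd] := local r _ r0 r1 (near_mdist (cs r) e0).
  exists d => //; split=> // u u0 u1 ur.
  have c1 : (fun i => mdist (cs r) (C i u)) @ F --> mdist (cs r) (cs u).
    by apply: mdist_cvg; [exact: cvg_cst|exact: Ccs].
  by apply: (cvgr_to_le c1); apply: filterS hd => i h; apply: ltW; exact: h.
have ccs : continuous cs.
  move=> r; apply/continuousPdist => e e0; have [r0 r1] := clamp_in r ler01.
  have e2 : 0 < e / 2 by rewrite divr_gt0.
  have [d d0 [_ hd]] := local_dist _ _ r0 r1 e2.
  exists d => // u ur; rewrite cs_clamp (cs_clamp u); have [u0 u1] := clamp_in u ler01.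
  apply: le_lt_trans (hd _ u0 u1 _) _; last by clear -e0; lra.
  by apply: le_lt_trans (clamp_dist 0 1 u r) ur.
have win : forall r, 0 <= r -> r <= 1 -> exists2 d, 0 < d &
    forall u v, 0 <= u -> u <= v -> v <= 1 -> `|u - r| < d -> `|v - r| < d ->
      tau S (cs u) (cs v) = (l * (v - u))%:E.
  move=> r r0 r1; have [U nU cU] := t_local hS (cs r).
  have [V nV hV] := strongly_causal hS nU.
  have /nbhs_mdist[rho rho0 hrho] := nV.
  have rho2 : 0 < rho / 2 by rewrite divr_gt0.
  have [d d0 [Fd hd]] := local_dist _ _ r0 r1 rho2.
  have VU z : V z -> U z.
    by move=> Vz; apply: (hV z z Vz Vz); apply: (diamondl hS); exact: t_refl.
  exists d => // u v u0 uv v1 ur vr.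
  have u1 := le_trans uv v1; have v0 := le_trans u0 uv.
  have Ucs w : 0 <= w -> w <= 1 -> `|w - r| < d -> U (cs w).
    move=> w0 w1 wr; apply: VU; apply: hrho.
    by apply: le_lt_trans (hd w w0 w1 wr) _; clear -rho0; lra.
  move: uv; rewrite le_eqVlt => /predU1P[->|uv].
    by rewrite (tau_refl hS) subrr mulr0.
  rewrite (tauE cU (Ucs u u0 u1 ur) (Ucs v v0 v1 vr)); congr EFin.
  have c1 : (fun i => tr S (C i u) (C i v)) @ F --> tr S (cs u) (cs v).
    exact: (tr_lim cU (Ucs u u0 u1 ur) (Ucs v v0 v1 vr) (Ccs u u0 u1) (Ccs v v0 v1)).
  have c2 : (fun i => ls i * (v - u)) @ F --> l * (v - u).
    by apply: cvgM => //; exact: cvg_cst.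
  apply: (cvg_near_eq c1 c2); near=> i; have ti : tg S (C i) (ls i) by near: i.
  have hi : forall w, 0 <= w -> w <= 1 -> `|w - r| < d -> mdist (cs r) (C i w) < rho / 2.
    by near: i.
  have Vi w : 0 <= w -> w <= 1 -> `|w - r| < d -> V (C i w).
    move=> w0 w1 wr; apply: hrho; apply: lt_trans (hi w w0 w1 wr) _.
    by clear -rho0; lra.
  have h0 : u + 0 * (v - u) = u by ring.
  have h1 : u + 1 * (v - u) = v by ring.
  have := tg_small_lin hS (tg_sub ti u0 uv v1) cU; rewrite h0 h1.
  move=> /(_ (hV _ _ (Vi u u0 u1 ur) (Vi v v0 v1 vr))) li.
  have := lin_tr li (lexx 0) ler01 (lexx 1); rewrite h0 h1 => ->.
  by rewrite subr0 mulr1.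
exists cs, l; split=> //; last first.
  move=> e e0.
  have : \forall i \near F, forall t, 0 <= t -> t <= 1 ->
      0 <= t -> t <= 1 -> mdist (cs t) (C i t) < e.
    apply: (@seg_near _ _ F _ (fun i t => 0 <= t -> t <= 1 -> mdist (cs t) (C i t) < e) 0 1).
    move=> t t0 t1; have e4 : 0 < e / 2 by rewrite divr_gt0.
    have [d d0 [Fd hd]] := local_dist _ _ t0 t1 e4.
    exists ([set t' | `|t' - t| < d], [set i | forall u, 0 <= u -> u <= 1 -> `|u - t| < d ->
      mdist (cs t) (C i u) < e / 2]); first by split=> //; exact: near_dist.
    move=> [t' i] /= [t't hi] t'0 t'1; apply: le_lt_trans (metric_triangle _ (cs t) _) _.
    have := hd t' t'0 t'1 t't; have := hi t' t'0 t'1 t't; rewrite (metric_sym (cs t')).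
    by clear; lra.
  by apply: filterS => i h t t0 t1; exact: h.
split=> //.
have [eta eta0 heta] : exists2 eta, 0 < eta & forall t, 0 <= t -> t <= 1 ->
    forall u v, 0 <= u -> u <= v -> v <= 1 -> `|u - t| < eta -> `|v - t| < eta ->
      tau S (cs u) (cs v) = (l * (v - u))%:E.
  suff : \forall eta \near (0 : R)^'+, forall t, 0 <= t -> t <= 1 ->
    forall u v, 0 <= u -> u <= v -> v <= 1 -> `|u - t| < eta -> `|v - t| < eta ->
      tau S (cs u) (cs v) = (l * (v - u))%:E.
    move=> h; near (0 : R)^'+ => eta; exists eta; first by near: eta; exact: nbhs_right_gt.
    by near: eta; exact: h.
  apply: (@seg_near _ _ (0 : R)^'+ _ (fun eta t => forall u v, 0 <= u -> u <= v -> v <= 1 ->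
      `|u - t| < eta -> `|v - t| < eta -> tau S (cs u) (cs v) = (l * (v - u))%:E)).
  move=> t t0 t1; have [d d0 hd] := win t t0 t1.
  exists ([set t' | `|t' - t| < d / 2], [set e | e < d / 2]).
    by split; [apply: near_dist; rewrite divr_gt0|apply: nbhs_right_lt; rewrite divr_gt0].
  move=> [t' e] /= [t't ed] u v u0 uv v1 ut vt.
  have tri w : `|w - t'| < e -> `|w - t| < d.
    move=> wt; have -> : w - t = (w - t') + (t' - t) by ring.
    by apply: le_lt_trans (ler_normD _ _) _; clear -wt t't ed; lra.
  by apply: hd => //; exact: tri.
exists (eta / 2); first by rewrite divr_gt0.
move=> r s r0 rs s1 sr; apply: (heta r) => //.
- exact: le_trans rs s1.
- by rewrite subrr normr0.
- by rewrite ger0_norm ?subr_ge0//; clear -sr eta0; lra.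
Unshelve. all: by end_near. Qed.

End Limits.

(** * Lifting a timelike homotopy to a family of geodesics *)

Definition continuous_family {R : realType} {X : metricType R} (D : R -> R -> X) :=
  forall s e : R, 0 <= s -> s <= 1 -> 0 < e -> exists2 d, 0 < d &
    forall s', 0 <= s' -> s' <= 1 -> `|s' - s| < d -> near_geo e (D s) (D s').

Section Families.
Context {R : realType} {X : metricType R} (S : causal_data R X) (hS : tame S).
Implicit Types (x y z p q : X) (U V W : set X) (c : R -> X) (l e : R).

Local Notation "x ≼ y" := (cle S x y) (at level 70).
Local Notation "x ≪ y" := (cll S x y) (at level 70).

Lemma near_geo_refl e c : 0 < e -> near_geo e c c.
Proof. by move=> e0 t _ _; rewrite mdistxx. Qed.

Lemma near_geo_eqr e c c1 c2 : (forall t, 0 <= t -> t <= 1 -> c1 t = c2 t) ->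
  near_geo e c c1 -> near_geo e c c2.
Proof. by move=> h n t t0 t1; rewrite -h//; exact: n. Qed.

(** A bootstrap: a member within [e0] of [c] coincides, by local uniqueness, with the [e]-close
    geodesic [b] having the same ends. Since [e <= e0 / 2], the improved bound leaves room to
    continue in [w]. *)
Lemma family_stays_near c e0 e (E : R -> R -> X) : 0 < e -> e <= e0 / 2 ->
  ordered_ball S e0 c -> continuous_family E ->
  (forall w, 0 <= w -> w <= 1 -> exists l, tg S (E w) l) ->
  (forall w, 0 <= w -> w <= 1 -> exists b k,
     [/\ tg S b k, b 0 = E w 0, b 1 = E w 1 & near_geo e c b]) ->
  near_geo e0 c (E 0) -> forall w, 0 <= w -> w <= 1 -> near_geo e c (E w).
Proof.
move=> epos ee0 ob cE tE bE n0.
have e00 : 0 < e0 / 2 by apply: lt_le_trans ee0.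
have e0e : e <= e0 by clear -ee0 e00; lra.
have improve w : 0 <= w -> w <= 1 -> near_geo e0 c (E w) -> near_geo e c (E w).
  move=> w0 w1 nw; have [l tl] := tE w w0 w1; have [b [k [tb b0 b1 nb]]] := bE w w0 w1.
  apply: (near_geo_eqr _ nb) => t t0 t1.
  exact: (ordered_ball_unique hS ob tb tl (near_geo_le e0e nb) nw b0 b1).
apply: real_ind; first exact: ler01.
- by apply: improve; rewrite ?ler01.
- move=> w w0 w1 nw; have [d d0 hd] := cE w _ w0 (ltW w1) e00; exists d => // u wu ud u1.
  have u0 := le_trans w0 (ltW wu); apply: improve => //.
  have nu : near_geo (e0 / 2) (E w) (E u).
    by apply: hd => //; rewrite gtr0_norm ?subr_gt0// ltrBlDl.
  by apply: near_geo_le (near_geo_trans nw nu); clear -ee0; lra.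
- move=> w w0 w1 IH; have [d d0 hd] := cE w _ (ltW w0) w1 e00; apply: improve => //; first exact: ltW.
  have [u [u0 uw ud]] : exists u, [/\ 0 <= u, u < w & w - u < d].
    exists (w - Num.min w (d / 2)); have : Num.min w (d / 2) <= w by rewrite ge_min lexx.
    have : Num.min w (d / 2) <= d / 2 by rewrite ge_min lexx orbT.
    have : 0 < Num.min w (d / 2) by rewrite lt_min w0 divr_gt0.
    by clear -d0; split; lra.
  have nu : near_geo (e0 / 2) (E w) (E u).
    apply: hd => //; first exact: le_trans (ltW uw) w1.
    by rewrite distrC gtr0_norm ?subr_gt0.
  by apply: near_geo_le (near_geo_trans (IH u u0 uw) (near_geo_sym nu)); clear -ee0; lra.
Qed.

(** Coincidence with [E 0] is open by local uniqueness around the current member and closed by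
    continuity of the family. *)
Lemma family_constant (E : R -> R -> X) x y : continuous_family E ->
  (forall s, 0 <= s -> s <= 1 -> [/\ exists l, tg S (E s) l, E s 0 = x & E s 1 = y]) ->
  forall s, 0 <= s -> s <= 1 -> forall t, 0 <= t -> t <= 1 -> E s t = E 0 t.
Proof.
move=> cE tE; apply: real_ind => //.
- move=> s s0 s1 Es; have [[l tl] e0 e1] := tE s s0 (ltW s1).
  have [e epos ob] := local_order hS tl; have [d d0 hd] := cE s e s0 (ltW s1) epos.
  exists d => // u su ud u1 t t0 t1; have u0 := le_trans s0 (ltW su).
  have [[k tk] f0 f1] := tE u u0 u1; rewrite -Es//; symmetry.
  apply: (ordered_ball_unique hS ob tl tk); rewrite ?e0 ?e1//.
    exact: near_geo_refl.
  by apply: hd => //; rewrite gtr0_norm ?subr_gt0// ltrBlDl.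
- move=> s s0 s1 IH t t0 t1; apply: mdist_positivity; apply/le_anti.
  rewrite mdist_ge0 andbT; apply/ler_addgt0Pl => e epos; rewrite addr0.
  have [d d0 hd] := cE s e (ltW s0) s1 epos.
  have [u [u0 us ud]] : exists u, [/\ 0 <= u, u < s & s - u < d].
    exists (s - Num.min s (d / 2)); have : Num.min s (d / 2) <= s by rewrite ge_min lexx.
    have : Num.min s (d / 2) <= d / 2 by rewrite ge_min lexx orbT.
    have : 0 < Num.min s (d / 2) by rewrite lt_min s0 divr_gt0.
    by clear -d0; split; lra.
  rewrite -(IH u)//; apply: ltW; apply: hd => //; first exact: le_trans (ltW us) s1.
  by rewrite distrC gtr0_norm ?subr_gt0.
Qed.

End Families.

(* [H s] is a timelike curve from [x] for every [s]; at the parameters [sd b] it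
   is, up to reparametrization by [fd b], a prescribed geodesic [gd b].  A value
   of [sd b] outside [0, 1] prescribes nothing. *)
Record timelike_fan {R : realType} {X : metricType R} (S : causal_data R X) (x : X)
    (H : R -> R -> X) (sd : bool -> R) (gd : bool -> R -> X) (fd : bool -> R -> R) :
    Prop := TimelikeFan {
  fan_cont : continuous (fun z : R * R => H z.1 z.2);
  fan_ll : forall s t t', 0 <= t -> t < t' -> t' <= 1 -> cll S (H s t) (H s t');
  fan_start : forall s, H s 0 = x;
  fan_tg : forall b, 0 <= sd b -> sd b <= 1 -> exists l, tg S (gd b) l;
  fan_gstart : forall b, 0 <= sd b -> sd b <= 1 -> gd b 0 = x;
  fan_fcont : forall b, 0 <= sd b -> sd b <= 1 -> continuous (fd b);
  fan_fgt0 : forall b t, 0 <= sd b -> sd b <= 1 -> 0 < t -> t <= 1 -> 0 < fd b t;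
  fan_fle1 : forall b t, 0 <= sd b -> sd b <= 1 -> 0 < t -> t <= 1 -> fd b t <= 1;
  fan_data : forall b t, 0 <= sd b -> sd b <= 1 -> 0 <= t -> t <= 1 ->
    H (sd b) t = gd b (fd b t) }.

Section Lift.
Context {R : realType} {X : metricType R} (S : causal_data R X) (hS : tame S).
Context (x : X) (H : R -> R -> X) (sd : bool -> R) (gd : bool -> R -> X) (fd : bool -> R -> R).
Context (hH : timelike_fan S x H sd gd fd).
Implicit Types (y z p q : X) (U V W : set X) (c : R -> X) (l e m : R).

Local Notation "x ≼ y" := (cle S x y) (at level 70).
Local Notation "x ≪ y" := (cll S x y) (at level 70).

(** The common lower bound [m] on speeds prevents degeneration when [t] passes to a limit. The last
    clause forces the family through the prescribed geodesics, so that a lifted homotopy connects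
    two given ones. *)
Definition lift_at (m t : R) (D : R -> R -> X) : Prop :=
  [/\ continuous_family D,
      forall s, 0 <= s -> s <= 1 ->
        [/\ exists2 l, m <= l & tg S (D s) l, D s 0 = x & D s 1 = H s t] &
      forall b r, 0 <= sd b -> sd b <= 1 -> 0 <= r -> r <= 1 ->
        D (sd b) r = gd b (fd b t * r)].

Lemma fan_cvg {I : Type} (F : set_system I) {FF : Filter F} (f g : I -> R) (s t : R) :
  f @ F --> s -> g @ F --> t -> (fun i => H (f i) (g i)) @ F --> H s t.
Proof.
move=> fs gt; have h : (fun z : R * R => H z.1 z.2) @ (s, t) --> H s t.
  exact: (@fan_cont _ _ _ _ _ _ _ _ hH (s, t)).
exact: (cvg_comp _ _ (cvg_pair fs gt) h).
Qed.

Lemma data_tg b t : 0 <= sd b -> sd b <= 1 -> 0 < t -> t <= 1 ->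
  exists l, tg S (fun r => gd b (fd b t * r)) l.
Proof.
move=> b0 b1 t0 t1; have [l tl] := fan_tg hH b0 b1.
have := tg_sub tl (lexx 0) (fan_fgt0 hH b0 b1 t0 t1) (fan_fle1 hH b0 b1 t0 t1).
rewrite subr0; have -> : (fun r => gd b (0 + r * fd b t)) = (fun r => gd b (fd b t * r)).
  by apply/funext => r; rewrite add0r mulrC.
by exists (l * fd b t).
Qed.

Lemma data_ends b t : 0 <= sd b -> sd b <= 1 -> 0 <= t -> t <= 1 ->
  gd b (fd b t * 0) = x /\ gd b (fd b t * 1) = H (sd b) t.
Proof.
by move=> b0 b1 t0 t1; rewrite mulr0 mulr1 (fan_gstart hH)// (fan_data hH).
Qed.

Lemma exists_near_fan c l e s t : tg S c l -> c 0 = x -> c 1 = H s t -> 0 < e ->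
  exists2 d, 0 < d & forall s' t', `|s' - s| < d -> `|t' - t| < d ->
    exists b k, [/\ tg S b k, b 0 = x, b 1 = H s' t' & near_geo e c b].
Proof.
move=> tc c0 c1 e0; have := tg_exists_near hS tc e0; rewrite c0 c1 => h.
have cH : (fun z : R * R => (x, H z.1 z.2)) @ (s, t) --> (x, H s t).
  by apply: cvg_pair; [exact: cvg_cst|exact: (@fan_cont _ _ _ _ _ _ _ _ hH (s, t))].
have [[A B] /= [/near_distP[a a0 ha] /near_distP[b b0 hb]] AB] := cH _ h.
exists (Num.min a b); first by rewrite lt_min a0.
move=> s' t'; rewrite !lt_min => /andP[sa _] /andP[_ tb].
by apply: (AB (s', t')); split; [exact: ha|exact: hb].
Qed.

(** For small [t1] the whole fan at time [t1] is in a causally convex comparison neighborhood of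
    [x]. There the geodesics are the unique maximizers, and compactness in [s] bounds their speeds
    from below. *)
Lemma lift_start : exists t1 m D, [/\ 0 < t1, t1 <= 1, 0 < m & lift_at m t1 D].
Proof.
have [U nU cU] := t_local hS x; have [V nV hV] := strongly_causal hS nU.
have Vx := nbhs_singleton nV.
have hVs : \forall t \near (0 : R)^'+, forall s, 0 <= s -> s <= 1 -> V (H s t).
  apply: (@seg_near _ _ (0 : R)^'+ _ (fun t s => V (H s t)) 0 1) => s s0 s1.
  have : (fun z : R * R => H z.1 z.2) @ filter_prod (nbhs s) (0 : R)^'+ --> x.
    rewrite -(fan_start hH s); apply: fan_cvg; first exact: cvg_fst.
    have c2 : (fun z : R * R => z.2) @ filter_prod (nbhs s) (0 : R)^'+ --> (0 : R)^'+ by exact: cvg_snd.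
    by apply: (cvg_trans c2); exact: cvg_within.
  exact.
have [t1 [t10 t11 Vt1]] : exists t1 : R, [/\ 0 < t1, t1 <= 1 &
    forall s, 0 <= s -> s <= 1 -> V (H s t1)].
  near (0 : R)^'+ => t1; exists t1; split.
  - by near: t1; exact: nbhs_right_gt.
  - by near: t1; exact: nbhs_right_le.
  - by near: t1.
have dU s : 0 <= s -> s <= 1 -> diamond S x (H s t1) `<=` U.
  by move=> s0 s1; apply: hV => //; exact: Vt1.
have ll s : x ≪ H s t1 by rewrite -(fan_start hH s); exact: (fan_ll hH).
have Ux := nbhs_singleton nU.
have UH s : 0 <= s -> s <= 1 -> U (H s t1).
  by move=> s0 s1; have [] := diamond_ends hS (ll s) (dU s s0 s1).
have [m m0 hm] : exists2 m, 0 < m & forall s, 0 <= s -> s <= 1 -> m <= tr S x (H s t1).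
  suff : \forall m \near (0 : R)^'+, forall s, 0 <= s -> s <= 1 -> m <= tr S x (H s t1).
    move=> h; near (0 : R)^'+ => m; exists m; first by near: m; exact: nbhs_right_gt.
    by near: m; exact: h.
  apply: (@seg_near _ _ (0 : R)^'+ _ (fun m s => m <= tr S x (H s t1)) 0 1) => s s0 s1.
  have g0 : 0 < tr S x (H s t1) by exact: (tr_gt0 hS cU Ux (UH s s0 s1) (ll s)).
  have c1 : (fun s' => tr S x (H s' t1)) @ s --> tr S x (H s t1).
    apply: (tr_lim cU Ux (UH s s0 s1)); first exact: cvg_cst.
    by apply: fan_cvg; [exact: cvg_id|exact: cvg_cst].
  have g2 : tr S x (H s t1) / 2 < tr S x (H s t1) by lra.
  exists ([set s' | tr S x (H s t1) / 2 < tr S x (H s' t1)], [set m | m < tr S x (H s t1) / 2]).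
    split; first exact: (cvgr_gt _ c1 _ g2).
    by apply: nbhs_right_lt; rewrite divr_gt0.
  by move=> [s' m'] /= [h1 h2]; apply: ltW; exact: lt_trans h1.
have /choice[D hD] : forall s : R, exists c, 0 <= s -> s <= 1 ->
    [/\ continuous c, lin S c (tr S x (H s t1)), c 0 = x & c 1 = H s t1].
  move=> s; have [[s0 s1]|no] := pselect (0 <= s /\ s <= 1); last first.
    by exists (fun=> x) => s0 s1; case: no.
  by have [c hc] := cmp_ex hS cU (ll s) (dU s s0 s1); exists c.
have tD s : 0 <= s -> s <= 1 -> tg S (D s) (tr S x (H s t1)).
  move=> s0 s1; have [cD lD D0 D1] := hD s s0 s1; apply: lin_tg => //.
  exact: (tr_gt0 hS cU Ux (UH s s0 s1) (ll s)).
have uniq s c l : 0 <= s -> s <= 1 -> tg S c l -> c 0 = x -> c 1 = H s t1 ->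
    forall r, 0 <= r -> r <= 1 -> c r = D s r.
  move=> s0 s1 tc c0 c1; have [cD lD D0 D1] := hD s s0 s1.
  apply: (tg_small_unique hS tc (tD s s0 s1) cU); rewrite ?c0 ?c1 ?D0 ?D1//.
  exact: dU.
exists t1, m, D; split=> //; split.
- move=> s e s0 s1 e0; have [cD lD D0 D1] := hD s s0 s1.
  have [d d0 hd] := exists_near_fan (tD s s0 s1) D0 D1 e0.
  exists d => // s' s'0 s'1 ss'; have [|b [k [tb b0 b1 nb]]] := hd s' t1 ss'.
    by rewrite subrr normr0.
  by apply: (near_geo_eqr _ nb) => r r0 r1; exact: (uniq s' b k).
- move=> s s0 s1; have [cD lD D0 D1] := hD s s0 s1; split=> //.
  by exists (tr S x (H s t1)); [exact: hm|exact: tD].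
- move=> b r b0 b1 r0 r1; have [l tl] := data_tg b0 b1 t10 t11.
  have [e0 e1] := data_ends b0 b1 (ltW t10) t11.
  by symmetry; apply: (uniq (sd b) (fun r => gd b (fd b t1 * r)) l).
Unshelve. all: by end_near. Qed.

(** For each [s] the geodesics [D t s] remain in the diamond of [x] and [H s T], so [tg_limit] gives
    [E s]. Continuity in [s] is the delicate point, because the ultrafilter limits are taken
    separately for each [s]; [family_stays_near] along a family with [t] fixed compares them. *)
Lemma lift_limit (m t1 T : R) : 0 < m -> 0 <= t1 -> t1 < T -> T <= 1 ->
  (forall t : R, t1 <= t -> t < T -> exists D, lift_at m t D) ->
  exists D, lift_at m T D.
Proof.
move=> m0 t10 t1T T1 IH; have T0 := le_lt_trans t10 t1T.
have /choice[D hD] : forall t : R, exists D, t1 <= t -> t < T -> lift_at m t D.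
  move=> t; have [[h1 h2]|no] := pselect (t1 <= t /\ t < T).
    by have [D hD] := IH t h1 h2; exists D.
  by exists (fun _ _ => x) => h1 h2; case: no.
have [F [UF sF]] := ultraFilterLemma (at_left_proper_filter T).
have Ft : \forall t \near F, t1 <= t /\ t < T.
  by apply: sF; near=> t; split; near: t; [exact: nbhs_left_ge|exact: nbhs_left_lt].
have FT : (fun t : R => t) @ F --> T.
  by apply: cvg_trans (sF : F --> T^'-) _; exact: cvg_within.
have /choice[E hE] : forall s : R, exists c, 0 <= s -> s <= 1 ->
   [/\ exists2 l, m <= l & tg S c l, forall r, 0 <= r -> r <= 1 -> (fun t => D t s r) @ F --> c r &
       forall e, 0 < e -> \forall t \near F, near_geo e c (D t s)].
  move=> s; have [[s0 s1]|no] := pselect (0 <= s /\ s <= 1); last first.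
    by exists (fun=> x) => s0 s1; case: no.
  have /choice[ls hls] : forall t : R, exists l, t1 <= t -> t < T -> tg S (D t s) l /\ m <= l.
    move=> t; have [[h1 h2]|no] := pselect (t1 <= t /\ t < T); last first.
      by exists 0 => h1 h2; case: no.
    by have [_ /(_ s s0 s1)[[l ml tl] _ _] _] := hD t h1 h2; exists l.
  have [||c [l [tc ml cvc nc]]] := @tg_limit _ _ _ hS _ F UF (fun t => D t s) ls x (H s T) m m0.
  - by apply: filterS Ft => t [h1 h2]; exact: hls.
  - apply: filterS Ft => t [h1 h2] r r0 r1.
    have [_ /(_ s s0 s1)[[l ml tl] D0 D1] _] := hD t h1 h2.
    split; first by rewrite -D0; apply: (tg_le hS tl).
    apply: (@t_trans _ _ _ hS _ (H s t)); first by rewrite -D1; apply: (tg_le hS tl).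
    by apply: (t_ll_le hS); apply: (fan_ll hH) => //; exact: le_trans h1.
  by exists c => _ _; split=> //; exists l.
have EF s : 0 <= s -> s <= 1 -> E s 0 = x /\ E s 1 = H s T.
  move=> s0 s1; have [_ cE _] := hE s s0 s1; split.
    apply: (cvg_mdist_unique (cE 0 (lexx _) ler01)).
    apply: cvg_near_cst; apply: filterS Ft => t [h1 h2].
    by have [_ /(_ s s0 s1)[_ D0 _] _] := hD t h1 h2.
  apply: (cvg_mdist_unique (cE 1 ler01 (lexx _))).
  have cH : (fun t => H s t) @ F --> H s T by apply: fan_cvg => //; exact: cvg_cst.
  apply: cvg_trans cH; apply: near_eq_cvg; apply: filterS Ft => t [h1 h2].
  by have [_ /(_ s s0 s1)[_ _ D1] _] := hD t h1 h2.
exists E; split.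
- move=> s e s0 s1 epos; have [[l ml tl] _ nE] := hE s s0 s1.
  have [E0 E1] := EF s s0 s1.
  have [e0 e0pos ob] := local_order hS tl.
  have [e' [e'0 e'e0 e'e]] : exists e', [/\ 0 < e', e' <= e0 / 2 & e' <= e / 4].
    by exists (Num.min (e0 / 2) (e / 4)); rewrite lt_min !divr_gt0// !ge_min !lexx orbT.
  have [d d0 hd] := exists_near_fan tl E0 E1 e'0.
  exists d => // s' s'0 s'1 ss'.
  have Fd : \forall t \near F, `|t - T| < d by exact: (FT _ (near_dist T d0)).
  have [_ _ nE'] := hE s' s'0 s'1.
  have e4 : 0 < e / 4 by rewrite divr_gt0.
  have [t [[h1 h2] [hd' [n1 n2]]]] := @filter_ex _ F _ _ (filterI Ft
     (filterI Fd (filterI (nE e0 e0pos) (nE' _ e4)))).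
  have [cD tD _] := hD t h1 h2.
  (* The straight path from [s] to [s']: along it the members of [D t] stay [e']-close to [E s], and
     at its end [D t s'] is close to [E s']. *)
  pose w2s w := s + w * (s' - s).
  have w01 w : 0 <= w -> w <= 1 -> [/\ 0 <= w2s w, w2s w <= 1 & `|w2s w - s| < d].
    move=> w0 w1; split.
    - have : w2s w = (1 - w) * s + w * s' by rewrite /w2s; ring.
      by move=> ->; rewrite addr_ge0// mulr_ge0// subr_ge0.
    - have -> : w2s w = (1 - w) * s + w * s' by rewrite /w2s; ring.
      have h3 : (1 - w) * s <= (1 - w) * 1 by rewrite ler_wpM2l// subr_ge0.
      have h4 : w * s' <= w * 1 by rewrite ler_wpM2l.
      by lra.
    - rewrite /w2s addrAC subrr add0r normrM ger0_norm//; apply: le_lt_trans ss'.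
      by rewrite ler_piMl.
  have : near_geo e' (E s) (D t (w2s 1)).
    apply: (@family_stays_near _ _ _ hS (E s) e0 e' (fun w => D t (w2s w))) => //.
    + move=> w f w0 w1 f0; have [a b _] := w01 w w0 w1.
      have [k k0 hk] := cD _ f a b f0; exists k => // w' w'0 w'1 ww'.
      have [a' b' _] := w01 w' w'0 w'1; apply: hk => //.
      have -> : w2s w' - w2s w = (w' - w) * (s' - s) by rewrite /w2s; ring.
      rewrite normrM; apply: le_lt_trans ww'; rewrite ler_piMr//.
      by apply/ler_normlP; split; lra.
    + by move=> w w0 w1; have [a b _] := w01 w w0 w1; have [[k _ tk] _ _] := tD _ a b; exists k.
    + move=> w w0 w1; have [a b wd] := w01 w w0 w1; have [_ D0 D1] := tD _ a b.
      by have [g [k [tg_ g0 g1 ng]]] := hd _ _ wd hd'; exists g, k; rewrite g0 g1 D0 D1.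
    + have -> : D t (w2s 0) = D t s by rewrite /w2s mul0r addr0.
      exact: n1.
  have -> : w2s 1 = s' by rewrite /w2s mul1r subrKC.
  move=> n3; apply: near_geo_le (near_geo_trans n3 (near_geo_sym n2)).
  by lra.
- move=> s s0 s1; have [[l ml tl] _ _] := hE s s0 s1; have [E0 E1] := EF s s0 s1.
  by split=> //; exists l.
- move=> b r b0 b1 r0 r1; have [_ cE _] := hE _ b0 b1.
  apply: (cvg_mdist_unique (cE r r0 r1)).
  have [k [_ cg _]] := fan_tg hH b0 b1.
  have cH : (fun t => gd b (fd b t * r)) @ F --> gd b (fd b T * r).
    apply: (cont_cvg cg); apply: cvgM; last exact: cvg_cst.
    exact: (cvg_comp _ _ FT (@fan_fcont _ _ _ _ _ _ _ _ hH b b0 b1 T)).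
  apply: cvg_trans cH; apply: near_eq_cvg; apply: filterS Ft => t [h1 h2].
  by have [_ _ /(_ b r b0 b1 r0 r1)] := hD t h1 h2.
Unshelve. all: by end_near. Qed.

End Lift.

Section LiftStep.
Context {R : realType} {X : metricType R} (S : causal_data R X) (hS : tame S).
Context (x : X) (H : R -> R -> X) (sd : bool -> R) (gd : bool -> R -> X) (fd : bool -> R -> R).
Context (hH : timelike_fan S x H sd gd fd).
Implicit Types (y z p q : X) (U V W : set X) (c : R -> X) (l e m : R).

Local Notation "x ≼ y" := (cle S x y) (at level 70).
Local Notation "x ≪ y" := (cll S x y) (at level 70).

(** On a short initial window [c1 r <= c2 r], so the separation from the common start is at least as
    large along [c2]. Thus speeds do not decrease while the end moves to the future along the fan,
    and [m] is preserved. *)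
Lemma ordered_speed e c c1 c2 l1 l2 : ordered_ball S e c -> tg S c1 l1 -> tg S c2 l2 ->
  near_geo e c c1 -> near_geo e c c2 -> c1 0 = c2 0 -> c1 1 ≼ c2 1 -> l1 <= l2.
Proof.
move=> ob t1 t2 n1 n2 e0 e1.
have ord := ob _ _ _ _ t1 t2 n1 n2 _ e1; rewrite e0 in ord.
have [_ _ [d1 d10 h1]] := t1; have [_ _ [d2 d20 h2]] := t2.
have [r [r0 r1 rd1 rd2]] : exists r : R, [/\ 0 < r, r <= 1, r <= d1 & r <= d2].
  exists (Num.min 1 (Num.min d1 d2)).
  by rewrite !lt_min ltr01 d10 d20 !ge_min !lexx !orbT.
have := t_tri hS (tg_le hS t2 (lexx 0) (ltW r0) r1) (t_refl hS (c2 r)).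
have le := ord (t_refl hS _) r (ltW r0) r1.
have := t_tri hS (tg_le hS t1 (lexx 0) (ltW r0) r1) le.
rewrite e0 -{1}e0 h1 ?subr0 ?(ltW r0)// h2 ?subr0 ?(ltW r0)// => le1 _.
have : ((l1 * r)%:E <= (l2 * r)%:E)%E.
  by apply: le_trans le1; rewrite leeDl// (t_tau0 hS).
by rewrite lee_fin ler_pM2r.
Qed.

(** Compactness in [s] gives one uniqueness radius [e0] and one time step for all geodesics of the
    family. The new ones are chosen for each [s] independently; inside the ordered balls the choice
    is forced, hence continuous in [s] and compatible with the prescribed geodesics. *)
Lemma lift_step m t D : 0 < t -> t < 1 -> lift_at S x H sd gd fd m t D ->
  exists2 e, 0 < e & forall t', t < t' -> t' < t + e -> t' <= 1 ->
    exists D', lift_at S x H sd gd fd m t' D'.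
Proof.
move=> t0 t1 [cD tD dD].
have [e0 e00 ob] : exists2 e0, 0 < e0 & forall s, 0 <= s -> s <= 1 -> ordered_ball S e0 (D s).
  suff : \forall e0 \near (0 : R)^'+, forall s, 0 <= s -> s <= 1 ->
      0 <= s -> s <= 1 -> ordered_ball S e0 (D s).
    move=> h; near (0 : R)^'+ => e0; exists e0; first by near: e0; exact: nbhs_right_gt.
    have h' : forall s, 0 <= s -> s <= 1 ->
      0 <= s -> s <= 1 -> ordered_ball S e0 (D s) by near: e0; exact: h.
    by move=> s s0 s1; exact: h'.
  apply: (@seg_near _ _ (0 : R)^'+ _ (fun e0 s => 0 <= s -> s <= 1 -> ordered_ball S e0 (D s)) 0 1).
  move=> s s0 s1; have [[l ml tl] _ _] := tD s s0 s1.
  have [e epos ob] := local_order hS tl; have e2 : 0 < e / 2 by rewrite divr_gt0.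
  have [d d0 hd] := cD s _ s0 s1 e2.
  exists ([set s' | `|s' - s| < d], [set e' | e' < e / 2]).
    by split; [exact: near_dist|exact: nbhs_right_lt].
  move=> [s' e'] /= [s's e'e] s'0 s'1; apply: ordered_ball_le (ltW e'e) _.
  by apply: ordered_ball_near ob; exact: hd.
(* Deviations of size [e0 / 4] and [e0 / 8] are added at most in pairs, so all competing geodesics
   remain in one ball of radius [e0]. *)
have e04 : 0 < e0 / 4 by rewrite divr_gt0.
have e08 : 0 < e0 / 8 by rewrite divr_gt0.
have step : \forall e \near (0 : R)^'+, forall s, 0 <= s -> s <= 1 -> 0 <= s -> s <= 1 ->
    forall t', t <= t' -> t' <= t + e -> exists b k,
      [/\ tg S b k, b 0 = x, b 1 = H s t' & near_geo (e0 / 4) (D s) b].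
  apply: (@seg_near _ _ (0 : R)^'+ _ (fun e s => 0 <= s -> s <= 1 ->
    forall t', t <= t' -> t' <= t + e -> exists b k,
      [/\ tg S b k, b 0 = x, b 1 = H s t' & near_geo (e0 / 4) (D s) b]) 0 1).
  move=> s s0 s1; have [[l ml tl] D0 D1] := tD s s0 s1.
  have [d d0 hd] := exists_near_fan hS hH tl D0 D1 e08.
  have [d' d'0 hd'] := cD s _ s0 s1 e08.
  exists ([set s' | `|s' - s| < Num.min d d'], [set e | e < d]).
    by split; [apply: near_dist; rewrite lt_min d0|exact: nbhs_right_lt].
  move=> [s' e] /= []; rewrite lt_min => /andP[s's s's'] ed s'0 s'1 t' tt' t'e.
  have [|b [k [tb b0 b1 nb]]] := hd s' t' s's.
    by rewrite ger0_norm ?subr_ge0//; lra.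
  exists b, k; split=> //.
  apply: near_geo_le (near_geo_trans (near_geo_sym (hd' s' s'0 s'1 s's')) nb).
  by lra.
have dnear b : \forall t' \near t, 0 <= sd b -> sd b <= 1 ->
    near_geo (e0 / 4) (D (sd b)) (fun r => gd b (fd b t' * r)).
  have [[b0 b1]|no] := pselect (0 <= sd b /\ sd b <= 1); last first.
    by near=> t' => b0 b1; case: no.
  have [k [_ cg _]] := fan_tg hH b0 b1.
  have cfd : continuous (fd b) by have := fan_fcont hH b0 b1.
  have : \forall t' \near t, forall r, 0 <= r -> r <= 1 -> 0 <= r -> r <= 1 ->
     mdist (D (sd b) r) (gd b (fd b t' * r)) < e0 / 4.
    apply: (@seg_near _ _ (nbhs t) _ (fun t' r => 0 <= r -> r <= 1 ->
      mdist (D (sd b) r) (gd b (fd b t' * r)) < e0 / 4) 0 1) => r r0 r1.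
    have cv : (fun z : R * R => mdist (gd b (fd b t * z.1)) (gd b (fd b z.2 * z.1))) @
        filter_prod (nbhs r) (nbhs t) --> mdist (gd b (fd b t * r)) (gd b (fd b t * r)).
      apply: mdist_cvg; apply: (cont_cvg cg); apply: cvgM; try exact: cvg_fst.
        exact: cvg_cst.
      have c2 : (fun z : R * R => z.2) @ filter_prod (nbhs r) (nbhs t) --> t by exact: cvg_snd.
      exact: (cvg_comp _ _ c2 (cfd t)).
    have lt0 : mdist (gd b (fd b t * r)) (gd b (fd b t * r)) < e0 / 4 by rewrite mdistxx.
    have h : \forall z \near filter_prod (nbhs r) (nbhs t),
        mdist (gd b (fd b t * z.1)) (gd b (fd b z.2 * z.1)) < e0 / 4.
      exact: (cvgr_lt _ cv _ lt0).
    by apply: (filterS _ h) => -[r' t'] /= h' r'0 r'1; rewrite dD.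
  by apply: filterS => t' h _ _ r r0 r1; exact: h.
have /near_distP[e1 e10 he1] : \forall t' \near t, forall b, 0 <= sd b -> sd b <= 1 ->
    near_geo (e0 / 4) (D (sd b)) (fun r => gd b (fd b t' * r)).
  by have := dnear true; have := dnear false; apply: filterS2 => t' h1 h2 [].
near (0 : R)^'+ => e; exists e; first by near: e; exact: nbhs_right_gt.
have ee1 : e <= e1 by near: e; exact: nbhs_right_le.
have step' : forall s, 0 <= s -> s <= 1 -> 0 <= s -> s <= 1 ->
    forall t', t <= t' -> t' <= t + e -> exists b k,
      [/\ tg S b k, b 0 = x, b 1 = H s t' & near_geo (e0 / 4) (D s) b] by near: e.
move=> t' tt' t'e t'1.
have t'0 := lt_trans t0 tt'.
have /choice[D' hD'] : forall s : R, exists b, 0 <= s -> s <= 1 -> exists k,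
    [/\ tg S b k, b 0 = x, b 1 = H s t' & near_geo (e0 / 4) (D s) b].
  move=> s; have [[s0 s1]|no] := pselect (0 <= s /\ s <= 1); last first.
    by exists (fun=> x) => s0 s1; case: no.
  by have [b hb] := step' s s0 s1 s0 s1 t' (ltW tt') (ltW t'e); exists b.
have e04e : e0 / 4 <= e0 by lra.
exists D'; split.
- move=> s f s0 s1 f0; have [k [tk D'0 D'1 nD']] := hD' s s0 s1.
  pose f' := Num.min f (e0 / 8).
  have [f'0 f'f f'e] : [/\ 0 < f', f' <= f & f' <= e0 / 8].
    by rewrite /f' lt_min f0 e08 !ge_min !lexx orbT.
  have [d d0 hd] := exists_near_fan hS hH tk D'0 D'1 f'0.
  have [d' d'0 hd'] := cD s _ s0 s1 e04.
  exists (Num.min d d'); first by rewrite lt_min d0.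
  move=> s' s'0 s'1; rewrite lt_min => /andP[s's s's'].
  have [|b [k' [tb b0 b1 nb]]] := hd s' t' s's; first by rewrite subrr normr0.
  have [k'' [tk'' D''0 D''1 nD'']] := hD' s' s'0 s'1.
  apply: near_geo_le f'f _; apply: (near_geo_eqr _ nb).
  apply: (ordered_ball_unique hS (ob s s0 s1) tb tk''); rewrite ?b0 ?b1//.
    by apply: near_geo_le (near_geo_trans nD' nb); lra.
  by apply: near_geo_le (near_geo_trans (hd' s' s'0 s'1 s's') nD''); lra.
- move=> s s0 s1; have [k [tk D'0 D'1 nD']] := hD' s s0 s1.
  have [[l ml tl] D0 D1] := tD s s0 s1; split=> //; exists k => //.
  apply: le_trans ml _; apply: (ordered_speed (ob s s0 s1) tl tk).
  + exact: near_geo_refl.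
  + exact: near_geo_le e04e nD'.
  + by rewrite D0 D'0.
  + by rewrite D1 D'1; apply: (t_ll_le hS); apply: (fan_ll hH) => //; exact: ltW.
- move=> b r b0 b1 r0 r1; have [k [tk D'0 D'1 nD']] := hD' _ b0 b1.
  have [l tl] := data_tg hH b0 b1 t'0 t'1.
  have [g0 g1] := data_ends hH b0 b1 (ltW t'0) t'1.
  apply: (ordered_ball_unique hS (ob _ b0 b1) tk tl) => //.
  + exact: near_geo_le e04e nD'.
  + apply: near_geo_le e04e _; apply: he1 => //.
    by rewrite gtr0_norm ?subr_gt0// ltrBlDl; apply: lt_le_trans t'e _; rewrite lerD2l.
  + by rewrite D'0 g0.
  + by rewrite D'1 g1.
Unshelve. all: by end_near. Qed.

Lemma lift_exists : exists m D, 0 < m /\ lift_at S x H sd gd fd m 1 D.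
Proof.
have [t1 [m [D1 [t10 t11 m0 hD1]]]] := lift_start hS hH.
suff main : forall t, t1 <= t -> t <= 1 -> exists D, lift_at S x H sd gd fd m t D.
  by have [D hD] := main 1 t11 (lexx _); exists m, D.
apply: real_ind => //.
- by exists D1.
- move=> t t1t lt1 [D hD].
  by have [e e0 he] := lift_step (lt_le_trans t10 t1t) lt1 hD; exists e.
- move=> t t1t lt1 IH; exact: (lift_limit hS hH m0 (ltW t10) t1t lt1 IH).
Qed.

End LiftStep.

(** * Existence from a curve and uniqueness from a homotopy *)

Section Conclusions.
Context {R : realType} {X : metricType R} (S : causal_data R X) (hS : tame S).
Implicit Types (x y z p q : X) (c : R -> X).

Lemma tg_exists_of_curve (x : X) (g : R -> X) : continuous g ->
  (forall t t', 0 <= t -> t < t' -> t' <= 1 -> cll S (g t) (g t')) -> g 0 = x ->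
  exists c l, [/\ tg S c l, c 0 = x & c 1 = g 1].
Proof.
move=> cg gll g0.
(* The constant fan; [2] is outside [[0, 1]], so no geodesic is prescribed. *)
have hH : timelike_fan S x (fun _ => g) (fun=> 2) (fun=> g) (fun _ t => t).
  have no : ~~ ((2 : R) <= 1) by rewrite -ltNge; lra.
  split=> //; try by move=> *; exfalso; move/negP: no.
  by move=> z; apply: (cont_cvg cg); exact: cvg_snd.
have [m [D [m0 [_ tD _]]]] := lift_exists hS hH.
by have [[l _ tl] D0 D1] := tD 0 (lexx _) ler01; exists (D 0), l.
Qed.

(** With the two geodesics prescribed at [s = 1] and [s = 0], the lift at time [1] is a continuous
    family of geodesics with common ends that contains both, and such a family is constant. *)
Lemma tg_unique_of_homotopy (x y : X) (H : R -> R -> X) (gd : bool -> R -> X)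
    (fd : bool -> R -> R) :
  timelike_fan S x H (fun b => if b then 1 else 0) gd fd ->
  (forall s, 0 <= s -> s <= 1 -> H s 1 = y) -> (forall b, fd b 1 = 1) ->
  forall t, 0 <= t -> t <= 1 -> gd true t = gd false t.
Proof.
move=> hH H1 f1 t t0 t1.
have [m [D [m0 [cD tD dD]]]] := lift_exists hS hH.
have h s : 0 <= s -> s <= 1 -> [/\ exists l, tg S (D s) l, D s 0 = x & D s 1 = y].
  move=> s0 s1; have [[l _ tl] D0 D1] := tD s s0 s1.
  by rewrite D0 D1 H1//; split=> //; exists l.
have := family_constant hS cD h ler01 (lexx 1) t0 t1.
have := dD true t; have := dD false t; rewrite !f1 !mul1r => -> // -> //.
Qed.

End Conclusions.

(** * Lengths of curves and the causal order *)

Section Partitions.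
Context {R : realType} {X : metricType R}.
Implicit Types (f : X -> X -> \bar R) (g : R -> X) (a b : R) (s : seq R).

Lemma partition_sum_nil f a b g : partition_sum f a b g [::] = 0%E.
Proof. by rewrite /partition_sum big_nil. Qed.

Lemma partition_sum_cons f a b g t s : partition_sum f a b g (t :: s) =
  (f (g a) (g t) + partition_sum f t b g s)%E.
Proof. by rewrite /partition_sum /= big_nat_recl. Qed.

Lemma partition_cons a b t s : a < t -> itv_partition t b s ->
  itv_partition a b (t :: s).
Proof. by move=> at_ [pt lt]; split=> //=; rewrite at_. Qed.

Lemma partition_split a b t s : itv_partition a b (t :: s) ->
  a < t /\ itv_partition t b s.
Proof. by move=> [/= /andP[at_ p] l]. Qed.

(* Allows [a = t], where the step contributes nothing. *)
Lemma partition_step f a b g t s : f (g a) (g a) = 0%E -> a <= t ->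
  itv_partition t b s -> exists2 s', itv_partition a b s' &
    partition_sum f a b g s' = (f (g a) (g t) + partition_sum f t b g s)%E.
Proof.
move=> f0; rewrite le_eqVlt => /predU1P[<- ps|at_ ps].
  by exists s => //; rewrite f0 add0e.
by exists (t :: s); [exact: partition_cons|rewrite partition_sum_cons].
Qed.

Lemma partition_exact f a b g (phi : R -> R) s : itv_partition a b s ->
  (forall u v, a <= u -> u <= v -> v <= b -> f (g u) (g v) = (phi v - phi u)%:E) ->
  partition_sum f a b g s = (phi b - phi a)%:E.
Proof.
elim: s a => [a /itv_partition_nil-> _|t s ih a /partition_split[at_ ps] h].
  by rewrite partition_sum_nil subrr.
have tb := itv_partition_le ps.
rewrite partition_sum_cons (ih t ps) => [|u v tu]; last exact: h (le_trans (ltW at_) tu).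
by rewrite h// ?(ltW at_)// -EFinD; congr EFin; ring.
Qed.

Fixpoint consecutive (Q : R -> R -> Prop) (a : R) s : Prop :=
  if s is t :: s' then Q a t /\ consecutive Q t s' else True.

Lemma consecutive_rcons Q a t s : consecutive Q a s -> Q (last a s) t ->
  consecutive Q a (rcons s t).
Proof. by elim: s a => [a //|u s ih a /= [? ?] ?]; split=> //; exact: ih. Qed.

Lemma partition_rcons a b t s : itv_partition a b s -> b < t ->
  itv_partition a t (rcons s t).
Proof.
move=> [ps /eqP ls] bt; split; last by rewrite last_rcons.
by rewrite rcons_path ps ls bt.
Qed.

(** Real induction on the right end: a partition of [[a, u]] with [u] close to [t] is prolonged by
    one admissible step. *)
Lemma fine_partition (Q : R -> R -> Prop) a b : a <= b ->
  (forall t, a <= t -> t <= b -> exists2 d, 0 < d & forall u v, a <= u -> u <= v ->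
     v <= b -> `|u - t| < d -> `|v - t| < d -> Q u v) ->
  exists2 s, itv_partition a b s & consecutive Q a s.
Proof.
move=> ab hQ; suff : forall t, a <= t -> t <= b ->
    exists2 s, itv_partition a t s & consecutive Q a s by apply.
apply: real_ind => //; first by exists [::].
- move=> t at_ tb [s ps cs]; have [d d0 hd] := hQ t at_ (ltW tb).
  exists d => // u tu ud ub; exists (rcons s u); first exact: partition_rcons tu.
  apply: consecutive_rcons => //; have [_ /eqP ->] := ps; apply: hd => //.
  + exact: ltW.
  + by rewrite subrr normr0.
  + by rewrite gtr0_norm ?subr_gt0// ltrBlDl.
- move=> t at_ tb IH; have [d d0 hd] := hQ t (ltW at_) tb.
  pose u := Num.max a (t - d / 2).
  have [au ut tu] : [/\ a <= u, u < t & t - u < d].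
    rewrite /u le_max lexx gt_max at_ ltrBlDr ltrDl divr_gt0//; split=> //.
    have : t - d / 2 <= Num.max a (t - d / 2) by rewrite le_max lexx orbT.
    by clear -d0; lra.
  have [s ps cs] := IH u au ut; exists (rcons s t); first exact: partition_rcons ut.
  apply: consecutive_rcons => //; have [_ /eqP ->] := ps; apply: hd => //.
  + exact: ltW.
  + by rewrite distrC gtr0_norm ?subr_gt0.
  + by rewrite subrr normr0.
Qed.

End Partitions.

Section Curves.
Context {R : realType} {X : metricType R}.
Implicit Types (S : causal_data R X) (g : R -> X) (a b : R).

Lemma lipschitz_continuous a b g : a <= b -> locally_lipschitz `[a, b] g ->
  continuous (fun t => g (clamp a b t)).
Proof.
move=> ab lg t; have [ta tb] := clamp_in t ab.
have [|k [V nV hV]] := lg (clamp a b t); first by rewrite /= in_itv /= ta tb.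
apply/metricType_numDomainType.cvgrPdist_lt => e e0.
pose k' := Num.max k 1; have k'0 : 0 < k' by rewrite lt_max ltr01 orbT.
near=> u; have [ua ub] := clamp_in u ab.
apply: (@le_lt_trans _ _ (k * `|clamp a b t - clamp a b u|)).
  apply: hV => //=; rewrite ?in_itv /= ?ta ?tb ?ua ?ub//; first exact: nbhs_singleton.
  by near: u; exact: continuous_clamp.
apply: (@le_lt_trans _ _ (k' * `|t - u|)).
  apply: le_trans (ler_wpM2l (ltW k'0) (clamp_dist a b t u)).
  by rewrite ler_wpM2r// le_max lexx.
rewrite -ltr_pdivlMl// distrC; near: u; apply: near_dist.
by rewrite mulr_gt0// invr_gt0.
Unshelve. all: by end_near. Qed.

End Curves.

Section CurveBasics.
Context {R : realType} {X : metricType R} (S : causal_data R X).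
Implicit Types (x y z p q : X) (g h : R -> X) (a b : R).

Lemma in_cc a b (t : R) : [set` `[a, b]] t = (a <= t /\ t <= b) :> Prop.
Proof. by rewrite /= in_itv /=; apply/propext; split=> [/andP[]|[-> ->]]. Qed.

Lemma curve_lt a b g : curve `[a, b] g -> a < b.
Proof.
move=> [_ [r [s []]]]; rewrite !in_cc => -[ar rb] [as_ sb] grs _.
rewrite lt_neqAle (le_trans ar rb) andbT; apply/eqP => ab; apply: grs.
by congr g; apply/le_anti; rewrite (le_trans rb) -?ab//= (le_trans sb) -?ab.
Qed.

Lemma lipschitz_mdist_le (k : R) g r s : mdist (g r) (g s) <= k * `|r - s| ->
  mdist (g r) (g s) <= Num.max k 0 * `|r - s|.
Proof.
by move=> h; apply: le_trans h _; rewrite ler_wpM2r// le_max lexx.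
Qed.

Lemma locally_lipschitz_comp (D E : set R) g (f : R -> R) (k : R) :
  locally_lipschitz D g -> (forall t, E t -> D (f t)) ->
  (forall s t, E s -> E t -> `|f s - f t| <= k * `|s - t|) ->
  locally_lipschitz E (fun t => g (f t)).
Proof.
move=> lg ED fk t Et; have [c [V nV hV]] := lg (f t) (ED t Et).
have /near_distP[e e0 he] := nV.
pose k' := Num.max k 1; have k'0 : 0 < k' by rewrite lt_max ltr01 orbT.
have fk' s u : E s -> E u -> `|f s - f u| <= k' * `|s - u|.
  by move=> Es Eu; apply: le_trans (fk s u Es Eu) _; rewrite ler_wpM2r// le_max lexx.
exists (Num.max c 0 * k'), [set u | `|u - t| < e / k'].
  by apply: near_dist; rewrite divr_gt0.
have inV u : `|u - t| < e / k' -> E u -> V (f u).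
  move=> ut Eu; apply: he; apply: le_lt_trans (fk' u t Eu Et) _.
  by rewrite mulrC -ltr_pdivlMr.
move=> r s /= rt Er st Es; rewrite -mulrA.
apply: (@le_trans _ _ (Num.max c 0 * `|f r - f s|)).
  by apply: lipschitz_mdist_le; apply: hV; [exact: inV|exact: ED|exact: inV|exact: ED].
by rewrite ler_wpM2l ?le_max ?lexx ?orbT//; exact: fk'.
Qed.

Lemma locally_lipschitz_sub (D E : set R) g : E `<=` D ->
  locally_lipschitz D g -> locally_lipschitz E g.
Proof.
move=> ED lg; apply: (@locally_lipschitz_comp D E g id 1 lg) => [t /ED//|s t _ _].
by rewrite mul1r.
Qed.

(** Mean value theorem; it makes the oscillating parameter in [cle_anti] Lipschitz. *)
Lemma cos_dist (s t : R) : `|cos s - cos t| <= `|s - t|.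
Proof.
wlog st : s t / s <= t.
  move=> h; have [st|ts] := leP s t; first exact: h.
  by rewrite distrC (distrC s); apply: h; exact: ltW.
rewrite distrC (distrC s).
have [|c _ ->] := @MVT_segment R cos (fun w : R => - sin w) s t st (fun w _ => is_derive_cos w).
  by apply: continuous_subspaceT => w; exact: continuous_cos.
rewrite normrM normrN ler_piMl//.
by apply/ler_normlP; split; [have := sin_geN1 c; lra|exact: sin_le1].
Qed.

End CurveBasics.

(** * Antisymmetry and closedness of the causal order *)

Section OrderFromCurves.
Context {R : realType} {X : metricType R} (S : causal_data R X).
Context (hX : lorentzian_length_space S) (hgh : globally_hyperbolic S).
Implicit Types (x y z p q : X) (g h : R -> X) (a b : R).

Lemma cle_refl x : cle S x x.
Proof. by have [[[h _] _ _ _ _] _ _ _ _] := hX; exact: h. Qed.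

Lemma cle_trans x y z : cle S x y -> cle S y z -> cle S x z.
Proof. by have [[[_ h] _ _ _ _] _ _ _ _] := hX; exact: h. Qed.

Lemma cll_le x y : cll S x y -> cle S x y.
Proof. by have [[_ [_ h] _ _ _] _ _ _ _] := hX; exact: h. Qed.

Lemma tau_ge0 x y : (0 <= tau S x y)%E.
Proof. by have [[_ _ [h _] _ _] _ _ _ _] := hX; exact: h. Qed.

Lemma tau_tri x y z : cle S x y -> cle S y z ->
  (tau S x y + tau S y z <= tau S x z)%E.
Proof. by have [[_ _ _ h _] _ _ _ _] := hX; exact: h. Qed.

Lemma tau_pos x y : (0 < tau S x y)%E <-> cll S x y.
Proof. by have [[_ _ _ _ h] _ _ _ _] := hX; exact: h. Qed.

Lemma cll_open p q : cll S p q -> \forall z \near (p, q), cll S z.1 z.2.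
Proof.
have [[_ _ [_ h] _ _] _ _ _ _] := hX => /tau_pos pq.
have [V nV hV] := h (p, q) 0 pq.
have nV' : nbhs (p, q) V.
  have e : @setT X `*` @setT X = setT by apply/seteqP; split.
  by move: nV; rewrite e nbhs_subspaceT.
by apply: filterS nV' => z /hV /tau_pos.
Qed.

Lemma cll_cle_trans x y z : cll S x y -> cle S y z -> cll S x z.
Proof.
move=> xy yz; apply/tau_pos; apply: lt_le_trans (tau_tri (cll_le xy) yz).
by rewrite -[ltLHS](adde0) lte_leD// ?tau_ge0//; apply/tau_pos.
Qed.

Lemma causal_le a b g : future_causal S `[a, b] g -> forall s t, a <= s -> s <= t ->
  t <= b -> cle S (g s) (g t).
Proof.
move=> [_ h] s t as_; rewrite le_eqVlt => /predU1P[<- _|st tb]; first exact: cle_refl.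
by apply: h => //; rewrite in_cc; split=> //; [exact: le_trans (ltW st) tb|exact: le_trans (ltW st)].
Qed.

(* If [x <= z <= x], all points of a causal curve from [x] to [z] precede each
   other, so the curve may be run back and forth indefinitely inside the compact
   diamond of [x], with unbounded arclength. *)
Lemma cle_anti x z : cle S x z -> cle S z x -> x = z.
Proof.
move=> xz zx; apply: contrapT => nxz.
have [_ _ [_ cpc] _ _] := hX; have [a [b [g [fc ga gb]]]] := cpc x z xz nxz.
have [cg _] := fc; have ab := curve_lt cg; have [_ _ lg] := cg.
(* A Lipschitz oscillation over [[a, b]], with value [a] at even and [b] at odd multiples of [pi];
   each half period adds at least [mdist x z] to the arclength. *)
pose w (t : R) := a + (b - a) * ((1 - cos t) / 2).
have wab t : a <= w t /\ w t <= b.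
  have := cos_le1 t; have := cos_geN1 t => c1 c2.
  have : 0 <= (b - a) * ((1 - cos t) / 2) by apply: mulr_ge0; lra.
  have : 0 <= (b - a) * ((1 + cos t) / 2) by apply: mulr_ge0; lra.
  by rewrite /w; lra.
pose h t := g (w t).
have hle s t : cle S (h s) (h t).
  have [s1 s2] := wab s; have [t1 t2] := wab t.
  apply: (@cle_trans _ z); first by rewrite -gb; exact: (causal_le fc).
  by apply: (cle_trans zx); rewrite -ga; exact: (causal_le fc).
have w0 : w 0 = a by rewrite /w cos0 subrr mul0r mulr0 addr0.
have wpi : w pi = b by rewrite /w cospi; lra.
have ch : causal_curve S setT h.
  left; split; last by move=> *; exact: hle.
  split.
  - by move=> *; exact.
  - by exists 0, pi; rewrite /h w0 wpi ga gb.
  - apply: (@locally_lipschitz_comp _ _ _ _ _ w ((b - a) / 2) lg).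
      by move=> t _; rewrite in_cc.
    move=> s t _ _; rewrite /w.
    have -> : a + (b - a) * ((1 - cos s) / 2) - (a + (b - a) * ((1 - cos t) / 2)) =
       (b - a) / 2 * (cos t - cos s) by field.
    rewrite normrM ger0_norm ?divr_ge0 ?subr_ge0 ?(ltW ab)//.
    by rewrite ler_wpM2l ?divr_ge0 ?subr_ge0 ?(ltW ab)// distrC cos_dist.
have hK : contained setT h (diamond S x x).
  move=> _ [t _ <-]; have [t1 t2] := wab t; split.
    by rewrite -ga; exact: (causal_le fc).
  by apply: (cle_trans _ zx); rewrite -gb; exact: (causal_le fc).
have [cK arc] := hgh; have [C hC] := arc _ (cK x x).
have := hC setT h ch hK; apply/negP; rewrite -ltNge.
have d0 : 0 < mdist x z by rewrite mdist_gt0; apply/eqP.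
have hk (k : nat) : mdist (h (k%:R * pi)) (h (k.+1%:R * pi)) = mdist x z.
  have e (j : nat) : w (j%:R * pi) = if odd j then b else a.
    elim: j => [|j ih]; first by rewrite mul0r w0.
    have -> : w (j.+1%:R * pi) = a + b - w (j%:R * pi).
      have -> : j.+1%:R * pi = j%:R * pi + pi :> R by rewrite -natr1; ring.
      by rewrite /w cosDpi; lra.
    by rewrite ih /=; case: (odd j) => /=; lra.
  rewrite /h !e /=; case: (odd k) => /=; rewrite ga gb//.
  by rewrite metric_sym.
have sums n : forall k : nat, exists2 s, itv_partition (k%:R * pi) ((k + n)%:R * pi) s &
    partition_sum (fun p q => (mdist p q)%:E) (k%:R * pi) ((k + n)%:R * pi) h s =
    (n%:R * mdist x z)%:E.
  elim: n => [|n ih] k.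
    by exists [::]; rewrite ?addn0 ?partition_sum_nil ?mul0r//; split=> //=.
  have [s ps es] := ih k.+1; exists ((k.+1%:R * pi) :: s).
    rewrite -addSnnS; apply: partition_cons ps.
    by rewrite ltr_pM2r ?pi_gt0// ltr_nat.
  rewrite partition_sum_cons -addSnnS es hk -EFinD; congr EFin.
  by rewrite -[n.+1%:R]natr1; ring.
have [n hn] := archi_mul (C + 1) d0; have [s ps es] := sums n 0%N.
apply: (@lt_le_trans _ _ (n%:R * mdist x z)%:E).
  by rewrite lte_fin; lra.
apply: ereal_sup_ubound; exists (0%:R * pi), ((0 + n)%:R * pi), s; split=> //.
Qed.

Lemma timelike_curve x y : cll S x y -> exists a b g, [/\ a < b, continuous g, g a = x,
  g b = y & forall s t, a <= s -> s < t -> t <= b -> cll S (g s) (g t)].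
Proof.
have [_ _ [cpc _] _ _] := hX => /cpc[a [b [g [[cg gll] ga gb]]]].
have ab := curve_lt cg; have [_ _ lg] := cg.
exists a, b, (fun t => g (clamp a b t)); split=> //.
- exact: lipschitz_continuous (ltW ab) lg.
- by rewrite clamp_id// ltW.
- by rewrite clamp_id// ltW.
- move=> s t as_ st tb; rewrite !clamp_id ?(le_trans as_ (ltW st)) ?(le_trans (ltW st) tb)//.
  by apply: gll; rewrite ?in_cc//; split=> //; [exact: le_trans (ltW st) tb|exact: le_trans (ltW st)].
Qed.

(** Localizability provides some point in the timelike future, and the beginning of a timelike curve
    towards it is in [W]. *)
Lemma chron_future_near x (W : set X) : nbhs x W -> exists2 y, W y & cll S x y.
Proof.
move=> nW; have [_ _ _ loc _] := hX.
have [Om [_ Omx _ [om [_ _ hI _]]]] := loc x.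
have [[y [xy _]] _] := hI x Omx.
have [a [b [g [ab cg ga gb gll]]]] := timelike_curve xy.
have : \forall t \near a^'+, W (g t).
  by apply: (cvg_at_right_filter (cg a)); rewrite ga.
move=> nWg; near a^'+ => t; exists (g t); first by near: t.
by rewrite -ga; apply: gll => //; near: t; exact: nbhs_right_le.
Unshelve. all: by end_near. Qed.

Lemma chron_past_near x (W : set X) : nbhs x W -> exists2 y, W y & cll S y x.
Proof.
move=> nW; have [_ _ _ loc _] := hX.
have [Om [_ Omx _ [om [_ _ hI _]]]] := loc x.
have [_ [y [yx _]]] := hI x Omx.
have [a [b [g [ab cg ga gb gll]]]] := timelike_curve yx.
have : \forall t \near b^'-, W (g t).
  by apply: (cvg_at_left_filter (cg b)); rewrite gb.
move=> nWg; near b^'- => t; exists (g t); first by near: t.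
by rewrite -gb; apply: gll => //; near: t; exact: nbhs_left_ge.
Unshelve. all: by end_near. Qed.

Lemma diamond_closed p q : closed (diamond S p q).
Proof.
by apply: compact_closed; [exact: metric_hausdorff|exact: (proj1 hgh)].
Qed.

(** Openness of the timelike relation gives [pm <= qp] whenever [pm << p] and [q << qp]. Letting
    [qp] tend to [q] and then [pm] to [p] inside diamonds, which are compact and hence closed,
    yields [p <= q]. *)
Lemma cle_closed : closed [set z : X * X | cle S z.1 z.2].
Proof.
move=> [p q] clpq /=.
have near_ll pm qp : cll S pm p -> cll S q qp -> cle S pm qp.
  move=> pmp qqp.
  have n1 : \forall z \near p, cll S pm z.
    have c1 : (fun z => (pm, z)) @ p --> (pm, p).
      by apply: cvg_pair; [exact: cvg_cst|exact: cvg_id].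
    exact: (c1 _ (cll_open pmp)).
  have n2 : \forall z \near q, cll S z qp.
    have c1 : (fun z => (z, qp)) @ q --> (q, qp).
      by apply: cvg_pair; [exact: cvg_id|exact: cvg_cst].
    exact: (c1 _ (cll_open qqp)).
  have nA : nbhs (p, q) [set z | cll S pm z.1 /\ cll S z.2 qp].
    by exists ([set z | cll S pm z], [set z | cll S z qp]).
  have [z [z12 [z1 z2]]] := clpq _ nA.
  exact: cle_trans (cll_le z1) (cle_trans z12 (cll_le z2)).
have [q0 _ qq0] := chron_future_near (@filterT _ _ (nbhs_filter q)).
have [p0 _ p0p] := chron_past_near (@filterT _ _ (nbhs_filter p)).
have leq pm : cll S pm p -> cle S pm q.
  move=> pmp; suff [] : diamond S pm q0 q by [].
  apply: diamond_closed => W nW.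
  have nW' : nbhs q (W `&` [set z | cll S z q0]).
    apply: filterI => //; have c1 : (fun z => (z, q0)) @ q --> (q, q0).
      by apply: cvg_pair; [exact: cvg_id|exact: cvg_cst].
    exact: (c1 _ (cll_open qq0)).
  have [z [Wz zq0] qz] := chron_future_near nW'.
  by exists z; split=> //; split; [exact: near_ll|exact: cll_le].
suff [] : diamond S p0 q p by [].
apply: diamond_closed => W nW.
have nW' : nbhs p (W `&` [set z | cll S p0 z]).
  apply: filterI => //; have c1 : (fun z => (p0, z)) @ p --> (p0, p).
    by apply: cvg_pair; [exact: cvg_cst|exact: cvg_id].
  exact: (c1 _ (cll_open p0p)).
have [z [Wz p0z] zp] := chron_past_near nW'.
by exists z; split=> //; split; [exact: cll_le|exact: leq].
Qed.

(** By antisymmetry a timelike curve from [x] to [x] would be constant, which curves are not. *)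
Lemma cll_irr x : ~ cll S x x.
Proof.
move=> xx; have [a [b [g [ab cg ga gb gll]]]] := timelike_curve xx.
have [_ _ [cpc _] _ _] := hX; have [a' [b' [g' [[cg' gll'] ga' gb']]]] := cpc x x xx.
have ab' := curve_lt cg'; have [_ [r [s [Dr Ds ne]]] _] := cg'.
have fc : future_causal S `[a', b'] g'.
  by split=> // u v Du Dv uv; apply: cll_le; exact: gll'.
have all_x t : [set` `[a', b']] t -> g' t = x.
  rewrite in_cc => -[at_ tb]; apply: cle_anti.
    by rewrite -gb'; apply: (causal_le fc).
  by rewrite -ga'; apply: (causal_le fc).
by apply: ne; rewrite !all_x.
Qed.

Lemma tau_xx x : tau S x x = 0%E.
Proof.
apply/eqP; rewrite eq_le tau_ge0 andbT leNgt; apply/negP => /tau_pos; exact: cll_irr.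
Qed.

End OrderFromCurves.

Section Inverse.
Context {R : realType}.

(** The inverse is extended by constants through clamping of its argument, which makes it continuous
    and monotone on the whole line. *)
Lemma increasing_inverse (f : R -> R) (a b : R) : a < b -> continuous f ->
  (forall s t, a <= s -> s < t -> t <= b -> f s < f t) ->
  exists k : R -> R, [/\ continuous k, {homo k : r s / r <= s},
    forall r, a <= k r /\ k r <= b,
    forall r, f a <= r -> r <= f b -> f (k r) = r &
    forall t, a <= t -> t <= b -> k (f t) = t].
Proof.
move=> ab cf inc; have fab : f a < f b by apply: inc.
have inc_le s t : a <= s -> s <= t -> t <= b -> f s <= f t.
  move=> as_; rewrite le_eqVlt => /predU1P[-> //|st] tb.
  by apply: ltW; exact: inc.
have /choice[k0 hk0] : forall r, exists t, [/\ a <= t, t <= b & f t = clamp (f a) (f b) r].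
  move=> r; have [r1 r2] := clamp_in r (ltW fab).
  have cf' : {within `[a, b], continuous f} by exact: continuous_subspaceT.
  have hr : Num.min (f a) (f b) <= clamp (f a) (f b) r <= Num.max (f a) (f b).
    by apply/andP; split; [rewrite ge_min r1|rewrite le_max r2 orbT].
  have [t + ft] := IVT (ltW ab) cf' hr.
  by rewrite in_itv /= => /andP[at_ tb]; exists t.
have homok r s : r <= s -> k0 r <= k0 s.
  move=> rs; rewrite leNgt; apply/negP => ksr.
  have [r1 r2 r3] := hk0 r; have [s1 s2 s3] := hk0 s.
  have := inc _ _ s1 ksr r2; rewrite r3 s3 ltNge => /negP; apply.
  exact: clamp_homo.
have kf t : a <= t -> t <= b -> k0 (f t) = t.
  move=> at_ tb; have [t1 t2] := hk0 (f t).
  rewrite clamp_id ?inc_le// => e; apply/le_anti; apply/andP; split; rewrite leNgt; apply/negP => lt.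
    by have := inc _ _ at_ lt t2; rewrite e ltxx.
  by have := inc _ _ t1 lt tb; rewrite e ltxx.
have fk r : f a <= r -> r <= f b -> f (k0 r) = r.
  by move=> r1 r2; have [_ _ ->] := hk0 r; rewrite clamp_id.
exists k0; split=> //; last by move=> r; have [? ?] := hk0 r.
move=> r; apply/cvgrPdist_lt => e e0.
have [k1 k2 k3] := hk0 r.
have left : \forall u \near r, k0 r - e < k0 u.
  have [ka|ak] := ltP (k0 r - e) a.
    by near=> u; have [u1 _ _] := hk0 u; exact: lt_le_trans u1.
  have lt : f (k0 r - e) < clamp (f a) (f b) r.
    by rewrite -k3; apply: inc => //; rewrite gtrDl oppr_lt0.
  near=> u; rewrite ltNge; apply/negP => ku.
  have [u1 u2 u3] := hk0 u.
  have := inc_le _ _ u1 ku (le_trans (ltW _) k2).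
  rewrite gtrDl oppr_lt0 => /(_ e0); rewrite u3; apply/negP; rewrite -ltNge.
  near: u; have := @continuous_clamp R (f a) (f b) r => c1.
  exact: (cvgr_gt _ c1 _ lt).
have right : \forall u \near r, k0 u < k0 r + e.
  have [kb|bk] := ltP b (k0 r + e).
    by near=> u; have [_ u2 _] := hk0 u; exact: le_lt_trans u2 kb.
  have lt : clamp (f a) (f b) r < f (k0 r + e).
    by rewrite -k3; apply: inc => //; rewrite ltrDl.
  near=> u; rewrite ltNge; apply/negP => ku.
  have [u1 u2 u3] := hk0 u.
  have := inc_le _ _ (le_trans k1 (ltW _)) ku u2.
  rewrite ltrDl => /(_ e0); rewrite u3; apply/negP; rewrite -ltNge.
  near: u; have := @continuous_clamp R (f a) (f b) r => c1.
  exact: (cvgr_lt _ c1 _ lt).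
near=> u; apply/ltr_normlP; split.
  by rewrite opprB ltrBlDr addrC; near: u.
by rewrite ltrBlDr -ltrBlDl; near: u.
Unshelve. all: by end_near. Qed.

End Inverse.

(** * Lengths and calibrations *)

Section Lengths.
Context {R : realType} {X : metricType R} (S : causal_data R X).
Context (hX : lorentzian_length_space S) (hgh : globally_hyperbolic S).
Implicit Types (x y z p q m : X) (g h : R -> X) (a b : R).

Lemma curve_length_le g a b s : itv_partition a b s ->
  (curve_length S a b g <= partition_sum (tau S) a b g s)%E.
Proof. by move=> ps; apply: ereal_inf_lbound; exists s. Qed.

Lemma partition_exists a b : a <= b -> exists s : seq R, itv_partition a b s.
Proof.
rewrite le_eqVlt => /predU1P[->|ab]; first by exists [::]; split=> /=.
by exists [:: b]; exact: itv_partition1.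
Qed.

Lemma curve_length_exact g a b (phi : R -> R) : a <= b ->
  (forall u v, a <= u -> u <= v -> v <= b -> tau S (g u) (g v) = (phi v - phi u)%:E) ->
  curve_length S a b g = (phi b - phi a)%:E.
Proof.
move=> ab h; apply/le_anti/andP; split.
  have [s ps] := partition_exists ab.
  by apply: le_trans (curve_length_le g ps) _; rewrite (partition_exact ps h).
by apply: le_ereal_inf_tmp => _ [s ps <-]; rewrite (partition_exact ps h).
Qed.

(** The length is at most the sum over the partition by [u] and [v], which is at most
    [tau (g a) (g b)]. Equality makes [tau] additive along [g], and finiteness permits the
    subtraction. *)
Lemma maximizer_calibrated g a b : maximizer S a b g ->
  tau S (g a) (g b) \is a fin_num ->
  forall u v, a <= u -> u <= v -> v <= b ->
    tau S (g u) (g v) = (tr S (g a) (g v) - tr S (g a) (g u))%:E.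
Proof.
move=> [fg len] fin.
have cg := causal_le hX fg.
have xx z : tau S z z = 0%E by exact: tau_xx.
have key u v : a <= u -> u <= v -> v <= b ->
    (tau S (g a) (g b) = tau S (g a) (g u) + tau S (g u) (g v) + tau S (g v) (g b))%E.
  move=> au uv vb; have ub := le_trans uv vb; have av := le_trans au uv.
  apply/le_anti/andP; split.
    have p0 : itv_partition b b [::] by split=> /=.
    have [s1 p1 e1] := @partition_step _ _ (tau S) v b g b _ (xx _) vb p0.
    have [s2 p2 e2] := @partition_step _ _ (tau S) u b g v _ (xx _) uv p1.
    have [s3 p3 e3] := @partition_step _ _ (tau S) a b g u _ (xx _) au p2.
    rewrite -len; apply: le_trans (curve_length_le g p3) _.
    by rewrite e3 e2 e1 partition_sum_nil adde0 addeA.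
  apply: le_trans (tau_tri hX (cg a v (lexx _) av vb) (cg v b av vb (lexx _))).
  by apply: leeD2r; apply: (tau_tri hX); apply: cg.
have finl u : a <= u -> u <= b -> tau S (g a) (g u) \is a fin_num /\ tau S (g u) (g b) \is a fin_num.
  move=> au ub; have := key u u au (lexx _) ub; rewrite xx adde0 => e.
  move: fin; rewrite e.
  have := tau_ge0 hX (g a) (g u); have := tau_ge0 hX (g u) (g b).
  by case: (tau S (g a) (g u)) => [r||]; case: (tau S (g u) (g b)) => [r'||].
move=> u v au uv vb; have ub := le_trans uv vb; have av := le_trans au uv.
have e1 := key u v au uv vb; have e2 := key v v av (lexx _) vb; rewrite xx adde0 in e2.
have [f1 _] := finl u au ub; have [f2 f3] := finl v av vb.
move: e1; rewrite e2 /tr.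
have := tau_ge0 hX (g u) (g v); move: f1 f2 f3.
case: (tau S (g a) (g u)) => [r1||] //; case: (tau S (g a) (g v)) => [r2||] //.
case: (tau S (g v) (g b)) => [r3||] //; case: (tau S (g u) (g v)) => [r4||] //= _ _ _ _.
by rewrite -!EFinD => -[e]; congr EFin; lra.
Qed.

(** The lower bounds on [[a, u]], [[u, v]] and [[v, b]] already add up to the total separation, so
    the reverse triangle inequality leaves no slack in any of them. *)
Lemma calibration_exact g a b (phi : R -> R) : a <= b ->
  (forall u v, a <= u -> u <= v -> v <= b -> cle S (g u) (g v)) ->
  (forall u v, a <= u -> u <= v -> v <= b -> ((phi v - phi u)%:E <= tau S (g u) (g v))%E) ->
  tau S (g a) (g b) = (phi b - phi a)%:E ->
  forall u v, a <= u -> u <= v -> v <= b -> tau S (g u) (g v) = (phi v - phi u)%:E.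
Proof.
move=> ab cg low e u v au uv vb; have ub := le_trans uv vb; have av := le_trans au uv.
have t1 : (tau S (g a) (g u) + tau S (g u) (g v) + tau S (g v) (g b) <= tau S (g a) (g b))%E.
  apply: le_trans (tau_tri hX (cg a v (lexx _) av vb) (cg v b av vb (lexx _))).
  by apply: leeD2r; apply: (tau_tri hX); apply: cg.
have := low a u (lexx _) au ub; have := low u v au uv vb; have := low v b av vb (lexx _).
move: t1; rewrite e.
case: (tau S (g a) (g u)) => [r1||] //; case: (tau S (g u) (g v)) => [r2||] //;
  case: (tau S (g v) (g b)) => [r3||] //.
rewrite -!EFinD !lee_fin => h1 h2 h3 h4; congr EFin; apply/le_anti; rewrite h3 andbT; lra.
Qed.

End Lengths.

Section Glue.
Context {R : realType} {X : metricType R}.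
Implicit Types (g h : R -> X) (a b c : R).

Definition glue (b : R) (g1 g2 : R -> X) (t : R) := if t <= b then g1 t else g2 t.

Lemma glue_left b g1 g2 t : t <= b -> glue b g1 g2 t = g1 t.
Proof. by rewrite /glue => ->. Qed.

Lemma glue_right b g1 g2 t : g1 b = g2 b -> b <= t -> glue b g1 g2 t = g2 t.
Proof.
move=> e bt; rewrite /glue; case: ifPn => // tb.
by have -> : t = b by apply/le_anti; rewrite tb.
Qed.

(** Both pieces, clamped, are locally Lipschitz on [[a, c]], and a distance along the glued curve is
    at most the sum of the two clamped distances, by way of the junction point. *)
Lemma curve_glue a b c g1 g2 : curve `[a, b] g1 -> curve `[b, c] g2 -> g1 b = g2 b ->
  curve `[a, c] (glue b g1 g2).
Proof.
move=> c1 c2 e; have ab := curve_lt c1; have bc := curve_lt c2.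
have [_ [r [s [Dr Ds ne]]] l1] := c1; have [_ _ l2] := c2.
split; first exact: interval_is_interval.
  move: Dr Ds; rewrite !in_cc => -[ar rb] [as_ sb].
  exists r, s; rewrite !in_cc !glue_left//; split=> //; split=> //.
    exact: le_trans rb (ltW bc).
  exact: le_trans sb (ltW bc).
have L1 : locally_lipschitz `[a, c] (fun t => g1 (clamp a b t)).
  apply: (@locally_lipschitz_comp _ _ _ _ _ (clamp a b) 1 l1).
    by move=> t _; rewrite in_cc; exact: clamp_in (ltW ab).
  by move=> s' t' _ _; rewrite mul1r clamp_dist.
have L2 : locally_lipschitz `[a, c] (fun t => g2 (clamp b c t)).
  apply: (@locally_lipschitz_comp _ _ _ _ _ (clamp b c) 1 l2).
    by move=> t _; rewrite in_cc; exact: clamp_in (ltW bc).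
  by move=> s' t' _ _; rewrite mul1r clamp_dist.
move=> t Dt; have [k1 [V1 nV1 h1]] := L1 t Dt; have [k2 [V2 nV2 h2]] := L2 t Dt.
exists (k1 + k2), (V1 `&` V2); first exact: filterI.
move=> u v [V1u V2u] Du [V1v V2v] Dv; rewrite mulrDl.
apply: le_trans (lerD (h1 _ _ V1u Du V1v Dv) (h2 _ _ V2u Du V2v Dv)).
move: Du Dv; rewrite !in_cc => -[au uc] [av vc].
have lb t' : a <= t' -> t' <= b -> clamp a b t' = t' /\ clamp b c t' = b.
  move=> at_ tb; rewrite clamp_id//; split=> //.
  by rewrite /clamp (min_idPl (le_trans tb (ltW bc))) (max_idPl tb).
have rb' t' : b <= t' -> t' <= c -> clamp a b t' = b /\ clamp b c t' = t'.
  move=> bt tc; rewrite (clamp_id bt tc); split=> //.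
  by rewrite /clamp (min_idPr bt) (max_idPr (ltW ab)).
have [ub|bu] := leP u b; have [vb|bv] := leP v b.
- have [-> ->] := lb u au ub; have [-> ->] := lb v av vb.
  by rewrite !glue_left// mdistxx addr0.
- have [-> ->] := lb u au ub; have [-> ->] := rb' v (ltW bv) vc.
  rewrite glue_left// glue_right ?(ltW bv)// -e; exact: metric_triangle.
- have [-> ->] := rb' u (ltW bu) uc; have [-> ->] := lb v av vb.
  rewrite glue_right ?(ltW bu)// glue_left// -e addrC; exact: metric_triangle.
- have [-> ->] := rb' u (ltW bu) uc; have [-> ->] := rb' v (ltW bv) vc.
  by rewrite (glue_right e (ltW bu)) (glue_right e (ltW bv)) mdistxx add0r.
Qed.

Lemma glue_rel (r : X -> X -> Prop) a b c g1 g2 : (forall x y z, r x y -> r y z -> r x z) ->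
  a < b -> b < c -> g1 b = g2 b ->
  (forall s t, [set` `[a, b]] s -> [set` `[a, b]] t -> s < t -> r (g1 s) (g1 t)) ->
  (forall s t, [set` `[b, c]] s -> [set` `[b, c]] t -> s < t -> r (g2 s) (g2 t)) ->
  forall s t, [set` `[a, c]] s -> [set` `[a, c]] t -> s < t ->
    r (glue b g1 g2 s) (glue b g1 g2 t).
Proof.
move=> tr_ ab bc e r1 r2 s t; rewrite !in_cc => -[as_ sc] [at_ tc] st.
have [tb|bt] := leP t b.
  have sb := le_trans (ltW st) tb.
  by rewrite !glue_left//; apply: r1 => //; rewrite in_cc; split.
have [sb|bs] := leP b s.
  by rewrite !glue_right ?(ltW bt)//; apply: r2 => //; rewrite in_cc; split=> //; exact: ltW.
rewrite glue_left ?(ltW bs)// glue_right ?(ltW bt)//.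
apply: (tr_ _ (g1 b)).
  by apply: r1 => //; rewrite in_cc; split=> //; exact: ltW.
by rewrite e; apply: r2 => //; rewrite in_cc; split=> //; exact: ltW.
Qed.

Lemma curve_shift a b d g : curve `[a, b] g -> curve `[a + d, b + d] (fun t => g (t - d)).
Proof.
move=> [_ [r [s [Dr Ds ne]]] lg]; split; first exact: interval_is_interval.
  move: Dr Ds; rewrite !in_cc => -[ar rb] [as_ sb].
  exists (r + d), (s + d); rewrite !in_cc !addrK !lerD2r.
  by split.
apply: (@locally_lipschitz_comp _ _ _ _ _ (fun t => t - d) 1 lg).
  by move=> t; rewrite !in_cc lerBrDr lerBlDr.
by move=> u v _ _; rewrite mul1r; have -> : u - d - (v - d) = u - v by ring.
Qed.

Lemma rel_shift (r : X -> X -> Prop) a b d g :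
  (forall s t, [set` `[a, b]] s -> [set` `[a, b]] t -> s < t -> r (g s) (g t)) ->
  forall s t, [set` `[a + d, b + d]] s -> [set` `[a + d, b + d]] t -> s < t ->
    r (g (s - d)) (g (t - d)).
Proof.
move=> h s t Ds Dt st; apply: h; last by rewrite ltrD2r.
  by move: Ds; rewrite !in_cc lerBrDr lerBlDr.
by move: Dt; rewrite !in_cc lerBrDr lerBlDr.
Qed.

End Glue.

(** * Constant speed and Lipschitz parametrizations *)

(** The second half of [cs_timelike_maximizer], split off because [lin] already accounts for
    constant speed. *)
Definition timelike_param {R : realType} {X : metricType R} (S : causal_data R X)
    (c : R -> X) : Prop := exists a b h,
  [/\ future_timelike S `[a, b] h, maximizer S a b h & reparametrization 0 1 c a b h].

Section Through.
Context {R : realType} {X : metricType R} (S : causal_data R X).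
Context (hX : lorentzian_length_space S) (hgh : globally_hyperbolic S) (hreg : regular S).
Implicit Types (x y z p q m : X) (g h c : R -> X) (a b l : R).

Lemma timelike_causal a b h : future_timelike S `[a, b] h -> future_causal S `[a, b] h.
Proof. by move=> [ch hl]; split=> // s t Ds Dt st; apply: (cll_le hX); exact: hl. Qed.

Lemma tau_not_ll p m : ~ cll S p m -> tau S p m = 0%E.
Proof.
move=> nll; apply/eqP; rewrite eq_le (tau_ge0 hX) andbT leNgt.
by apply/negP => /(tau_pos hX).
Qed.

Lemma exact_maximizer g a b (phi : R -> R) : future_causal S `[a, b] g ->
  (forall u v, a <= u -> u <= v -> v <= b -> tau S (g u) (g v) = (phi v - phi u)%:E) ->
  maximizer S a b g.
Proof.
move=> fg h; have ab := ltW (curve_lt (proj1 fg)); split=> //.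
by rewrite (curve_length_exact ab h) h.
Qed.

Lemma timelike_param_sub (c : R -> X) l : lin S c l -> 0 < l -> timelike_param S c ->
  forall u v : R, 0 <= u -> u < v -> v <= 1 ->
  timelike_param S (fun t => c (u + t * (v - u))).
Proof.
move=> lc l0 [a [b [h [th mh [f [cf mf fa fb ch]]]]]] u v u0 uv v1.
have [cv hl] := th; have [_ _ lh] := cv; have ab := curve_lt cv.
have in01 (t : R) : 0 <= t -> t <= 1 -> t \in `[0, 1] by move=> ? ?; rewrite in_itv /=; apply/andP.
have u1 : u <= 1 by exact: le_trans (ltW uv) v1.
have v0 : 0 <= v by exact: le_trans u0 (ltW uv).
have fin01 (t : R) : 0 <= t -> t <= 1 -> a <= f t /\ f t <= b.
  by move=> t0 t1; rewrite -fa -fb; split; apply: mf => //; exact: in01.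
have [fu1 fu2] := fin01 u u0 u1; have [fv1 fv2] := fin01 v v0 v1.
have fuv : f u < f v.
  rewrite lt_neqAle (mf u v (in01 u u0 u1) (in01 v v0 v1) (ltW uv)) andbT.
  apply/eqP => e; have := lc u v u0 (ltW uv) v1.
  rewrite !ch ?in01// e (tau_xx hX hgh) => -[] /esym/eqP.
  by rewrite mulf_eq0 gt_eqF//= subr_eq0 gt_eqF.
have hll s t : a <= s -> s < t -> t <= b -> cll S (h s) (h t).
  move=> as_ st tb; apply: hl; rewrite ?in_cc//; split=> //.
    exact: le_trans (ltW st) tb.
  exact: le_trans as_ (ltW st).
have sub : [set` `[f u, f v]] `<=` [set` `[a, b]].
  by move=> t; rewrite !in_cc => -[? ?]; split; [apply: le_trans fu1 _|exact: le_trans fv2].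
have tsub : future_timelike S `[f u, f v] h.
  split; last by move=> s t Ds Dt; apply: hl; exact: sub.
  split; [exact: interval_is_interval| |exact: locally_lipschitz_sub sub lh].
  exists (f u), (f v); rewrite !in_cc !lexx (ltW fuv); split=> // e.
  by apply: (cll_irr hX hgh (x := h (f u))); rewrite {2}e; exact: hll.
have fin : tau S (h a) (h b) \is a fin_num.
  by rewrite -fa -fb -!ch ?in01// lc// lexx.
exists (f u), (f v), h; split=> //.
  apply: (exact_maximizer (phi := fun t => tr S (h a) (h t)) (timelike_causal tsub)) => s t us st tv.
  apply: (maximizer_calibrated hX hgh mh) => //.
    exact: (le_trans fu1 us).
  exact: le_trans fv2.
have uvin (t : R) : 0 <= t -> t <= 1 -> 0 <= u + t * (v - u) /\ u + t * (v - u) <= 1.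
  move=> t0 t1; split; first by rewrite addr_ge0// mulr_ge0// subr_ge0 ltW.
  have : t * (v - u) <= v - u by rewrite ger_pMl// subr_gt0.
  lra.
exists (fun t => f (u + t * (v - u))); split.
- apply/subspace_continuousP => t; rewrite in_cc => -[t0 t1].
  have [p0 p1] := uvin t t0 t1.
  have /subspace_continuousP/(_ (u + t * (v - u))) := cf.
  rewrite in_cc => /(_ (conj p0 p1)) cft.
  have cg : (fun t => u + t * (v - u)) @ t --> u + t * (v - u).
    by apply: cvgD; [exact: cvg_cst|exact: mulrr_continuous].
  move=> W /cft nW; have nW' : nbhs t (fun r => [set` `[0, 1]] (u + r * (v - u)) ->
      W (f (u + r * (v - u)))) by exact: cg nW.
  apply: filterS nW' => r h1 /andP[r0 r1]; apply: h1.
  by rewrite in_cc; exact: uvin.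
- move=> s t; rewrite !in_itv /= => /andP[s0 s1] /andP[t0 t1] st.
  have [? ?] := uvin s s0 s1; have [? ?] := uvin t t0 t1.
  by apply: mf; rewrite ?in01// lerD2l ler_wpM2r// subr_ge0 ltW.
- by rewrite mul0r addr0.
- by rewrite mul1r subrKC.
- move=> t; rewrite in_itv /= => /andP[t0 t1]; have [? ?] := uvin t t0 t1.
  by rewrite ch// in01.
Qed.

Lemma timelike_param_ext c c' : (forall t : R, 0 <= t -> t <= 1 -> c t = c' t) ->
  timelike_param S c -> timelike_param S c'.
Proof.
move=> e [a [b [h [th mh [f [cf mf fa fb ch]]]]]]; exists a, b, h; split=> //.
exists f; split=> // t t01; rewrite -ch//.
by move: t01; rewrite in_itv /= => /andP[? ?]; rewrite e.
Qed.

Lemma lin_cs_maximizer c l : lin S c l -> timelike_param S c -> cs_timelike_maximizer S c.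
Proof.
move=> lc pc; split=> //; exists l => t; rewrite in_itv /= => /andP[t0 t1].
rewrite (curve_length_exact (phi := fun r => l * r) t0) ?mulr0 ?subr0//.
by move=> u v u0 uv vt; rewrite lc ?(le_trans vt)// mulrBr.
Qed.

(** * From comparison neighborhoods to [cmp] *)

Section Neighborhood.
Context (U0 U : set X) (cU0 : comparison_neighborhood S U0) (UU0 : U `<=` U0).
Context (Ufin : forall p q, U p -> U q -> tau S p q \is a fin_num).
Context (Ucont : forall p q, U p -> U q ->
    (fun z : X * X => tr S z.1 z.2) @ (p, q) --> tr S p q).

Let diamondL p q : cle S p q -> diamond S p q p.
Proof. by split=> //; exact: cle_refl. Qed.

Let diamondR p q : cle S p q -> diamond S p q q.
Proof. by split=> //; exact: cle_refl. Qed.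

(** For timelike related ends [phi] is the separation from [p] along the maximizer of the comparison
    neighborhood. Otherwise the separation is [0], and any causal curve with [phi = 0] will do. *)
Lemma calibrated_segment p m : diamond S p m `<=` U -> cle S p m -> p <> m ->
  exists a b g (phi : R -> R), [/\ causal_from_to S p m a b g,
    forall u v, a <= u -> u <= v -> v <= b -> ((phi v - phi u)%:E <= tau S (g u) (g v))%E &
    phi b - phi a = tr S p m].
Proof.
move=> dU pm npm; have [ll|nll] := pselect (cll S p m).
  have Up := dU _ (diamondL pm); have Um := dU _ (diamondR pm).
  have [_ hex _] := cU0.
  have [a [b [g [cg cont len]]]] := hex p m (UU0 Up) (UU0 Um) ll.
  have [fg ga gb] := cg.
  have mx : maximizer S a b g by split=> //; rewrite len ga gb.
  exists a, b, g, (fun t => tr S p (g t)); split=> //.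
    move=> u v au uv vb; rewrite (maximizer_calibrated hX hgh mx) ?ga ?gb//.
    exact: Ufin.
  by rewrite ga gb /tr (tau_xx hX hgh) subr0.
have [_ _ [_ cpc] _ _] := hX; have [a [b [g cg]]] := cpc p m pm npm.
exists a, b, g, (fun=> 0); split=> //; last by rewrite /tr tau_not_ll// subrr.
by move=> *; rewrite subrr; exact: tau_ge0.
Qed.

(** Two calibrated segments are concatenated at [m], and the reverse triangle inequality gives the
    lower bound across the junction. The cases [m = p] and [m = q] are separate because a constant
    piece is not a curve. *)
Lemma calibrated_through p m q : cll S p q -> diamond S p q `<=` U -> cle S p m ->
  cle S m q -> tr S p m + tr S m q = tr S p q ->
  exists a b g (phi : R -> R) t, [/\ causal_from_to S p q a b g,
    forall u v, a <= u -> u <= v -> v <= b -> ((phi v - phi u)%:E <= tau S (g u) (g v))%E,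
    phi b - phi a = tr S p q, a <= t /\ t <= b & g t = m].
Proof.
move=> pq dU pm mq e.
have npq : p <> q by move=> epq; apply: (cll_irr hX hgh (x := p)); rewrite {2}epq.
have [epm|npm] := pselect (p = m).
  have [a [b [g [phi [cg low ephi]]]]] := calibrated_segment dU (cll_le hX pq) npq.
  have [fg ga gb] := cg.
  exists a, b, g, phi, a; split=> //; last by rewrite ga.
  by split=> //; apply: ltW; exact: curve_lt (proj1 fg).
have [emq|nmq] := pselect (m = q).
  have [a [b [g [phi [cg low ephi]]]]] := calibrated_segment dU (cll_le hX pq) npq.
  have [fg ga gb] := cg.
  exists a, b, g, phi, b; split=> //; last by rewrite gb.
  by split=> //; apply: ltW; exact: curve_lt (proj1 fg).
have d1 : diamond S p m `<=` U.
  by move=> z [pz zm]; apply: dU; split=> //; exact: (cle_trans hX) zm mq.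
have d2 : diamond S m q `<=` U.
  by move=> z [mz zq]; apply: dU; split=> //; exact: (cle_trans hX) pm mz.
have [a1 [b1 [g1 [phi1 [[fg1 g1a g1b] low1 e1]]]]] := calibrated_segment d1 pm npm.
have [a2 [b2 [g2 [phi2 [[fg2 g2a g2b] low2 e2]]]]] := calibrated_segment d2 mq nmq.
have [cg1 rg1] := fg1; have [cg2 rg2] := fg2.
have ab1 := curve_lt cg1; have ab2 := curve_lt cg2.
pose d := b1 - a2; pose g2' t := g2 (t - d).
have ad : a2 + d = b1 by rewrite /d subrKC.
have cg2' : curve `[b1, b2 + d] g2' by rewrite -ad; exact: curve_shift.
have bd : b1 < b2 + d by exact: curve_lt cg2'.
have eg : g1 b1 = g2' b1 by rewrite /g2' -[X in X - d]ad addrK g1b g2a.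
pose g := glue b1 g1 g2'.
pose phi t := if t <= b1 then phi1 t else phi2 (t - d) - phi2 a2 + phi1 b1.
have low2' u v : b1 <= u -> u <= v -> v <= b2 + d ->
    ((phi2 (v - d) - phi2 (u - d))%:E <= tau S (g2' u) (g2' v))%E.
  by move=> bu uv vb; apply: low2; rewrite -?ad ?lerBrDr ?lerBlDr ?ad ?lerD2r// subrK.
have fg : future_causal S `[a1, b2 + d] g.
  split; first exact: curve_glue.
  apply: (glue_rel (cle_trans hX) ab1 bd eg rg1).
  by rewrite -ad; exact: (rel_shift rg2).
exists a1, (b2 + d), g, phi, b1; split.
- split=> //; first by rewrite /g glue_left// ltW.
  by rewrite /g glue_right ?(ltW bd)// /g2' addrK.
- move=> u v au uv vb; rewrite /phi /g.
  have [vb1|b1v] := leP v b1.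
    have ub1 := le_trans uv vb1.
    by rewrite ub1 !glue_left//; exact: low1.
  rewrite [X in tau S _ X](glue_right eg (ltW b1v)).
  have [ub1|b1u] := leP u b1; last first.
    rewrite (glue_right eg (ltW b1u)).
    apply: le_trans (low2' u v (ltW b1u) uv vb); rewrite lee_fin.
    lra.
  rewrite glue_left//.
  have le1 : cle S (g1 u) (g1 b1) by exact: (causal_le hX fg1).
  have le2 : cle S (g1 b1) (g2' v).
    have := causal_le hX fg (ltW ab1) (ltW b1v) vb.
    by rewrite /g (glue_right eg (ltW b1v)) glue_left.
  apply: le_trans (tau_tri hX le1 le2).
  have := low1 u b1 au ub1 (lexx _); have := low2' b1 v (lexx _) (ltW b1v) vb.
  rewrite -eg; have -> : b1 - d = a2 by rewrite -ad addrK.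
  move=> h2 h1; apply: le_trans (leeD h1 h2); rewrite -EFinD lee_fin.
  lra.
- rewrite /phi (ltW ab1) leNgt bd /= addrK -e -e1 -e2; lra.
- by split; exact: ltW.
- by rewrite /g glue_left.
Qed.

(** The calibrated curve through [m] is a maximizer, so regularity makes it timelike after a
    reparametrization and excludes null pieces. The separation from [p] is then a strictly
    increasing continuous function of the parameter, and its inverse gives constant speed. *)
Lemma maximizer_through p m q : cll S p q -> diamond S p q `<=` U -> cle S p m ->
  cle S m q -> tr S p m + tr S m q = tr S p q ->
  exists c, [/\ continuous c, lin S c (tr S p q), c 0 = p /\ c 1 = q,
    exists r, [/\ 0 <= r, r <= 1 & c r = m] & timelike_param S c].
Proof.
move=> pq dU pm mq e.
have [a [b [g [phi [tm [[fg ga gb] low ephi [atm tmb] gm]]]]]] :=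
  calibrated_through pq dU pm mq e.
have Up := dU _ (diamondL (cll_le hX pq)); have Uq := dU _ (diamondR (cll_le hX pq)).
have ab := curve_lt (proj1 fg).
have tpq : tau S p q = (tr S p q)%:E by rewrite /tr fineK//; exact: Ufin.
set L := tr S p q in e ephi tpq *.
have L0 : 0 < L by rewrite -lte_fin -tpq; apply/(tau_pos hX).
have ex := calibration_exact hX (ltW ab) (causal_le hX fg) low.
have {}ex : forall u v, a <= u -> u <= v -> v <= b -> tau S (g u) (g v) = (phi v - phi u)%:E.
  by apply: ex; rewrite ga gb tpq ephi.
have [a' [b' [h [th [hth [cth moth tha thb gh]]]]]] :=
  hreg pq (And3 fg ga gb) (exact_maximizer fg ex).
have in_ab t : a <= t -> t <= b -> t \in `[a, b].
  by move=> ? ?; rewrite in_itv /=; apply/andP.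
have [ch hl] := th; have ab' := curve_lt ch; have [_ _ lh] := ch.
have hll s t : a' <= s -> s < t -> t <= b' -> cll S (h s) (h t).
  move=> as_ st tb; apply: hl; rewrite ?in_cc//; split=> //.
    exact: le_trans (ltW st) tb.
  exact: le_trans as_ (ltW st).
have ha' : h a' = p by rewrite -tha -gh ?in_ab// ?ltW.
have hb' : h b' = q by rewrite -thb -gh ?in_ab// ?ltW.
have thin t : a <= t -> t <= b -> a' <= hth t /\ hth t <= b'.
  move=> at_ tb; rewrite -tha -thb.
  by split; apply: moth => //; apply: in_ab => //; exact: ltW.
(* Regularity gives [g = h o hth] with [hth] monotone, possibly pausing. Preimages chosen by the
   intermediate value theorem carry the calibration from [g] to [h]; the value [0] outside
   [[a', b']] is a placeholder. *)
have /choice[pre hpre] : forall s, exists u, a' <= s -> s <= b' ->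
    [/\ a <= u, u <= b & hth u = s].
  move=> s; have [as_|] := leP a' s; last by exists 0.
  have [sb|] := leP s b'; last by exists 0.
  have hs : Num.min (hth a) (hth b) <= s <= Num.max (hth a) (hth b).
    by apply/andP; split; rewrite tha thb; [rewrite ge_min as_|rewrite le_max sb orbT].
  have [u + hu] := IVT (ltW ab) cth hs.
  by rewrite in_itv /= => /andP[au ub]; exists u.
pose f s := tr S p (h (clamp a' b' s)).
have exh s t : a' <= s -> s <= t -> t <= b' ->
    tau S (h s) (h t) = (phi (pre t) - phi (pre s))%:E.
  move=> as_ st tb; have sb := le_trans st tb; have at_ := le_trans as_ st.
  have [s1 s2 s3] := hpre s as_ sb; have [t1 t2 t3] := hpre t at_ tb.
  move: st; rewrite le_eqVlt => /predU1P[->|st].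
    by rewrite (tau_xx hX hgh) subrr.
  have le : pre s <= pre t.
    rewrite leNgt; apply/negP => lt.
    have := moth _ _ (in_ab _ t1 t2) (in_ab _ s1 s2) (ltW lt).
    by rewrite s3 t3 leNgt st.
  by rewrite -{1}s3 -{1}t3 -!gh ?in_ab//; exact: ex.
have fE s : a' <= s -> s <= b' -> f s = phi (pre s) - phi (pre a').
  by move=> as_ sb; rewrite /f clamp_id// /tr -ha' exh.
have fab' : f a' = 0 by rewrite fE ?subrr// ltW.
have fb' : f b' = L.
  by rewrite /f clamp_id ?(ltW ab')// hb'.
have fdiff s t : a' <= s -> s <= t -> t <= b' -> tau S (h s) (h t) = (f t - f s)%:E.
  move=> as_ st tb; rewrite exh// fE ?(le_trans as_)// (fE s)// ?(le_trans st)//.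
  by congr EFin; lra.
have finc s t : a' <= s -> s < t -> t <= b' -> f s < f t.
  move=> as_ st tb; rewrite -subr_gt0 -lte_fin -fdiff// ?(ltW st)//.
  by apply/(tau_pos hX); exact: hll.
have ch' : continuous (fun s => h (clamp a' b' s)) by exact: lipschitz_continuous (ltW ab') lh.
have hle s t : a' <= s -> s <= t -> t <= b' -> cle S (h s) (h t).
  exact: (causal_le hX (timelike_causal th)).
have Uh s : a' <= s -> s <= b' -> U (h s).
  move=> as_ sb; apply: dU; split.
    by rewrite -ha'; exact: hle.
  by rewrite -hb'; exact: hle.
have cf : continuous f.
  move=> s; have [s1 s2] := clamp_in s (ltW ab').
  have c1 : (fun u => (p, h (clamp a' b' u))) @ s --> (p, h (clamp a' b' s)).
    by apply: cvg_pair; [exact: cvg_cst|exact: ch'].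
  exact: (cvg_comp _ _ c1 (Ucont Up (Uh _ s1 s2))).
have [k [ck hk kin fk kf]] := increasing_inverse ab' cf finc.
rewrite fab' fb' in fk.
have rL r : 0 <= r -> r <= 1 -> 0 <= r * L /\ r * L <= L.
  by move=> r0 r1; rewrite mulr_ge0 ?(ltW L0)// ger_pMl.
pose th' r := k (r * L).
have cth' : continuous th'.
  have -> : th' = k \o ( *%R^~ L) by [].
  by move=> r; apply: continuous_comp; [exact: mulrr_continuous|exact: ck].
have th'in r : a' <= th' r /\ th' r <= b' by exact: kin.
have th'0 : th' 0 = a' by rewrite /th' mul0r -fab' kf// ltW.
have th'1 : th' 1 = b' by rewrite /th' mul1r -fb' kf// ltW.
have ctn : continuous (fun r => h (th' r)).
  have -> : (fun r => h (th' r)) = (fun s => h (clamp a' b' s)) \o th'.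
    by apply/funext => r /=; have [? ?] := th'in r; rewrite clamp_id.
  by move=> r; apply: continuous_comp; [exact: cth'|exact: ch'].
exists (fun r => h (th' r)); split=> //.
- move=> r s r0 rs s1; have [r1 s0] := (le_trans rs s1, le_trans r0 rs).
  have [? ?] := th'in r; have [? ?] := th'in s.
  rewrite fdiff//; last by apply: hk; rewrite ler_wpM2r// ltW.
  have [? ?] := rL r r0 r1; have [? ?] := rL s s0 s1.
  by rewrite /th' !fk//; congr EFin; ring.
- by rewrite th'0 th'1.
- have [t1 t2] := thin tm atm tmb.
  exists (f (hth tm) / L); split.
  + rewrite divr_ge0 ?(ltW L0)// -fab'.
    move: t1; rewrite le_eqVlt => /predU1P[<- //|t1]; apply: ltW; exact: finc.
  + rewrite ler_pdivrMr// mul1r -fb'.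
    move: t2; rewrite le_eqVlt => /predU1P[-> //|t2]; apply: ltW; exact: finc.
  + by rewrite /th' divfK ?gt_eqF// kf// -gm gh ?in_ab.
- exists a', b', h; split=> //.
    by apply: (exact_maximizer (timelike_causal th)) => s t; exact: fdiff.
  exists th'; split=> //; first exact: continuous_subspaceT.
  by move=> r s _ _ rs; apply: hk; rewrite ler_wpM2r// ltW.
Qed.

(** Concavity applies once the start of [c'] is moved to [c' d], which is timelike after [c 0], with
    the other ends equal. It makes the intermediate points timelike related, and closedness of the
    order allows [d -> 0]. *)
Lemma lin_param_le c c' l l' : lin S c l -> lin S c' l' -> 0 < l' ->
  continuous c' -> timelike_param S c -> timelike_param S c' ->
  c 0 = c' 0 -> c 1 = c' 1 -> contained `[0, 1] c U0 -> contained `[0, 1] c' U0 ->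
  forall t : R, 0 <= t -> t < 1 -> cle S (c t) (c' t).
Proof.
move=> lc lc' l0 cc' pc pc' e0 e1 cU cU' t t0 t1.
have [_ _ conc] := cU0.
pose w (d r : R) : R := d + r * (1 - d).
have hd (d : R) : 0 < d -> d < 1 -> cle S (c t) (c' (w d t)).
  move=> d0 d1.
  have win (r : R) : 0 <= r -> r <= 1 -> 0 <= w d r /\ w d r <= 1.
    move=> r0 r1; split; first by rewrite addr_ge0 ?(ltW d0)// mulr_ge0// subr_ge0 ltW.
    have : r * (1 - d) <= 1 - d by rewrite ger_pMl// subr_gt0.
    rewrite /w; lra.
  have lw : lin S (fun r => c' (w d r)) (l' * (1 - d)).
    move=> r s r0 rs s1; have [? ?] := win r r0 (le_trans rs s1).
    have [? ?] := win s (le_trans r0 rs) s1.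
    rewrite lc'//; first by congr EFin; rewrite /w; ring.
    by rewrite lerD2l ler_wpM2r// subr_ge0 ltW.
  have pw : timelike_param S (fun r => c' (w d r)) by exact: timelike_param_sub lc' l0 pc' _ _ (ltW d0) d1 (lexx _).
  have w0 : w d 0 = d by rewrite /w mul0r addr0.
  have w1 : w d 1 = 1 by rewrite /w mul1r subrKC.
  have t0d : tau S (c 0) (c' d) = (l' * d)%:E.
    by rewrite e0 lc' ?lexx ?subr0// ltW.
  have lld : cll S (c 0) (c' d) by apply/(tau_pos hX); rewrite t0d lte_fin mulr_gt0.
  have h : ((1 - t)%:E * (l' * d)%:E <= tau S (c t) (c' (w d t)))%E.
    have wU : contained `[0, 1] (fun r => c' (w d r)) U0.
      move=> _ [r + <-]; rewrite in_cc => -[r0 r1]; apply: cU'; exists (w d r) => //.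
      by rewrite in_cc; exact: win.
    have h := conc c (fun r => c' (w d r)) (or_introl (conj (lin_cs_maximizer lc pc)
      (lin_cs_maximizer lw pw))) cU wU.
    rewrite w0 w1 in h; have := h (or_introl lld) (or_intror e1) t.
    by rewrite -e1 (tau_xx hX hgh) t0d mule0 add0e in_itv /= t0 (ltW t1) => /(_ isT).
  apply: (cll_le hX); apply/(tau_pos hX); apply: lt_le_trans h.
  by rewrite -EFinM lte_fin mulr_gt0 ?mulr_gt0// subr_gt0.
have cw : (fun d => (c t, c' (w d t))) @ 0^'+ --> (c t, c' t).
  apply: cvg_pair; first exact: cvg_cst.
  have -> : c' t = c' (w 0 t) by rewrite /w subr0 mulr1 add0r.
  have cwt : {for 0, continuous (w^~ t)}.
    apply: cvgD; first exact: cvg_id.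
    by apply: cvgMr; apply: cvgB; [exact: cvg_cst|exact: cvg_id].
  apply: cvg_at_right_filter; exact: (cvg_comp _ _ cwt (cc' _)).
have := @closed_cvg _ _ 0^'+ _ (fun d => (c t, c' (w d t))) [set z | cle S z.1 z.2].
move=> /(_ _ (cle_closed hX hgh) _ (c t, c' t)); apply => //=.
near=> d; apply: hd; near: d; [exact: nbhs_right_gt|exact: nbhs_right_lt].
Unshelve. all: by end_near. Qed.

Lemma lin_param_unique c c' l l' : lin S c l -> lin S c' l' -> 0 < l -> 0 < l' ->
  continuous c -> continuous c' -> timelike_param S c -> timelike_param S c' ->
  c 0 = c' 0 -> c 1 = c' 1 -> contained `[0, 1] c U0 -> contained `[0, 1] c' U0 ->
  forall t : R, 0 <= t -> t <= 1 -> c t = c' t.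
Proof.
move=> lc lc' l0 l0' cc cc' pc pc' e0 e1 cU cU' t t0.
rewrite le_eqVlt => /predU1P[-> //|t1].
by apply: (cle_anti hX hgh); [apply: lin_param_le lc lc' _ _ _ _ _ _ _ _ _ _ _|
  apply: lin_param_le lc' lc _ _ _ _ _ _ _ _ _ _ _].
Qed.

Lemma lin_in_diamond c l : lin S c l -> 0 < l -> forall t : R, 0 <= t -> t <= 1 ->
  diamond S (c 0) (c 1) (c t).
Proof.
move=> lc l0.
have le (r s : R) : 0 <= r -> r <= s -> s <= 1 -> cle S (c r) (c s).
  move=> r0; rewrite le_eqVlt => /predU1P[->|rs] s1; first exact: cle_refl.
  apply: (cll_le hX); apply/(tau_pos hX); rewrite lc ?(ltW rs)//.
  by rewrite lte_fin mulr_gt0// subr_gt0.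
by move=> t t0 t1; split; apply: le.
Qed.

(** Nothing but separations is known about [c]. For each [r] there is a realizable maximizer through
    [c r], which meets it at parameter [r] because of the separation from the start. All these
    maximizers coincide by uniqueness, so [c] is one of them. *)
Lemma lin_param c l : lin S c l -> 0 < l -> diamond S (c 0) (c 1) `<=` U ->
  exists c0, [/\ continuous c0, lin S c0 l, timelike_param S c0,
    contained `[0, 1] c0 U0 & forall t : R, 0 <= t -> t <= 1 -> c t = c0 t].
Proof.
move=> lc l0 dU; set p := c 0 in dU *; set q := c 1 in dU *.
have tpq : tr S p q = l by rewrite /tr lc ?lexx// subr0 mulr1.
have pq : cll S p q by apply/(tau_pos hX); rewrite lc ?lexx// subr0 mulr1 lte_fin.
have base m : cle S p m -> cle S m q -> tr S p m + tr S m q = l ->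
    exists c0, [/\ continuous c0, lin S c0 l, timelike_param S c0,
      contained `[0, 1] c0 U0 & [/\ c0 0 = p, c0 1 = q &
      exists r, [/\ 0 <= r, r <= 1 & c0 r = m]]].
  move=> pm mq e.
  have [|c0 [cc0 lc0 [c00 c01] cr pc0]] := maximizer_through pq dU pm mq.
    by rewrite tpq.
  exists c0; rewrite tpq in lc0; split=> //.
  move=> _ [r + <-]; rewrite in_cc => -[r0 r1]; apply: UU0; apply: dU.
  by rewrite -c00 -c01; exact: lin_in_diamond lc0 l0 _ r0 r1.
have [||| c0 [cc0 lc0 pc0 cU [c00 c01 _]]] := base p.
- exact: cle_refl.
- exact: cll_le.
- by rewrite {1}/tr (tau_xx hX hgh) add0r.
exists c0; split=> // r r0 r1.
have [pm mq] := lin_in_diamond lc l0 r0 r1.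
have [|c1 [cc1 lc1 pc1 cU1 [c10 c11 [s [s0 s1 c1s]]]]] := base (c r) pm mq.
  by rewrite /tr !lc ?lexx//=; ring.
have es : s = r.
  have := lc 0 r (lexx _) r0 r1; rewrite -c1s -/p -c10 lc1 ?lexx// !subr0 => -[].
  exact/mulfI/lt0r_neq0.
rewrite -{1}c1s es; apply: (lin_param_unique lc1 lc0) => //; first by rewrite c10.
by rewrite c11.
Qed.

Lemma comparison_cmp : cmp S U.
Proof.
split=> //.
- move=> p m q pq dU pm mq e.
  have [c [? ? [? ?] ? _]] := maximizer_through pq dU pm mq e.
  by exists c; split.
- move=> c c' l l' lc lc' l0 e0 e1 dU t t0 t1.
  have el : l' = l.
    have := lc' 0 1; rewrite -e0 -e1 lc ?lexx// subr0 !mulr1 => h.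
    by have [] := h isT ler01 isT.
  rewrite el in lc'.
  have dU' : diamond S (c' 0) (c' 1) `<=` U by rewrite -e0 -e1.
  have [d [cd ld pd dU0 ed]] := lin_param lc l0 dU.
  have [d' [cd' ld' pd' dU0' ed']] := lin_param lc' l0 dU'.
  rewrite ed// ed'//; apply: (lin_param_unique ld ld') => //.
    by rewrite -ed ?lexx// -ed' ?lexx.
  by rewrite -ed ?lexx// -ed' ?lexx.
- move=> c c' l l' lc lc' l0 l0' dU dU' h0 h1 t t0 t1.
  have [d [cd ld pd dU0 ed]] := lin_param lc l0 dU.
  have [d' [cd' ld' pd' dU0' ed']] := lin_param lc' l0' dU'.
  have [_ _ conc] := cU0.
  have Uc (r : R) : 0 <= r -> r <= 1 -> U (c r).
    by move=> r0 r1; apply: dU; exact: lin_in_diamond lc l0 _ r0 r1.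
  have Uc' (r : R) : 0 <= r -> r <= 1 -> U (c' r).
    by move=> r0 r1; apply: dU'; exact: lin_in_diamond lc' l0' _ r0 r1.
  have fE (r : R) : 0 <= r -> r <= 1 -> tau S (c r) (c' r) = (tr S (c r) (c' r))%:E.
    by move=> r0 r1; rewrite /tr fineK//; apply: Ufin; [exact: Uc|exact: Uc'].
  have := conc d d'; rewrite -!ed ?lexx// -!ed' ?lexx// => h.
  have := h (or_introl (conj (lin_cs_maximizer ld pd) (lin_cs_maximizer ld' pd'))) dU0 dU0' h0 h1 t.
  rewrite in_itv /= t0 t1 -ed// -ed'// !fE ?lexx// => /(_ isT).
  by rewrite -!EFinM -EFinD lee_fin.
Qed.

Lemma lin_timelike_param c l : lin S c l -> 0 < l -> diamond S (c 0) (c 1) `<=` U ->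
  timelike_param S c.
Proof.
move=> lc l0 dU; have [c0 [_ _ p0 _ e]] := lin_param lc l0 dU.
by apply: timelike_param_ext p0 => t t0 t1; rewrite e.
Qed.

End Neighborhood.
(** Passing to the interior turns continuity within the neighborhood into continuity, and shrinking
    until [tau < 1], possible since [tau x x = 0], gives finiteness. The realizability clause is
    kept beside [cmp], which forgets Lipschitz curves. *)
Lemma cmp_near (hconc : locally_concave S) x : exists U, [/\ nbhs x U, cmp S U &
  forall c l, lin S c l -> 0 < l -> diamond S (c 0) (c 1) `<=` U -> timelike_param S c].
Proof.
have [U0 nU0 cU0] := hconc x; have [/subspace_continuousP ct _ _] := cU0.
have tcont p q : U0° p -> U0° q -> (fun z : X * X => tau S z.1 z.2) @ (p, q) --> tau S p q.
  move=> Up Uq W nW.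
  have Upq : (U0 `*` U0) (p, q) by split; exact: interior_subset.
  have h : \forall z \near (p, q), (U0 `*` U0) z -> W (tau S z.1 z.2) := ct _ Upq W nW.
  have h' : nbhs (p, q) (U0 `*` U0) by exists (U0, U0).
  apply: filterS (filterI h h') => z -[hz Uz]; exact: hz.
have [[A B] /= [nA nB] AB] : nbhs (x, x) (fun z : X * X => (tau S z.1 z.2 < 1)%E).
  apply: (tcont x x _ _ [set v | (v < 1)%E]) => //.
  by rewrite (tau_xx hX hgh); apply: open_nbhs_nbhs; split=> //=; exact: open_ereal_lt_ereal.
pose U := U0° `&` (A `&` B)°.
have Ufin p q : U p -> U q -> tau S p q \is a fin_num.
  move=> [_ /interior_subset[Ap _]] [_ /interior_subset[_ Bq]].
  have := AB (p, q) (conj Ap Bq) => /= lt1; rewrite ge0_fin_numE ?(tau_ge0 hX)//.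
  exact: lt_trans lt1 (ltry _).
have Ucont p q : U p -> U q -> (fun z : X * X => tr S z.1 z.2) @ (p, q) --> tr S p q.
  move=> Up Uq; apply: fine_cvg; rewrite /tr fineK; last exact: Ufin.
  by apply: tcont; [exact: (proj1 Up)|exact: (proj1 Uq)].
have UU0 : U `<=` U0 by move=> z [/interior_subset].
exists U; split.
- apply: filterI; first by apply: open_nbhs_nbhs; split=> //; exact: open_interior.
  apply: open_nbhs_nbhs; split; [exact: open_interior|exact: filterI].
- exact: comparison_cmp cU0 UU0 Ufin Ucont.
- move=> c l; exact: lin_timelike_param cU0 UU0 Ufin Ucont c l.
Qed.

Lemma tame_of_concave (hconc : locally_concave S) : tame S.
Proof.
split.
- exact: cle_refl.
- exact: cle_trans.
- exact: cle_anti.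
- exact: cll_le.
- exact: tau_ge0.
- exact: tau_tri.
- exact: tau_pos.
- exact: cll_open.
- exact: cle_closed.
- exact: (proj1 hgh).
- exact: chron_future_near.
- exact: chron_past_near.
- by move=> x; have [U [? ? _]] := cmp_near hconc x; exists U.
Qed.

End Through.

Section Windows.
Context {R : realType}.

Lemma uniform_window (Q : R -> R -> Prop) (a b : R) :
  (forall t, a <= t -> t <= b -> exists2 d, 0 < d & forall u v, a <= u -> u <= v ->
     v <= b -> `|u - t| < d -> `|v - t| < d -> Q u v) ->
  exists2 e, 0 < e & forall u v, a <= u -> u <= v -> v <= b -> v - u <= e -> Q u v.
Proof.
move=> hQ.
have h : \forall e \near (0 : R)^'+, forall t, a <= t -> t <= b ->
    forall v, a <= t -> t <= v -> v <= b -> v - t <= e -> Q t v.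
  apply: (@seg_near _ _ (0 : R)^'+ _ (fun e t => forall v, a <= t -> t <= v -> v <= b ->
    v - t <= e -> Q t v) a b) => t at_ tb.
  have [d d0 hd] := hQ t at_ tb; have d2 : 0 < d / 2 by rewrite divr_gt0.
  exists ([set s | `|s - t| < d / 2], [set e | e < d / 2]).
    by split; [exact: near_dist|exact: nbhs_right_lt].
  move=> [s e] /= [st ed] v as_ sv vb ve; apply: hd => //.
    by apply: lt_le_trans st _; lra.
  have -> : v - t = (v - s) + (s - t) by ring.
  apply: le_lt_trans (ler_normD _ _) _; rewrite ger0_norm ?subr_ge0//; lra.
near (0 : R)^'+ => e; exists e; first by near: e; exact: nbhs_right_gt.
move=> u v au uv vb ve; have he : forall t, a <= t -> t <= b ->
    forall v, a <= t -> t <= v -> v <= b -> v - t <= e -> Q t v by near: e; exact: h.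
by apply: he => //; exact: le_trans vb.
Unshelve. all: by end_near. Qed.

Lemma continuous_within_clamp {T : topologicalType} (f : R -> T) (a b : R) : a <= b ->
  {within `[a, b], continuous f} -> continuous (fun t => f (clamp a b t)).
Proof.
move=> ab /subspace_continuousP cf t W nW.
have [ta tb] := clamp_in t ab.
have h : nbhs (clamp a b t) (fun s => [set` `[a, b]] s -> W (f s)).
  by apply: cf nW; rewrite in_cc.
have h' : nbhs t (fun s => [set` `[a, b]] (clamp a b s) -> W (f (clamp a b s))).
  exact: (@continuous_clamp R a b t _ h).
by apply: filterS h' => s hs; apply: hs; rewrite in_cc; exact: clamp_in.
Qed.

Lemma consecutive_ind (Q P : R -> R -> Prop) (a b : R) s :
  (forall u v, a <= u -> u < v -> v <= b -> Q u v -> P u v) ->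
  (forall u v w, a <= u -> u < v -> v < w -> w <= b -> P u v -> P v w -> P u w) ->
  a < b -> itv_partition a b s -> consecutive Q a s -> P a b.
Proof.
elim: s a => [a _ _ ab /itv_partition_nil e|t s ih a hQ hP ab /partition_split[at_ ps] /= [Qt cs]].
  by rewrite e ltxx in ab.
have := itv_partition_le ps; rewrite le_eqVlt => /predU1P[tb|tb].
  by rewrite -tb; apply: hQ => //; rewrite tb.
apply: (hP a t b) => //; first by apply: hQ => //; exact: ltW.
apply: ih => // [u v tu|u v w tu]; [apply: hQ|apply: hP]; exact: le_trans (ltW at_) tu.
Qed.

End Windows.

Definition timelike_piece {R : realType} {X : metricType R} (S : causal_data R X)
    (c : R -> X) (u v : R) : Prop := exists a b h (f : R -> R),
  [/\ future_timelike S `[a, b] h, continuous f,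
      forall s t, u <= s -> s < t -> t <= v -> f s < f t,
      f u = a /\ f v = b & forall t, u <= t -> t <= v -> c t = h (f t)].

(** * Translation between [tg] and Lipschitz timelike geodesics *)

Section Realization.
Context {R : realType} {X : metricType R} (S : causal_data R X).
Context (hX : lorentzian_length_space S) (hgh : globally_hyperbolic S) (hreg : regular S).
Context (hconc : locally_concave S).
Implicit Types (x y z p q m : X) (g h c : R -> X) (a b l : R).

Let hS : tame S := tame_of_concave hX hgh hreg hconc.

Lemma timelike_piece_glue c (u v w : R) : u < v -> v < w ->
  timelike_piece S c u v -> timelike_piece S c v w -> timelike_piece S c u w.
Proof.
move=> uv vw [a1 [b1 [h1 [f1 [[cv1 r1] cf1 mf1 [fu1 fv1] e1]]]]].
move=> [a2 [b2 [h2 [f2 [[cv2 r2] cf2 mf2 [fu2 fv2] e2]]]]].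
pose d := b1 - a2; pose h2' t := h2 (t - d).
have ad : a2 + d = b1 by rewrite /d subrKC.
have ab1 := curve_lt cv1; have ab2 := curve_lt cv2.
have cv2' : curve `[b1, b2 + d] h2' by rewrite -ad; exact: curve_shift.
have bd := curve_lt cv2'.
have e12 : h1 b1 = h2' b1.
  by rewrite /h2' -[X in X - d]ad addrK -fv1 -fu2 -e1 ?(ltW uv)// e2 ?(ltW vw).
(* On either side of [v] one of the two summands is constant, so continuity needs no case
   distinction. *)
pose f t := f1 (clamp u v t) + (f2 (clamp v w t) - a2).
have fl t : u <= t -> t <= v -> f t = f1 t.
  move=> ut tv; rewrite /f clamp_id//.
  have -> : clamp v w t = v by rewrite /clamp (min_idPl (le_trans tv (ltW vw))) (max_idPl tv).
  by rewrite fu2 subrr addr0.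
have fr t : v <= t -> t <= w -> f t = f2 t + d.
  move=> vt tw; rewrite /f (clamp_id vt tw).
  have -> : clamp u v t = v by rewrite /clamp (min_idPr vt) (max_idPr (ltW uv)).
  by rewrite fv1 /d; ring.
exists a1, (b2 + d), (glue b1 h1 h2'), f; split.
- split; first exact: curve_glue.
  apply: (glue_rel _ ab1 bd e12 r1); last by rewrite -ad; exact: (rel_shift r2).
  by move=> x y z xy yz; apply: (cll_cle_trans hX xy); exact: (cll_le hX).
- move=> t; apply: cvgD; first by apply: continuous_comp; [exact: continuous_clamp|exact: cf1].
  apply: cvgB; last exact: cvg_cst.
  by apply: continuous_comp; [exact: continuous_clamp|exact: cf2].
- move=> s t us st tw; have [tv|vt] := leP t v.
    by rewrite !fl// ?(le_trans us (ltW st))// ?(le_trans (ltW st) tv)//; exact: mf1.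
  have [sv|vs] := leP s v; last by rewrite !fr// ?(ltW vs) ?(ltW vt)// ?(le_trans (ltW st))// ltrD2r; apply: mf2 => //; exact: ltW.
  rewrite (fl s)// fr ?(ltW vt)//.
  have le1 : f1 s <= b1.
    move: sv; rewrite le_eqVlt => /predU1P[->|sv]; first by rewrite fv1.
    by rewrite -fv1; apply: ltW; exact: mf1.
  have := mf2 v t (lexx _) vt tw; rewrite fu2 /d; lra.
- by rewrite fl ?(ltW uv)// fr ?(ltW vw)// fu1 fv2.
- move=> t ut tw; have [tv|vt] := leP t v.
    rewrite fl// glue_left; first exact: e1.
    rewrite -fv1; move: tv; rewrite le_eqVlt => /predU1P[-> //|tv]; apply: ltW; exact: mf1.
  rewrite fr ?(ltW vt)// glue_right//; first by rewrite /h2' addrK e2// ltW.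
  by rewrite -ad lerD2r -fu2; apply: ltW; exact: mf2.
Qed.

Lemma timelike_piece_small c l (u v : R) (U : set X) : tg S c l -> cmp S U ->
  (forall c l, lin S c l -> 0 < l -> diamond S (c 0) (c 1) `<=` U -> timelike_param S c) ->
  0 <= u -> u < v -> v <= 1 -> diamond S (c u) (c v) `<=` U -> timelike_piece S c u v.
Proof.
move=> tc cU pU u0 uv v1 dU; have vu : 0 < v - u by rewrite subr_gt0.
have ts := tg_sub tc u0 uv v1.
have dU' : diamond S (c (u + 0 * (v - u))) (c (u + 1 * (v - u))) `<=` U.
  by rewrite mul0r addr0 mul1r subrKC.
have ls := tg_small_lin hS ts cU dU'.
have [l0 _ _] := ts; have [a [b [h [th _ [f [cf mf fa fb ch]]]]]] := pU _ _ ls l0 dU'.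
have [cv hl] := th.
pose w (t : R) := (t - u) / (v - u).
have win t : u <= t -> t <= v -> 0 <= w t /\ w t <= 1.
  move=> ut tv; rewrite /w ler_pdivrMr// mul1r lerD2r; split=> //.
  by rewrite divr_ge0 ?subr_ge0// ltW.
have in01 (t : R) : 0 <= t -> t <= 1 -> t \in `[0, 1] by move=> ? ?; rewrite in_itv /=; apply/andP.
have wE t : u + w t * (v - u) = t by rewrite /w divfK ?gt_eqF// subrKC.
pose F t := f (clamp 0 1 (w t)).
have FE t : u <= t -> t <= v -> F t = f (w t).
  by move=> ut tv; have [? ?] := win t ut tv; rewrite /F clamp_id.
have cE t : u <= t -> t <= v -> c t = h (F t).
  move=> ut tv; have [w0 w1] := win t ut tv.
  by rewrite FE// -ch ?in01// wE.
exists a, b, h, F; split=> //.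
- move=> t; have cw : {for t, continuous w}.
    by apply: cvgMl; apply: cvgB; [exact: cvg_id|exact: cvg_cst].
  have cf' := continuous_within_clamp ler01 cf.
  exact: (cvg_comp _ _ cw (cf' _)).
- move=> s t us st tv; have ut := le_trans us (ltW st); have sv := le_trans (ltW st) tv.
  have [? ?] := win s us sv; have [? ?] := win t ut tv.
  rewrite lt_neqAle; apply/andP; split.
    apply/eqP => e; have := tg_ll hS tc (le_trans u0 us) st (le_trans tv v1).
    by rewrite !cE// e; exact: ll_irr.
  by rewrite !FE//; apply: mf; rewrite ?in01// ler_wpM2r ?invr_ge0 ?(ltW vu)// lerD2r ltW.
- rewrite !FE ?lexx ?(ltW uv)// /w subrr mul0r divff ?gt_eqF//.
Qed.

Lemma timelike_piece_tg c l : tg S c l -> timelike_piece S c 0 1.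
Proof.
move=> tc; have [_ cc _] := tc.
have [s ps cs] : exists2 s : seq R, itv_partition 0 1 s &
    consecutive (fun u v => u < v -> timelike_piece S c u v) 0 s.
  apply: fine_partition => // t t0 t1.
  have [U [nU cU pU]] := cmp_near hX hgh hreg hconc (c t).
  have [V nV hV] := strongly_causal hS nU.
  have /near_distP[d d0 hd] : \forall r \near t, V (c r) by exact: cc.
  exists d => // u v u0 uv v1 ud vd uv'.
  by apply: (timelike_piece_small tc cU pU) => //; apply: hV; exact: hd.
apply: (consecutive_ind _ _ ltr01 ps cs) => [u v _ uv _|u v w _ uv vw _]; first exact.
exact: timelike_piece_glue.
Qed.

(** Local Lipschitz realizations are glued to a single one. Local maximality comes from the windows
    of [c], transported by the homeomorphism [f]. *)
Lemma geodesic_of_tg c l : tg S c l -> exists a b h (f : R -> R),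
  [/\ timelike_geodesic S (c 0) (c 1) a b h, continuous f,
      forall s t, 0 <= s -> s < t -> t <= 1 -> f s < f t,
      f 0 = a /\ f 1 = b & forall t, 0 <= t -> t <= 1 -> c t = h (f t)].
Proof.
move=> tc; have [a [b [h [f [th cf mf [f0 f1] ch]]]]] := timelike_piece_tg tc.
have [l0 cc [e e0 he]] := tc; have [cv hl] := th; have ab := curve_lt cv.
have [_ _ lh] := cv.
exists a, b, h, f; split=> //; split.
  by split=> //; rewrite -?f0 -?f1 -ch.
split; first exact: timelike_causal.
move=> w; rewrite in_itv /= => /andP[aw wb].
have [k [ck hk kin fk kf]] := increasing_inverse ltr01 cf mf.
rewrite f0 f1 in fk; have [r0 r1] := kin w; set r := k w in r0 r1.
have fr : f r = w by exact: fk.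
have mono s t : 0 <= s -> s <= t -> t <= 1 -> f s <= f t.
  by move=> s0; rewrite le_eqVlt => /predU1P[-> //|st] t1; apply: ltW; exact: mf.
(* Cut off at [0] and [1]: where the cut is active, [f u] or [f v] is an end of the domain, and the
   window is still a neighborhood within it. *)
pose u := Num.max 0 (r - e / 2); pose v := Num.min 1 (r + e / 2).
have u0 : 0 <= u by rewrite le_max lexx.
have v1 : v <= 1 by rewrite ge_min lexx.
have ur : u <= r by rewrite ge_max r0 gerBl divr_ge0// ltW.
have rv : r <= v by rewrite le_min r1 lerDl divr_ge0// ltW.
have e2 : 0 < e / 2 by rewrite divr_gt0.
have uv : u < v.
  rewrite lt_min !gt_max ltr01 /=; apply/andP; split; first lra.
  by apply/andP; split; lra.
have vue : v - u <= e.
  have : v <= r + e / 2 by rewrite ge_min lexx orbT.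
  have : r - e / 2 <= u by rewrite le_max lexx orbT.
  lra.
have [fua fvb] : a <= f u /\ f v <= b.
  by rewrite -f0 -f1; split; apply: mono => //; apply: ltW; [exact: lt_le_trans uv v1|exact: le_lt_trans u0 uv].
have sub : [set` `[f u, f v]] `<=` [set` `[a, b]].
  by move=> t; rewrite !in_cc => -[? ?]; split; [exact: (le_trans fua)|exact: le_trans fvb].
exists (f u), (f v); split=> //.
  have nu : \forall s \near w, a <= s -> f u <= s.
    have [ue|] := eqVneq u 0; first by rewrite ue f0; near=> s.
    rewrite neq_lt ltNge u0 /= => ugt.
    have : f u < w.
      rewrite -fr; apply: mf => //; move: ugt; rewrite /u; case: (leP 0 (r - e / 2)) => //; lra.
    by move=> lt; near=> s; move=> _; apply: ltW; near: s; exact: lt_nbhsr.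
  have nv : \forall s \near w, s <= b -> s <= f v.
    have [ve|] := eqVneq v 1; first by rewrite ve f1; near=> s.
    rewrite neq_lt [1 < v]ltNge v1 orbF => vlt.
    have : w < f v.
      rewrite -fr; apply: mf => //; move: vlt; rewrite /v; case: (leP 1 (r + e / 2)) => //; lra.
    by move=> lt; near=> s; move=> _; apply: ltW; near: s; exact: lt_nbhsl.
  apply: filterS (filterI nu nv) => s [h1 h2]; rewrite !in_cc => -[as_ sb].
  by split; [exact: h1|exact: h2].
have fuv : f u < f v by exact: mf.
have tsub : future_timelike S `[f u, f v] h.
  split; last by move=> s t Ds Dt; apply: hl; exact: sub.
  split; [exact: interval_is_interval| |exact: locally_lipschitz_sub sub lh].
  exists (f u), (f v); rewrite !in_cc !lexx (ltW fuv); split=> // eh.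
  apply: (ll_irr hS (x := h (f u))); rewrite {2}eh; apply: hl => //.
    by apply: sub; rewrite in_cc lexx ltW.
  by apply: sub; rewrite in_cc lexx ltW.
have kf' t : 0 <= t -> t <= 1 -> k (f t) = t by exact: kf.
have u1 := ltW (lt_le_trans uv v1); have v0 := ltW (le_lt_trans u0 uv).
apply: (exact_maximizer (phi := fun t => l * k t) (timelike_causal hX tsub)) => s t us st tv.
have [s0 s1] := kin s; have [t0 t1] := kin t.
have as_ := le_trans fua us; have tb := le_trans tv fvb.
rewrite -{1}(fk s as_ (le_trans st tb)) -{1}(fk t (le_trans as_ st) tb) -!ch//.
rewrite he//; first by rewrite mulrBr.
  exact: hk.
apply: le_trans vue; apply: lerB.
  by rewrite -[leRHS]kf'//; exact: hk.
by rewrite -[leLHS]kf'//; exact: hk.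
Unshelve. all: by end_near. Qed.

(** Every partition sum is at least this value by [tg_tau_ge], and a partition with steps inside the
    windows of [c] attains it. *)
Lemma curve_length_tg c l (f : R -> R) (a b : R) : tg S c l -> continuous f ->
  (forall s t, a <= s -> s <= t -> t <= b -> 0 <= f s /\ f s <= f t /\ f t <= 1) ->
  a <= b -> curve_length S a b (fun t => c (f t)) = (l * (f b - f a))%:E.
Proof.
move=> tc cf mf ab; have [l0 cc [e e0 he]] := tc.
apply/le_anti/andP; split; last first.
  apply: le_ereal_inf_tmp => _ [s ps <-].
  have low u v : a <= u -> u <= v -> v <= b -> ((l * f v - l * f u)%:E <= tau S (c (f u)) (c (f v)))%E.
    move=> au uv vb; have [fu [fuv fv]] := mf u v au uv vb.
    by have [_] := tg_tau_ge hS tc fu fuv fv; rewrite mulrBr.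
  elim: s a ab ps mf low => [a' ab' /itv_partition_nil -> _ _|t s ih a' ab' /partition_split[at_ ps] mf low].
    by rewrite partition_sum_nil subrr mulr0.
  have tb := itv_partition_le ps; rewrite partition_sum_cons.
  have := low a' t (lexx _) (ltW at_) tb.
  have h1 : ((l * (f b - f t))%:E <= partition_sum (tau S) t b (fun t0 => c (f t0)) s)%E.
    by apply: (ih t tb ps) => u v tu; [apply: mf|apply: low]; exact: le_trans (ltW at_) tu.
  move=> h2; apply: le_trans (leeD h2 h1); rewrite -EFinD lee_fin; lra.
have [s ps cs] : exists2 s : seq R, itv_partition a b s & consecutive
    (fun u v => tau S (c (f u)) (c (f v)) = (l * f v - l * f u)%:E) a s.
  apply: fine_partition => // t at_ tb.
  have /near_distP[d d0 hd] : \forall r \near t, `|f r - f t| < e / 2.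
    have e2 : 0 < e / 2 by rewrite divr_gt0.
    exact: (cf t _ (near_dist (f t) e2)).
  exists d => // u v au uv vb ud vd; have [fu [fuv fv]] := mf u v au uv vb.
  rewrite he// ?mulrBr//.
  have := hd u ud; have := hd v vd; rewrite !ltr_distl => /andP[? ?] /andP[? ?]; lra.
apply: le_trans (curve_length_le S _ ps) _; rewrite mulrBr.
elim: s a {ab mf} ps cs => [a' /itv_partition_nil -> _|t s ih a' /partition_split[at_ ps] /= [q cs]].
  by rewrite partition_sum_nil subrr.
rewrite partition_sum_cons q; apply: le_trans (leeD2l _ (ih t ps cs)) _.
rewrite -EFinD lee_fin; lra.
Qed.

(** [tau] may be infinite between distant points, but a partition finer than the comparison
    neighborhoods has a finite sum. Hence a maximizer has ends of finite separation. *)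
Lemma curve_length_fin g a b : a <= b -> continuous (fun t => g (clamp a b t)) ->
  (curve_length S a b g < +oo)%E.
Proof.
move=> ab cg.
have [s ps cs] : exists2 s : seq R, itv_partition a b s &
    consecutive (fun u v => tau S (g u) (g v) \is a fin_num) a s.
  apply: fine_partition => // t at_ tb.
  have [U [nU cU _]] := cmp_near hX hgh hreg hconc (g t).
  have /near_distP[d d0 hd] : \forall r \near t, U (g (clamp a b r)).
    by apply: cg; rewrite clamp_id.
  exists d => // u v au uv vb ud vd; apply: (cmp_fin cU).
    by have := hd u ud; rewrite clamp_id// (le_trans uv).
  by have := hd v vd; rewrite clamp_id// (le_trans au).
apply: le_lt_trans (curve_length_le S g ps) _.
elim: s a ps cs {ab cg} => [a _ _|t s ih a /partition_split[_ ps] /= [q cs]].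
  by rewrite partition_sum_nil.
by rewrite partition_sum_cons lte_add_pinfty// ?ih// ltey_eq q.
Qed.

Lemma geodesic_window g a b : geodesic S a b g -> exists2 d, 0 < d &
  forall u v, a <= u -> u <= v -> v <= b -> v - u <= d -> forall w : R, u <= w -> w <= v ->
    tau S (g u) (g v) = (tr S (g u) (g v))%:E /\
    tr S (g u) (g v) = tr S (g u) (g w) + tr S (g w) (g v).
Proof.
move=> [fg hg].
apply: (uniform_window (Q := fun u v => forall w : R, u <= w -> w <= v ->
    tau S (g u) (g v) = (tr S (g u) (g v))%:E /\
    tr S (g u) (g v) = tr S (g u) (g w) + tr S (g w) (g v))) => t at_ tb.
have [|a' [b' [sub nt mx]]] := hg t; first by rewrite in_itv /= at_.
have [[cv _] len] := mx; have ab' := curve_lt cv; have [_ _ lg] := cv.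
have fin : tau S (g a') (g b') \is a fin_num.
  have := curve_length_fin (ltW ab') (lipschitz_continuous (ltW ab') lg).
  by rewrite len ge0_fin_numE// (tau_ge0 hX).
have ex := maximizer_calibrated hX hgh mx fin.
have /near_distP[d d0 hd] : \forall r \near t, [set` `[a, b]] r -> [set` `[a', b']] r by exact: nt.
exists d => // u v au uv vb ud vd w uw wv.
have := hd u ud; have := hd v vd; rewrite !in_cc => h1 h2.
have [av' vb'] := h1 (conj (le_trans au uv) vb).
have [au' ub'] := h2 (conj au (le_trans uv vb)).
have aw := le_trans au' uw; have wb := le_trans wv vb'.
by rewrite /tr (ex u v)// (ex u w)// (ex w v)//=; split=> //; ring.
Qed.

(** The potential [psi] is prolonged by one window of length [d] at a time. Additivity of [tau] at
    the junction [w] makes the old and new pieces fit for intervals across it. *)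
Lemma geodesic_calibration g a b : geodesic S a b g -> exists2 d, 0 < d & exists psi : R -> R,
  forall u v, a <= u -> u <= v -> v <= b -> v - u <= d ->
    tau S (g u) (g v) = (psi v - psi u)%:E.
Proof.
move=> gg; have [d d0 hd] := geodesic_window gg; exists d => //.
have xx z : tau S z z = 0%E by exact: tau_xx.
suff main n : exists psi : R -> R, forall u v, a <= u -> u <= v -> v <= b ->
    v <= a + n%:R * d -> v - u <= d -> tau S (g u) (g v) = (psi v - psi u)%:E.
  have [n hn] := archi_mul (b - a) d0; have [psi hpsi] := main n.
  by exists psi => u v au uv vb vd; apply: hpsi => //; apply: le_trans vb _; lra.
elim: n => [|n [psi ih]].
  exists (fun=> 0) => u v au uv vb; rewrite mul0r addr0 => va _.
  have -> : v = u by apply/le_anti; rewrite uv (le_trans va).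
  by rewrite xx subrr.
pose w := a + n%:R * d; rewrite -/w in ih.
have aw : a <= w by rewrite lerDl mulr_ge0// ltW.
exists (fun t => if t <= w then psi t else psi w + tr S (g w) (g t)) => u v au uv vb.
rewrite -addn1 natrD mulrDl mul1r addrA -/w => vw vu.
have [vw'|wv] := leP v w; first by rewrite (le_trans uv vw'); exact: ih.
have [uw|wu] := leP u w.
  have [-> ->] := hd u v au uv vb vu w uw (ltW wv).
  rewrite {1}/tr (ih u w)//=; last by lra.
    by congr EFin; ring.
  exact: le_trans (ltW wv) vb.
have [|_ e] := hd w v aw (ltW wv) vb _ u (ltW wu) uv; first lra.
have [-> _] := hd u v au uv vb vu u (lexx _) uv.
by rewrite e; congr EFin; ring.
Qed.

(** The potential from [geodesic_calibration] is strictly increasing as [g] is timelike, and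
    continuous as [tau] is small near the diagonal. Its inverse, scaled to [[0, 1]], parametrizes
    [g] with constant speed. *)
Lemma tg_of_geodesic x y a b g : timelike_geodesic S x y a b g ->
  exists c l (f : R -> R), [/\ tg S c l, c 0 = x /\ c 1 = y, continuous f,
    forall s t, a <= s -> s < t -> t <= b -> f s < f t &
    [/\ f a = 0, f b = 1 & forall t, a <= t -> t <= b -> g t = c (f t)]].
Proof.
move=> [[[cv hl] ga gb] gg]; have ab := curve_lt cv; have [_ _ lg] := cv.
have [d d0 [psi hpsi]] := geodesic_calibration gg.
have cg := lipschitz_continuous (ltW ab) lg.
have xx z : tau S z z = 0%E by exact: tau_xx.
pose f t := psi (clamp a b t) - psi a.
have fE t : a <= t -> t <= b -> f t = psi t - psi a by move=> ? ?; rewrite /f clamp_id.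
have finc s t : a <= s -> s < t -> t <= b -> f s < f t.
  move=> as_ st tb.
  have small u v : a <= u -> u < v -> v <= b -> v - u <= d -> f u < f v.
    move=> au uv vb vu; rewrite !fE ?(ltW (le_lt_trans au uv)) ?(ltW (lt_le_trans uv vb))//.
    rewrite ltrD2r -subr_gt0 -lte_fin -hpsi ?(ltW uv)//; apply/(tau_pos hX); apply: hl => //.
      by rewrite in_cc; split=> //; exact: ltW (lt_le_trans uv vb).
    by rewrite in_cc; split=> //; exact: ltW (le_lt_trans au uv).
  have [n hn] := archi_mul (t - s) d0.
  elim: n t st tb hn => [|n ih] t st tb; first by rewrite mul0r; lra.
  rewrite -addn1 natrD mulrDl mul1r => hn.
  have [ts|dts] := leP (t - s) d; first exact: small.
  apply: (lt_trans (ih (t - d) _ _ _)); [lra|lra|lra|].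
  by apply: small; lra.
have cf : continuous f.
  move=> t; apply/cvgrPdist_lt => e e0.
  have [ta tb] := clamp_in t (ltW ab).
  have [U [nU cU _]] := cmp_near hX hgh hreg hconc (g (clamp a b t)).
  have Ut := nbhs_singleton nU.
  have trxx z : tr S z z = 0 by rewrite /tr xx.
  have h1 : (fun u => tr S (g (clamp a b u)) (g (clamp a b t))) @ t --> (0 : R).
    rewrite -(trxx (g (clamp a b t))); apply: (tr_lim cU Ut Ut); last exact: cvg_cst.
    exact: cg.
  have h2 : (fun u => tr S (g (clamp a b t)) (g (clamp a b u))) @ t --> (0 : R).
    rewrite -(trxx (g (clamp a b t))); apply: (tr_lim cU Ut Ut); first exact: cvg_cst.
    exact: cg.
  near=> u; have [ua ub] := clamp_in u (ltW ab).
  have du : `|clamp a b u - clamp a b t| < d.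
    apply: le_lt_trans (clamp_dist _ _ _ _) _; near: u; exact: near_dist.
  have l1 : tr S (g (clamp a b u)) (g (clamp a b t)) < e.
    by near: u; exact: (cvgr_lt _ h1 _ e0).
  have l2 : tr S (g (clamp a b t)) (g (clamp a b u)) < e.
    by near: u; exact: (cvgr_lt _ h2 _ e0).
  have -> : f t - f u = psi (clamp a b t) - psi (clamp a b u) by rewrite /f; ring.
  move: du; rewrite ltr_norml => /andP[du1 du2].
  have [le|lt] := leP (clamp a b t) (clamp a b u).
    have := hpsi _ _ ta le ub (ltW du2); move: l2; rewrite /tr => + e1; rewrite e1 /= => l2.
    have := tau_ge0 hX (g (clamp a b t)) (g (clamp a b u)); rewrite e1 lee_fin => p0.
    by rewrite distrC ger0_norm.
  have := hpsi _ _ ua (ltW lt) tb; move: l1; rewrite /tr => + e1; rewrite e1 /= => [l1|]; last lra.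
  have := tau_ge0 hX (g (clamp a b u)) (g (clamp a b t)); rewrite e1; last lra.
  by rewrite lee_fin => p0; rewrite ger0_norm.
have [k [ck hk kin fk kf]] := increasing_inverse ab cf finc.
pose L := f b; have fa : f a = 0 by rewrite fE ?subrr// ltW.
have L0 : 0 < L by rewrite /L -fa; exact: finc.
rewrite fa -/L in fk.
pose k' r := k (r * L).
have ck' : continuous k'.
  have -> : k' = k \o ( *%R^~ L) by [].
  by move=> r; apply: continuous_comp; [exact: mulrr_continuous|exact: ck].
have homk r s : r <= s -> k' r <= k' s by move=> rs; apply: hk; rewrite ler_wpM2r// ltW.
have k'in r : a <= k' r /\ k' r <= b by exact: kin.
have rL r : 0 <= r -> r <= 1 -> 0 <= r * L /\ r * L <= L.
  by move=> r0 r1; rewrite mulr_ge0 ?(ltW L0)// ger_pMl.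
have ka : k' 0 = a by rewrite /k' mul0r -fa kf// ltW.
have kb : k' 1 = b by rewrite /k' mul1r /L kf// ltW.
exists (fun r => g (k' r)), L, (fun t => f t / L); split.
- split=> //.
    have -> : (fun r => g (k' r)) = (fun s => g (clamp a b s)) \o k'.
      by apply/funext => r /=; have [? ?] := k'in r; rewrite clamp_id.
    by move=> r; apply: continuous_comp; [exact: ck'|exact: cg].
  apply: (uniform_window (Q := fun r s => tau S (g (k' r)) (g (k' s)) = (L * (s - r))%:E)) => t t0 t1.
  have d2 : 0 < d / 2 by rewrite divr_gt0.
  have /near_distP[e e0 he] := ck' t _ (near_dist (k' t) d2).
  exists e => // r s r0 rs s1 rt st; have [? ?] := k'in r; have [? ?] := k'in s.
  have /= h1 := he r rt; have /= h2 := he s st.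
  rewrite hpsi ?homk//; last first.
    by move: h1 h2; rewrite !ltr_norml => /andP[? ?] /andP[? ?]; lra.
  have r1 := le_trans rs s1; have s0 := le_trans r0 rs.
  have [? ?] := rL r r0 r1; have [? ?] := rL s s0 s1.
  have e1 : f (k' r) = r * L by exact: fk.
  have e2 : f (k' s) = s * L by exact: fk.
  rewrite !fE// in e1 e2.
  by congr EFin; rewrite mulrBr ![L * _]mulrC -e1 -e2; ring.
- by rewrite ka kb.
- by move=> t; apply: cvgMl; exact: cf.
- by move=> s t as_ st tb; rewrite ltr_pM2r ?invr_gt0//; exact: finc.
- rewrite fa mul0r divff ?gt_eqF//; split=> // t at_ tb.
  by rewrite /k' divfK ?gt_eqF// kf.
Unshelve. all: by end_near. Qed.

End Realization.

(** * Uniqueness and continuous dependence *)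

Section Uniqueness.
Context {R : realType} {X : metricType R} (S : causal_data R X).
Context (hX : lorentzian_length_space S) (hgh : globally_hyperbolic S) (hreg : regular S).
Context (hconc : locally_concave S) (hone : future_one_connected S).
Implicit Types (x y z p q m : X) (g h c : R -> X) (a b l : R).

Let hS : tame S := tame_of_concave hX hgh hreg hconc.

Let in01 (t : R) : 0 <= t -> t <= 1 -> t \in `[0, 1].
Proof. by move=> t0 t1; rewrite in_itv /= t0. Qed.

Lemma tg_lipschitz_param c l : tg S c l -> exists h (k : R -> R),
  [/\ timelike_from_to S (c 0) (c 1) 0 1 h, continuous k,
      forall r, 0 < r -> r <= 1 -> 0 < k r, (forall r, k r <= 1) /\ k 1 = 1 &
      forall r, 0 <= r -> r <= 1 -> h r = c (k r)].
Proof.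
move=> tc; have [a [b [h [f [[th _] cf mf [f0 f1] ch]]]]] := geodesic_of_tg hX hgh hreg hconc tc.
have [[cv hl] ha hb] := th; have ab := curve_lt cv; have [_ [u [v [Du Dv ne]]] lh] := cv.
have ba : 0 < b - a by rewrite subr_gt0.
pose w (t : R) := a + t * (b - a).
pose f' t := (f t - a) / (b - a).
have wf t : w (f' t) = f t by rewrite /w /f' divfK ?gt_eqF// subrKC.
have win t : 0 <= t -> t <= 1 -> a <= w t /\ w t <= b.
  move=> t0 t1; rewrite lerDl mulr_ge0// ?(ltW ba)//; split=> //.
  have : t * (b - a) <= b - a by rewrite ger_pMl.
  by rewrite /w; lra.
have mf' s t : 0 <= s -> s < t -> t <= 1 -> f' s < f' t.
  by move=> s0 st t1; rewrite ltr_pM2r ?invr_gt0// ltrD2r; exact: mf.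
have cf' : continuous f'.
  by move=> t; apply: cvgMl; apply: cvgB; [exact: cf|exact: cvg_cst].
have [k [ck hk kin fk kf]] := increasing_inverse ltr01 cf' mf'.
have f'0 : f' 0 = 0 by rewrite /f' f0 subrr mul0r.
have f'1 : f' 1 = 1 by rewrite /f' f1 divff ?gt_eqF.
rewrite f'0 f'1 in fk.
have w01 (s t : R) : s < t -> w s < w t by move=> st; rewrite ltrD2l ltr_pM2r.
have ll s t : 0 <= s -> s < t -> t <= 1 -> cll S (h (w s)) (h (w t)).
  move=> s0 st t1; have [? ?] := win s s0 (le_trans (ltW st) t1).
  by have [? ?] := win t (le_trans s0 (ltW st)) t1; apply: hl; rewrite ?in_cc//; exact: w01.
exists (fun t => h (w t)), k; split=> //.
- split; last 2 first.
  + by rewrite /w mul0r addr0.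
  + by rewrite /w mul1r subrKC.
  split; last by move=> s t; rewrite !in_cc => -[? ?] [? ?] st; exact: ll.
  split; first exact: interval_is_interval.
    exists 0, 1; rewrite !in_cc !lexx ler01; split=> // e.
    by apply: (ll_irr hS (x := h (w 0))); rewrite {2}e; exact: ll.
  apply: (@locally_lipschitz_comp _ _ _ _ _ w (b - a) lh).
    by move=> t; rewrite !in_cc => -[? ?]; exact: win.
  move=> s t _ _; have -> : w s - w t = (b - a) * (s - t) by rewrite /w; ring.
  by rewrite normrM gtr0_norm.
- move=> r r0 r1; have [k0 _] := kin r; rewrite lt_neqAle k0 andbT.
  by apply/eqP => e; have := fk r (ltW r0) r1; rewrite -e f'0 => e0; rewrite e0 ltxx in r0.
- by split; [move=> r; have [] := kin r|rewrite -[in LHS]f'1 kf].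
- move=> r r0 r1; have [k0 k1] := kin r; rewrite ch// -wf fk//.
Qed.

Lemma tg_unique c c' l l' : tg S c l -> tg S c' l' -> c 0 = c' 0 -> c 1 = c' 1 ->
  forall t, 0 <= t -> t <= 1 -> c t = c' t.
Proof.
move=> tc tc' e0 e1.
have [h [k [th ck kpos [kle k1] hE]]] := tg_lipschitz_param tc.
have [h' [k' [th' ck' kpos' [kle' k1'] hE']]] := tg_lipschitz_param tc'.
rewrite -e0 -e1 in th'.
(* The homotopy runs from [c'] at [s = 0] to [c] at [s = 1]. Clamping both variables makes it a fan
   with these two geodesics prescribed. *)
have [H0 [cH H00 H01 H0t] H0e] := proj2 hone _ _ _ _ th' th.
pose K (t : R) := clamp 0 1 t.
have Kin t : 0 <= K t /\ K t <= 1 by exact: clamp_in.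
have KE t : 0 <= t -> t <= 1 -> K t = t by exact: clamp_id.
pose H s t := H0 (K s, K t).
have hH : timelike_fan S (c 0) H (fun i => if i then 1 else 0)
    (fun i => if i then c else c') (fun i => if i then k else k').
  split.
  - move: cH => /subspace_continuousP cH -[s t] W nW.
    have [s0 s1] := Kin s; have [t0 t1] := Kin t.
    have in_sq s' t' : ([set` `[0, 1]] `*` [set` `[0, 1]]) (K s', K t').
      by have [? ?] := Kin s'; have [? ?] := Kin t'; split; rewrite in_cc.
    have h1 : \forall z \near (K s, K t), ([set` `[0, 1]] `*` [set` `[0, 1]]) z -> W (H0 z).
      exact: (cH (K s, K t) (in_sq s t) W nW).
    have cK : (fun z : R * R => (K z.1, K z.2)) @ (s, t) --> (K s, K t).
      have c1 : (fun z : R * R => K z.1) @ (s, t) --> K s.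
        by apply: continuous_comp; [exact: cvg_fst|exact: continuous_clamp].
      have c2 : (fun z : R * R => K z.2) @ (s, t) --> K t.
        by apply: continuous_comp; [exact: cvg_snd|exact: continuous_clamp].
      exact: (cvg_pair c1 c2).
    have h2 : \forall z \near (s, t), ([set` `[0, 1]] `*` [set` `[0, 1]]) (K z.1, K z.2) ->
        W (H0 (K z.1, K z.2)) by exact: cK h1.
    by apply: filterS h2 => z hz; apply: hz.
  - move=> s t t' t0 tt' t1; have [s0 s1] := Kin s.
    have [_ hl] := H0t (K s) (in01 s0 s1).
    have t'0 := le_trans t0 (ltW tt'); have t1' := le_trans (ltW tt') t1.
    by rewrite /H (KE t)// (KE t')//; apply: hl; rewrite ?in_cc.
  - move=> s; have [s0 s1] := Kin s; have [] := H0e (K s) (in01 s0 s1).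
    by rewrite /H (KE 0).
  - by case=> _ _; [exists l|exists l'].
  - by case.
  - by case.
  - by case=> t _ _; [exact: kpos|exact: kpos'].
  - by case=> t _ _ _ _; [exact: kle|exact: kle'].
  - case=> t _ _ t0 t1; rewrite /H (KE t)//.
      by rewrite (KE 1)// H01 ?in01// hE.
    by rewrite (KE 0)// H00 ?in01// hE'.
move=> t t0 t1.
apply: (tg_unique_of_homotopy hS (y := c 1) hH) => //; last by case.
by move=> s s0 s1; have [_] := H0e s (in01 s0 s1); rewrite /H (KE s)// (KE 1).
Qed.

Lemma tg_exists x y : cll S x y -> exists c l, [/\ tg S c l, c 0 = x & c 1 = y].
Proof.
move=> xy; have [a [b [g [ab cg ga gb gll]]]] := timelike_curve hX xy.
have ba : 0 < b - a by rewrite subr_gt0.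
have [| | |c [l [tc c0 c1]]] := tg_exists_of_curve hS (g := fun t => g (a + t * (b - a))) (x := x).
- move=> t; have cw : {for t, continuous (fun t : R => a + t * (b - a))}.
    by apply: cvgD; [exact: cvg_cst|apply: cvgMl; exact: cvg_id].
  exact: (cvg_comp _ _ cw (cg _)).
- move=> s t s0 st t1; apply: gll.
  + by rewrite lerDl mulr_ge0// ltW.
  + by rewrite ltrD2l ltr_pM2r.
  + have : t * (b - a) <= b - a by rewrite ger_pMl.
    lra.
- by rewrite mul0r addr0.
by exists c, l; split=> //; rewrite c1 mul1r subrKC.
Qed.

Lemma tg_cs_geodesic c l : tg S c l -> cs_timelike_geodesic S (c 0) (c 1) c.
Proof.
move=> tc; split.
  exists l => t; rewrite in_itv /= => /andP[t0 t1].
  rewrite (curve_length_tg hX hgh hreg hconc (f := id) tc) ?subr0//; first by move=> ?; exact: cvg_id.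
  by move=> u v u0 uv vt; rewrite (le_trans vt).
have [a [b [h [f [gh cf mf [f0 f1] ch]]]]] := geodesic_of_tg hX hgh hreg hconc tc.
exists a, b, h; split=> //; exists f; split=> //.
- exact: continuous_subspaceT.
- move=> s t; rewrite !in_itv /= => /andP[s0 _] /andP[_ t1].
  by rewrite le_eqVlt => /predU1P[-> //|st]; apply: ltW; exact: mf.
- by move=> t; rewrite in_itv /= => /andP[t0 t1]; exact: ch.
Qed.

Lemma partition_sum_eq (d : X -> X -> \bar R) g h a b s : itv_partition a b s ->
  (forall t, a <= t -> t <= b -> g t = h t) ->
  partition_sum d a b g s = partition_sum d a b h s.
Proof.
elim: s a => [a _ _|t s ih a /partition_split[at_ ps] e]; first by rewrite !partition_sum_nil.
have tb := itv_partition_le ps.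
rewrite !partition_sum_cons ih// => [|u tu]; last exact: e (le_trans (ltW at_) tu).
by rewrite !e// ?(ltW at_)// (le_trans (ltW at_)).
Qed.

Lemma curve_length_eq g h a b : (forall t, a <= t -> t <= b -> g t = h t) ->
  curve_length S a b g = curve_length S a b h.
Proof.
move=> e; congr ereal_inf; apply/seteqP; split=> _ [s ps <-]; exists s => //.
  by apply: partition_sum_eq => // t at_ tb; rewrite e.
exact: partition_sum_eq.
Qed.

(** A constant-speed geodesic is [c o eta] for a monotone time change [eta]. Comparing lengths on
    [[0, t]] gives [l * eta t = v * t], and [eta 1 = 1] leaves only the identity. *)
Lemma cs_geodesic_tg x y g : cs_timelike_geodesic S x y g -> exists c l,
  [/\ tg S c l, c 0 = x, c 1 = y & forall t, 0 <= t -> t <= 1 -> g t = c t].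
Proof.
move=> [[v hv] [a [b [h [gh [phi [cphi mphi phi0 phi1 gE]]]]]]].
have [c [l [f [tc [c0 c1] cf mf [fa fb hE]]]]] := tg_of_geodesic hX hgh hreg hconc gh.
pose eta t := f (phi (clamp 0 1 t)).
have ceta : continuous eta.
  have c' := continuous_within_clamp ler01 cphi.
  by move=> t; exact: (cvg_comp _ _ (c' t) (cf _)).
have phiin t : 0 <= t -> t <= 1 -> a <= phi t /\ phi t <= b.
  by move=> t0 t1; rewrite -phi0 -phi1; split; apply: mphi => //; exact: in01.
have etaE t : 0 <= t -> t <= 1 -> eta t = f (phi t) by move=> ? ?; rewrite /eta clamp_id.
have gc t : 0 <= t -> t <= 1 -> g t = c (eta t).
  by move=> t0 t1; have [? ?] := phiin t t0 t1; rewrite gE ?in01// hE// etaE.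
have mf' s t : a <= s -> s <= t -> t <= b -> f s <= f t.
  by move=> as_; rewrite le_eqVlt => /predU1P[-> //|st] tb; apply: ltW; exact: mf.
have eta0 : eta 0 = 0 by rewrite etaE// phi0.
have eta1 : eta 1 = 1 by rewrite etaE// phi1.
have meta s t : 0 <= s -> s <= t -> t <= 1 -> eta s <= eta t.
  move=> s0 st t1; have s1 := le_trans st t1; have t0 := le_trans s0 st.
  have [? ?] := phiin s s0 s1; have [? ?] := phiin t t0 t1.
  by rewrite !etaE//; apply: mf' => //; apply: mphi => //; exact: in01.
have len t : 0 <= t -> t <= 1 -> (l * eta t = v * t)%R.
  move=> t0 t1; have := hv t (in01 t0 t1).
  rewrite (curve_length_eq (h := fun t => c (eta t))).
    rewrite (curve_length_tg hX hgh hreg hconc tc ceta _ t0).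
      by rewrite eta0 subr0 => -[].
    move=> r s r0 rs st; have s1 := le_trans st t1.
    by split; [rewrite -eta0|split; [|rewrite -eta1]]; apply: meta => //; [exact: le_trans rs s1|exact: le_trans r0 rs].
  by move=> u u0 ut; apply: gc => //; exact: le_trans ut t1.
have [l0 _ _] := tc.
have vl : v = l by have := len 1 ler01 (lexx _); rewrite eta1 !mulr1.
exists c, l; split=> // t t0 t1; rewrite gc//; congr c.
by have := len t t0 t1; rewrite vl; exact/mulfI/lt0r_neq0.
Qed.

End Uniqueness.

Theorem theorem1p4 (R : realType) (X : metricType R) (S : causal_data R X)
  (hX : lorentzian_length_space S)
  (hgh : globally_hyperbolic S)
  (hreg : regular S)
  (hconc : locally_concave S)
  (hone : future_one_connected S) :
  (forall x y : X, cll S x y ->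
     exists c : R -> X, unique_timelike_geodesic S x y c) /\
  (forall G : X -> X -> R -> X,
     (forall x y : X, cll S x y -> cs_timelike_geodesic S x y (G x y)) ->
     {within [set p : X * X * R | cll S p.1.1 p.1.2 /\ p.2 \in `[0, 1]],
       continuous (fun p : X * X * R => G p.1.1 p.1.2 p.2)}).
Proof.
have hS := tame_of_concave hX hgh hreg hconc.
have uniq := tg_unique hX hgh hreg hconc hone.
split=> [x y xy|G hG].
  have [c [l [tc c0 c1]]] := tg_exists hX hgh hreg hconc xy.
  exists c; split; first by have := tg_cs_geodesic hX hgh hreg hconc tc; rewrite c0 c1.
  move=> a b g /(tg_of_geodesic hX hgh hreg hconc) [c' [l' [f [tc' [c'0 c'1] cf mf [fa fb gE]]]]].
  have mf' s t : a <= s -> s <= t -> t <= b -> f s <= f t.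
    by move=> as_; rewrite le_eqVlt => /predU1P[-> //|st] tb; apply: ltW; exact: mf.
  exists f; split=> //; first exact: continuous_subspaceT.
    by move=> s t; rewrite !in_itv /= => /andP[? _] /andP[_ ?] ?; exact: mf'.
  move=> t; rewrite in_itv /= => /andP[at_ tb]; rewrite gE// (uniq _ _ _ _ tc' tc) ?c0 ?c1//.
    by rewrite -fa; exact: mf'.
  by rewrite -fb; exact: mf'.
apply/subspace_continuousP => -[[x y] t] /= [xy]; rewrite in_itv /= => /andP[t0 t1].
have [c [l [tc c0 c1 Gc]]] := cs_geodesic_tg hX hgh hreg hconc (hG x y xy).
apply/metricType_numDomainType.cvgrPdist_lt => e e0; have e2 : 0 < e / 2 by rewrite divr_gt0.
(* For ends near [(x, y)] there is a geodesic uniformly close to [c]; by global uniqueness it is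
   [G x' y']. *)
have near_s := tg_exists_near hS tc e2; rewrite c0 c1 in near_s.
have [_ cc _] := tc.
have near_t : \forall r \near t, mdist (c t) (c r) < e / 2 by exact: cvg_near_mdist (cc t) e2.
rewrite near_withinE.
exists ([set z | exists s k, [/\ tg S s k, s 0 = z.1, s 1 = z.2 & near_geo (e / 2) c s]],
  [set r | mdist (c t) (c r) < e / 2]); first by split.
move=> [[x' y'] r] /= [[s [k [ts s0 s1 ns]]] dr] [xy']; rewrite in_itv /= => /andP[r0 r1].
have [c' [l' [tc' c'0 c'1 Gc']]] := cs_geodesic_tg hX hgh hreg hconc (hG x' y' xy').
rewrite /from_subspace /= Gc// Gc'// (uniq _ _ _ _ tc' ts) ?c'0 ?c'1 ?s0 ?s1//.
apply: le_lt_trans (metric_triangle _ (c r) _) _.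
by rewrite (splitr e) ltrD// ns.
Qed.
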